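(* Let $\alpha:\mathbb{R}\to(0,\infty)$ be a continuous function with $0<\inf_{z\in\mathbb{R}}\alpha(z)\le\sup_{z\in\mathbb{R}}\alpha(z)<\infty$ and $\lim_{z\to\infty}\alpha(z)=1$. Let $(L_t)_{t\ge 0}$ be a real-valued Lévy process satisfying $\mathbf{E}[\exp(L_1)]=1$. Let $(X_t)_{t\ge0}$ be the time-changed process given by $X_t(x)=L_{T_x(t)}+x$ for $t\ge 0$, $x\in\mathbb{R}$, where $T_x(t)=\inf\{s\ge0 \mid \int_0^s\alpha(L_r+x)\,\mathrm{d}r>t\}$. Let $\{U^{(i)}\}_{i\in\mathbb{N}}$ be a Poisson point process on $\mathbb{R}$ with intensity measure $\alpha(x)\exp(-x)\,\mathrm{d}x$, and let $(X^{(i)}_t)_{t\ge0}$, $i\in\mathbb{N}$, be i.i.d. copies of $(X_t)_{t\ge0}$, independent of $\{U^{(i)}\}_{i\in\mathbb{N}}$. Consider the process $(Z_t)_{t\ge0}$ defined by $$Z_t=\max_{i\in\mathbb{N}}X^{(i)}_t(U^{(i)}),\qquad t\ge0.$$ Then, almost surely, $(Z_t)_{t\ge0}$ has paths in $\mathbb{D}([0,\infty))$, and $(Z_t)_{t\ge0}$ is stationary. If, furthermore, $(L_t)_{t\ge0}$ has continuous paths, then, almost surely, $(Z_t)_{t\ge0}$ has paths in $\mathbb{C}([0,\infty))$.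
   Context: Lévy processes are real-valued, started at $L_0=0$, with càdlàg paths. $\mathbb{D}([0,\infty))$ is the set of real-valued càdlàg functions on $[0,\infty)$ and $\mathbb{C}([0,\infty))$ the set of real-valued continuous functions on $[0,\infty)$. $X_t(x)$ denotes the process at time $t$ started in $x$ at time $0$; thus the $i$-th copy $X^{(i)}$ is built from an independent copy $L^{(i)}$ of $L$ and is started at the random point $U^{(i)}$. A process $(Z_t)_{t\ge0}$ is stationary if for all $0\le t_1<\cdots<t_\ell<\infty$, $\ell\in\mathbb{N}$, and all $h\ge0$, the vectors $(Z_{t_1},\ldots,Z_{t_\ell})$ and $(Z_{t_1+h},\ldots,Z_{t_\ell+h})$ have the same distribution. *)

(* Defs.v *)
From mathcomp Require Export all_boot all_order all_algebra.
From mathcomp Require Export all_classical all_reals all_analysis.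
(* [measurable_realfun], which provides the Borel sigma-algebra of \bar R, is
   not part of [all_analysis]. *)
From mathcomp Require Export measurable_realfun.

Set Implicit Arguments.
Unset Strict Implicit.
Unset Printing Implicit Defensive.

Import Order.TTheory GRing.Theory Num.Theory.
Import numFieldNormedType.Exports.

Local Open Scope classical_set_scope.
Local Open Scope ring_scope.

(* A function or a process indexed by [0, +oo[ is encoded as a total function
   on R; no definition below depends on its values at negative times. *)

Section path_spaces.
Context {R : realType}.

Definition cadlag (f : R -> R) : Prop :=
  (forall t, 0 <= t -> f x @[x --> t^'+] --> f t) /\
  (forall t, 0 < t -> cvg (f x @[x --> t^'-])).

Definition continuous_path (f : R -> R) : Prop :=
  {within `[0, +oo[, continuous f}.

Definition is_max (A : set R) (m : R) : Prop := A m /\ ubound A m.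

End path_spaces.

Section laws_and_independence.
Context {R : realType}.

Definition same_law d1 d2 d (T1 : measurableType d1) (T2 : measurableType d2)
    (T : measurableType d) (P1 : probability T1 R) (P2 : probability T2 R)
    (X : T1 -> T) (Y : T2 -> T) : Prop :=
  forall A, measurable A -> P1 (X @^-1` A) = P2 (Y @^-1` A).

Definition time_vector (T : Type) (Z : R -> T -> R) (n : nat)
    (t : n.-tuple R) (w : T) : n.-tuple R :=
  [tuple Z (tnth t k) w | k < n].

Definition same_process_law d1 d2 (T1 : measurableType d1)
    (T2 : measurableType d2) (P1 : probability T1 R) (P2 : probability T2 R)
    (X : R -> T1 -> R) (Y : R -> T2 -> R) : Prop :=
  forall (n : nat) (t : n.-tuple R),
    sorted <%R t -> all (>= 0) t ->
    same_law P1 P2 (time_vector X t) (time_vector Y t).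

Definition stationary d (T : measurableType d) (P : probability T R)
    (Z : R -> T -> R) : Prop :=
  (forall t, 0 <= t -> measurable_fun setT (Z t)) /\
  (forall h, 0 <= h -> same_process_law P P Z (fun t => Z (t + h))).

Definition independent_systems d (T : measurableType d) (P : probability T R)
    (I : eqType) (G : I -> set (set T)) : Prop :=
  forall (s : seq I) (B : I -> set T),
    uniq s -> (forall i, i \in s -> G i (B i)) ->
    P (\bigcap_(i in [set` s]) B i) = (\prod_(i <- s) P (B i))%E.

Definition independent_variables d d' (T : measurableType d)
    (T' : measurableType d') (P : probability T R) (I : eqType)
    (X : I -> T -> T') : Prop :=
  independent_systems P (fun i => preimage_set_system setT (X i) measurable).

Definition generated_sigma_algebra d d' (T : measurableType d)
    (T' : measurableType d') (I : Type) (D : set I) (X : I -> T -> T') :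
    set (set T) :=
  <<s \bigcup_(i in D) preimage_set_system setT (X i) measurable >>.

End laws_and_independence.

Section levy.
Context {R : realType} d (T : measurableType d) (P : probability T R).

(* Continuity in probability is not listed: it follows from right-continuity
   of the paths and stationarity of the increments. *)
Definition levy_process (L : R -> {RV P >-> R}) : Prop :=
  [/\ {ae P, forall w, L 0 w = 0},
      forall w, cadlag (fun t => L t w),
      forall t : nat -> R, 0 <= t 0%N -> (forall k, t k < t k.+1) ->
        independent_variables P (fun k w => L (t k.+1) w - L (t k) w) &
      forall s h, 0 <= s -> 0 <= h ->
        same_law P P (fun w => L (s + h) w - L s w) (L h : T -> R)].

End levy.

Arguments levy_process {R d T} P L.

Section poisson.
Context {R : realType} d d' (T : measurableType d) (E : measurableType d')
  (P : probability T R).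

Definition nb_points (U : nat -> {RV P >-> E}) (A : set E) (w : T) : \bar R :=
  counting [set i | A (U i w)].

(* In [poisson_prob rate _ B] the second argument is unused: this is the
   probability that a Poisson variable of parameter [rate] lies in [B]
   (the Dirac mass at 0 if [rate] is 0). *)
Definition poisson_point_process (U : nat -> {RV P >-> E})
    (mu : set E -> \bar R) : Prop :=
  [/\ forall A, measurable A -> (mu A < +oo)%E -> forall k : nat,
        P [set w | nb_points U A w = (k%:R)%:E] =
          poisson_prob (fine (mu A)) 0 [set k],
      forall A, measurable A -> mu A = +oo%E ->
        P [set w | nb_points U A w = +oo%E] = 1%E &
      forall (n : nat) (A : 'I_n -> set E),
        (forall k, measurable (A k)) -> trivIset setT A ->
        independent_variables P (fun k => nb_points U (A k))].

End poisson.

Arguments poisson_point_process {R d d' T E} P U mu.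

Section time_change.
Context {R : realType}.

Definition time_change (alpha l : R -> R) (x t : R) : R :=
  inf [set s | 0 <= s /\
    (t%:E < \int[lebesgue_measure]_(r in `[0%R, s]) (alpha (l r + x))%:E)%E].

Definition time_changed (alpha l : R -> R) (x t : R) : R :=
  l (time_change alpha l x t) + x.

Definition intensity (alpha : R -> R) (A : set R) : \bar R :=
  (\int[lebesgue_measure]_(x in A) (alpha x * expR (- x))%:E)%E.

(* [sup] is the real supremum, equal to 0 on sets that are not bounded above;
   use together with [is_max]. *)
Definition max_process (T : Type) (X : nat -> R -> T -> R) (t : R) (w : T) : R :=
  sup [set X i t w | i in [set: nat]].

End time_change.

(* Main.v *)
From HB Require Import structures.
Require Import Defs.
From mathcomp Require Import ring lra zify.
Import Order.TTheory GRing.Theory Num.Theory.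
Import numFieldNormedType.Exports.
Local Open Scope classical_set_scope.
Local Open Scope ring_scope.

Set Implicit Arguments.
Unset Strict Implicit.
Unset Printing Implicit Defensive.

(** The Poisson points, marked by the paths started from them, form a Poisson
    point process on [R * path_space R]. Its intensity is [alpha (x) exp (- x) dx]
    times the law of [L], and the whole proof rests on the fact that this infinite
    measure is invariant under the time-changed flow.

    Without time change, [exp (- x) dx] times the law of [L] is invariant under
    [(x, l) |-> (x + l s, l (s + .) - l s)]: this is the Markov property, the
    translation of Lebesgue measure and [E (exp (L s)) = 1]
    ([flow_shift_invariance]). Consider then a property [E] of the time-changed
    process seen from clock time [t], and the clock time spent by a path in [E]
    during the natural time interval [0, 1]. Since the clock runs at rate
    [alpha], the mean of this time is, by the invariance just mentioned, the
    [alpha]-weighted measure of [E] at time 0 ([path_integral_strip]). Delaying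
    [E] by [h] replaces the interval of clock times [0, c] by [h, c + h], where
    [c] is the clock at natural time 1. What is lost at the beginning is the
    clock time spent before [h]; what is gained at the end is the same quantity
    for the path restarted at natural time 1. They have the same finite mean, so
    they cancel ([alpha_weighted_invariance]).

    For levels [z_k] and times [t_k], the event that [Z] stays below [z_k] at each
    time [t_k + h] says that no marked point falls in a certain region. Its
    probability is the exponential of minus the intensity of the region
    ([avoidance_probability]), which by invariance does not depend on [h]; closed
    orthants determine laws on [R ^ n], hence stationarity.

    For the regularity of the paths, Ottaviani's inequality bounds the supremum of
    [L] on a bounded interval by its terminal value, and [E (exp (L S)) = 1] makes
    the intensity of the paths that pass a given level before a given time finite
    ([exceed_before_integral_lty]). Almost surely only finitely many of the marked
    points are of this kind ([finitely_many_hits]), so that locally in time [Z] is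
    the maximum of finitely many cadlag, or continuous, paths. Continuity of the
    copies of [L] is inherited from [L] because, among cadlag paths, it is a
    measurable condition on countably many coordinates
    ([continuous_path_transfer]). *)

(** * Laws and independence on generated sigma-algebras *)

Section cylinders.
Context {R : realType} d (T : measurableType d).
Local Open Scope ereal_scope.

(** Finite intersections of generators of distinct indices form a pi-system. *)
Lemma cylinder_measure_unique (I : choiceType) (D : set I)
    (G : I -> set (set T)) (m1 m2 : {measure set T -> \bar R}) :
  (forall i, D i -> G i `<=` measurable) ->
  (forall i, D i -> setI_closed (G i)) ->
  m1 setT < +oo ->
  (forall (s : seq I) (B : I -> set T), uniq s ->
    (forall i, i \in s -> D i /\ G i (B i)) ->
    m1 (\bigcap_(i in [set` s]) B i) = m2 (\bigcap_(i in [set` s]) B i)) ->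
  forall A, <<s \bigcup_(i in D) G i >> A -> m1 A = m2 A.
Proof.
move=> Gm GI m1fin m12 A.
pose C := [set X | exists (s : seq I) (B : I -> set T), [/\ uniq s,
  forall i, i \in s -> D i /\ G i (B i) & X = \bigcap_(i in [set` s]) B i]].
have CT : C setT.
  exists [::], (fun=> setT); split => //.
  by apply/seteqP; split => x.
have Cm : C `<=` measurable.
  move=> _ [s [B [us sB ->]]].
  apply: fin_bigcap_measurable; first exact: finite_seq.
  by move=> i /sB [Di]; exact: Gm.
have CI : setI_closed C.
  move=> _ _ [s1 [B1 [us1 sB1 ->]]] [s2 [B2 [us2 sB2 ->]]].
  exists (undup (s1 ++ s2)).
  exists (fun i => if i \in s1 then if i \in s2 then B1 i `&` B2 i else B1 i
                   else B2 i); split.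
  - exact: undup_uniq.
  - move=> i; rewrite mem_undup mem_cat.
    case: ifPn => is1; last by rewrite /= => /sB2.
    have [Di G1] := sB1 _ is1.
    case: ifPn => is2 _; last by [].
    by split => //; apply: GI => //; exact: (sB2 _ is2).2.
  - apply/seteqP; split => x /=.
      move=> [h1 h2] i /=; rewrite mem_undup mem_cat.
      case: ifPn => is1; last by move=> /= /h2.
      by case: ifPn => is2 _; [split; [exact: h1|exact: h2]|exact: h1].
    move=> h; split => i /= si; have := h i;
      rewrite /= mem_undup mem_cat si ?orbT => /(_ isT).
      by case: ifPn => // _ [].
    by case: ifPn => // _ [].
move=> sA.
apply: (g_sigma_algebra_measure_unique C Cm (fun=> setT)) => //.
- by rewrite bigcup_const//; exists 0%N.
- by move=> _ [s [B [us sB ->]]]; exact: m12.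
- move: A sA; apply: sub_sigma_algebra2 => X [i Di GX].
  exists [:: i], (fun=> X); split => //.
    by move=> j; rewrite inE => /eqP ->.
  apply/seteqP; split => [x Xx j //|x /(_ i)]; apply.
  by rewrite /= inE.
Qed.

End cylinders.

Section independence.
Context {R : realType} d (T : measurableType d) (P : probability T R).
Local Open Scope ereal_scope.

(** With [B] fixed, both sides are finite measures in [A], and they agree on
    finite intersections because [k] differs from all the indices in [D]. *)
Lemma independent_sigma_algebra (I : choiceType) (G : I -> set (set T))
    (D : set I) (k : I) :
  (forall i, G i `<=` measurable) -> (forall i, setI_closed (G i)) ->
  independent_systems P G -> ~ D k ->
  forall A B, <<s \bigcup_(i in D) G i >> A -> G k B ->
    P (A `&` B) = P A * P B.
Proof.
move=> Gm GI indG Dk A B sA GB.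
have mB := Gm _ _ GB.
pose r : {nonneg R} := NngNum (fine_ge0 (measure_ge0 P B)).
have rE : r%:num%:E = P B by rewrite /= fineK// fin_num_measure.
suff : mrestr P mB A = mscale r P A by rewrite /mrestr /mscale muleC rE.
apply: (cylinder_measure_unique (D := D) (G := G)) => //.
- by rewrite /= /mrestr setTI (le_lt_trans (probability_le1 _ _)) ?ltry.
move=> s C us sC.
change (P (\bigcap_(i in [set` s]) C i `&` B) =
  r%:num%:E * P (\bigcap_(i in [set` s]) C i)); rewrite rE.
have ks : k \notin s by apply/negP => /sC[].
have := indG (k :: s) (fun i => if i == k then B else C i).
rewrite /= ks us => /(_ isT) ind1.
have H1 : forall i, i \in s -> (if i == k then B else C i) = C i.
  by move=> i si; case: eqP => // ik; move: ks; rewrite -ik si.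
have -> : (\bigcap_(i in [set` s]) C i) `&` B =
    \bigcap_(i in [set` k :: s]) (if i == k then B else C i).
  apply/seteqP; split => x /=.
    by move=> [h Bx] i /=; rewrite inE; case: eqP => // ik /= /h.
  move=> h; split.
    by move=> i /= si; have := h i; rewrite /= inE si orbT H1//; apply.
  by have := h k; rewrite /= inE eqxx; apply.
rewrite ind1; last first.
  move=> i; rewrite inE; case: eqP => [->//|_ /= /sC[]//].
rewrite big_cons eqxx; congr (_ * _).
have -> : \prod_(j <- s) P (if j == k then B else C j) = \prod_(j <- s) P (C j).
  by apply: eq_big_seq => i /H1 ->.
by rewrite indG// => i /sC[].
Qed.

End independence.

Section independent_pair.
Context {R : realType} d d' d1 d2 (T : measurableType d) (T' : measurableType d')
  (F : measurableType d1) (E : measurableType d2)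
  (P : probability T R) (P' : probability T' R).
Local Open Scope ereal_scope.

(** Fubini for an independent pair whose second component is known only in law:
    [X'] lives on another space and can therefore be integrated alone. *)
Lemma independent_pair_integral (Y : T -> F) (X : T -> E) (X' : T' -> E)
    (f : F * E -> \bar R) :
  measurable_fun setT Y -> measurable_fun setT X -> measurable_fun setT X' ->
  (forall A C, measurable A -> measurable C ->
    P (Y @^-1` A `&` X @^-1` C) = P (Y @^-1` A) * P' (X' @^-1` C)) ->
  measurable_fun setT f -> (forall z, 0 <= f z) ->
  \int[P]_w f (Y w, X w) = \int[P]_w \int[P']_w' f (Y w, X' w').
Proof.
move=> mY mX mX' ind mf f0.
have mYX : measurable_fun setT (fun w => (Y w, X w)).
  exact: measurable_fun_pair.
pose Ym : {mfun T >-> F} := HB.pack Y (isMeasurableFun.Build _ _ _ _ _ mY).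
pose Xm' : {mfun T' >-> E} := HB.pack X' (isMeasurableFun.Build _ _ _ _ _ mX').
pose YXm : {mfun T >-> (F * E)%type} :=
  HB.pack (fun w => (Y w, X w)) (isMeasurableFun.Build _ _ _ _ _ mYX).
transitivity (\int[distribution P YXm]_z f z).
  by rewrite ge0_integral_distribution.
transitivity (\int[distribution P Ym \x distribution P' Xm']_z f z).
  apply: eq_measure_integral => A mA _; apply/esym.
  exact: product_measure_unique.
rewrite fubini_tonelli1// ge0_integral_distribution//.
- apply: eq_integral => w _ /=.
  rewrite /fubini_F ge0_integral_distribution//.
  exact: measurableT_comp.
- exact: measurable_fun_fubini_tonelli_F.
- by move=> x; apply: integral_ge0.
Qed.

End independent_pair.

Section ae_tools.
Context {R : realType} d (T : measurableType d) (P : probability T R).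
Local Open Scope ereal_scope.

Lemma ae_eq_measure (A B : set T) : measurable A -> measurable B ->
  {ae P, forall w, A w <-> B w} -> P A = P B.
Proof.
move=> mA mB [N [mN N0 sub]].
have H (X Y : set T) : measurable X -> measurable Y ->
    X `<=` Y `|` N -> P X <= P Y.
  move=> mX mY XY; apply: (@le_trans _ _ (P (Y `|` N))).
    by apply: le_measure => //; rewrite inE//; exact: measurableU.
  apply: (@le_trans _ _ (P Y + P N)); last by rewrite N0 adde0.
  exact: measureU2.
have AB w : ~ N w -> A w <-> B w.
  by move=> Nw; apply: contrapT => h; apply: Nw; exact: sub.
apply/eqP; rewrite eq_le; apply/andP; split; apply: H => // w Xw;
  have [Nw|Nw] := pselect (N w); by [right|left; apply/(AB _ Nw)].
Qed.

End ae_tools.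

Section coordinate_spaces.
Context {R : realType}.
Local Open Scope ereal_scope.

(** [cylinder_measure_unique] in terms of the values of the variables [X i]. *)
Lemma preimage_cylinder_measure_unique d d' (T : measurableType d)
    (E : measurableType d') (I : choiceType) (D : set I) (X : I -> T -> E)
    (m1 m2 : {measure set T -> \bar R}) :
  (forall i, D i -> measurable_fun setT (X i)) ->
  m1 setT < +oo ->
  (forall (s : seq I) (B : I -> set E), uniq s ->
    (forall i, i \in s -> D i) -> (forall i, measurable (B i)) ->
    m1 [set w | forall i, i \in s -> B i (X i w)] =
    m2 [set w | forall i, i \in s -> B i (X i w)]) ->
  forall A, generated_sigma_algebra D X A -> m1 A = m2 A.
Proof.
move=> mX m1fin m12; apply: cylinder_measure_unique => //.
- by move=> i /mX mXi _ [B mB <-]; exact: mXi.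
- move=> i Di _ _ [B mB <-] [C mC <-]; exists (B `&` C).
    exact: measurableI.
  by rewrite !setTI preimage_setI.
move=> s B us sB.
have /choice[C hC] : forall i, exists C, measurable C /\
    (i \in s -> B i = X i @^-1` C).
  move=> i; have [si|_] := boolP (i \in s).
    by have [_ [C mC <-]] := sB _ si; exists C; rewrite setTI.
  by exists setT.
have -> : \bigcap_(i in [set` s]) B i =
    [set w | forall i, i \in s -> C i (X i w)].
  apply/seteqP; split => w /= h i si; have := h _ si; by rewrite (hC i).2.
apply: m12 => // i; first by move=> /sB [].
exact: (hC i).1.
Qed.

(** All functions on [I], with the sigma-algebra of the coordinates in [D] only. *)
Definition coordinate_space (I : Type) (D : set I) :=
  g_sigma_algebraType (\bigcup_(i in D)
    preimage_set_system setT (fun e : I -> R => e i) measurable).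
#[global] Arguments coordinate_space : clear implicits.

HB.instance Definition _ I (D : set I) := Measurable.on (coordinate_space I D).

Lemma measurable_coordinate (I : Type) (D : set I) (i : I) : D i ->
  measurable_fun setT (fun e : coordinate_space I D => e i).
Proof.
move=> Di _ B mB; apply: sub_sigma_algebra; exists i => //.
by exists B.
Qed.

Lemma measurable_to_coordinate_space d (T : measurableType d) (I : Type)
    (D : set I) (f : T -> coordinate_space I D) :
  (forall i, D i -> measurable_fun setT (fun w => f w i)) ->
  measurable_fun setT f.
Proof.
move=> mf.
apply: (@measurability _ _ _ (coordinate_space I D) _ _ (\bigcup_(i in D)
    preimage_set_system setT (fun e : I -> R => e i) measurable)) => //.
move=> _ [_ [i Di [B mB <-]] <-]; rewrite !setTI.
by have := mf _ Di measurableT B mB; rewrite setTI.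
Qed.

(** The form in which laws of processes are compared: cylinders generate the
    sigma-algebra of the coordinate space and are stable by intersection. *)
Lemma coordinate_law_unique d1 d2 (T1 : measurableType d1)
    (T2 : measurableType d2) (I : choiceType) (D : set I)
    (m1 : {measure set T1 -> \bar R}) (m2 : {measure set T2 -> \bar R})
    (X : T1 -> coordinate_space I D) (Y : T2 -> coordinate_space I D) :
  measurable_fun setT X -> measurable_fun setT Y ->
  m1 setT < +oo ->
  (forall (s : seq I) (B : I -> set R), uniq s ->
    (forall i, i \in s -> D i) -> (forall i, measurable (B i)) ->
    m1 [set w | forall i, i \in s -> B i (X w i)] =
    m2 [set w | forall i, i \in s -> B i (Y w i)]) ->
  forall A, measurable A -> m1 (X @^-1` A) = m2 (Y @^-1` A).
Proof.
move=> mX mY m1fin m12 A mA.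
suff : pushforward m1 X A = pushforward m2 Y A by [].
apply: (preimage_cylinder_measure_unique (D := D)
  (X := fun i (e : coordinate_space I D) => e i)) => //.
by move=> i Di; exact: measurable_coordinate.
Qed.

End coordinate_spaces.
Arguments coordinate_space R {I} D.

(** * Path space and the Markov property *)
Section levy_markov.
Context {R : realType} d (T : measurableType d) (P : probability T R)
  (L : R -> {RV P >-> R}) (L_levy : levy_process P L).
Local Open Scope ereal_scope.

(** Time 0 is left out: a shifted path vanishes there, whereas [L 0] does so only
    almost surely, and right-continuity recovers it from positive times. *)
Definition path_space := coordinate_space R [set t : R | (0 < t)%R].

HB.instance Definition _ := Measurable.on path_space.

Definition shift_path (s : R) (e : path_space) : path_space :=
  fun r => (e (s + r) - e s)%R.

Definition path_of : T -> path_space := fun w t => L t w.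

Lemma measurable_shift_path s : (0 < s)%R ->
  measurable_fun setT (shift_path s).
Proof.
move=> s0; apply: measurable_to_coordinate_space => t /= t0.
apply: measurable_funB; apply: measurable_coordinate => //=.
exact: addr_gt0.
Qed.

Lemma measurable_path_of : measurable_fun setT path_of.
Proof. by apply: measurable_to_coordinate_space => t _ /=. Qed.

(** The first increment along [p] is independent of the later ones, which have
    the law of the increments along [q], a sequence with the same steps. *)
Lemma increments_law (p q : nat -> R) (A : set R) :
  (0 <= p 0%N)%R -> (0 <= q 0%N)%R ->
  (forall k, p k < p k.+1)%R -> (forall k, q k < q k.+1)%R ->
  (forall k, p k.+2 - p k.+1 = q k.+1 - q k)%R ->
  measurable A ->
  forall C : set (coordinate_space R [set: nat]), measurable C ->
  P ((fun w => L (p 1%N) w - L (p 0%N) w)%R @^-1` A `&`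
     (fun w k => L (p k.+2) w - L (p k.+1) w)%R @^-1` C) =
  P ((fun w => L (p 1%N) w - L (p 0%N) w)%R @^-1` A) *
  P ((fun w k => L (q k.+1) w - L (q k) w)%R @^-1` C).
Proof.
move=> p0 q0 pS qS pq mA C mC.
have [_ _ Lind Lstat] := L_levy.
have ge0 (r : nat -> R) : (0 <= r 0%N)%R -> (forall k, r k < r k.+1)%R ->
    forall k, (0 <= r k)%R.
  move=> r0 rS; elim=> // k IH.
  by apply: le_trans IH _; exact: ltW.
have law r k B : (0 <= r 0%N)%R -> (forall k, r k < r k.+1)%R -> measurable B ->
    P ((fun w => L (r k.+1) w - L (r k) w)%R @^-1` B) =
    P (L (r k.+1 - r k)%R @^-1` B).
  move=> r0 rS mB; have h0 : (0 <= r k.+1 - r k)%R by rewrite subr_ge0 ltW.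
  by rewrite -(Lstat _ _ (ge0 r r0 rS k) h0)// subrKC.
set a := (fun w => L (p 1%N) w - L (p 0%N) w)%R.
have ma : measurable_fun setT a by apply: measurable_funB.
have mpA : measurable (a @^-1` A) by rewrite -[X in measurable X]setTI; exact: ma.
set X := (X in _ `&` X @^-1` C).
have mX : @measurable_fun _ _ _ (coordinate_space R [set: nat]) setT X.
  by apply: measurable_to_coordinate_space => k _; apply: measurable_funB.
set Y := (Y in _ * P (Y @^-1` C)).
have mY : @measurable_fun _ _ _ (coordinate_space R [set: nat]) setT Y.
  by apply: measurable_to_coordinate_space => k _; apply: measurable_funB.
pose r : {nonneg R} := NngNum (fine_ge0 (measure_ge0 P (a @^-1` A))).
have rE : r%:num%:E = P (a @^-1` A) by rewrite /= fineK// fin_num_measure.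
suff : mrestr P mpA (X @^-1` C) = mscale r P (Y @^-1` C).
  by rewrite setIC /mscale rE.
apply: (coordinate_law_unique mX mY) => //.
  by rewrite /= /mrestr setTI (le_lt_trans (probability_le1 _ _)) ?ltry.
move=> s B us _ mB.
change (P ([set w | forall i, i \in s -> B i (X w i)] `&` a @^-1` A) =
  r%:num%:E * P [set w | forall i, i \in s -> B i (Y w i)]); rewrite rE.
have YE : P [set w | forall i, i \in s -> B i (Y w i)] =
    \prod_(i <- s) P (L (q i.+1 - q i)%R @^-1` B i).
  have := Lind q q0 qS s (fun i => (fun w => L (q i.+1) w - L (q i) w)%R @^-1` B i) us.
  move=> H; rewrite (eq_bigr _ (fun i _ => esym (law q i (B i) q0 qS (mB i)))) -H//.
  by move=> i _; exists (B i) => //; rewrite setTI.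
rewrite YE.
pose BB i := if i is j.+1 then B j else A.
have uss : uniq (0%N :: map S s).
  by rewrite /= map_inj_uniq ?us ?andbT//; [apply/mapP => -[]|move=> ? ? []].
have := Lind p p0 pS (0%N :: map S s)
  (fun i => (fun w => L (p i.+1) w - L (p i) w)%R @^-1` BB i) uss.
have mBB i : measurable (BB i) by case: i.
move=> H.
transitivity (P (\bigcap_(i in [set` 0%N :: [seq i.+1 | i <- s]])
  ((fun w => L (p i.+1) w - L (p i) w)%R @^-1` BB i))).
  congr (P _); apply/seteqP; split => w /=.
    move=> [h1 h2] i /=; rewrite inE => /orP[/eqP -> //|/mapP[j js ->]].
    exact: h1.
  move=> h; split; last by have := h 0%N; rewrite /= inE eqxx; apply.
  move=> i si; have := h i.+1; rewrite /= inE /= map_f//; exact.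
rewrite H; last by move=> i _; exists (BB i) => //; rewrite setTI.
rewrite big_cons big_map; congr (_ * _).
apply: eq_bigr => i _; rewrite (law p i.+1 (B i))// pq//.
Qed.

End levy_markov.
Arguments path_space R : clear implicits.

(** Independence of increments is available along infinite increasing sequences
    only, whereas cylinders involve finite sets of times. *)
Lemma increasing_sequence_through {R : realType} (l : seq R) : uniq l ->
  (forall t, t \in l -> 0 < t) ->
  exists q : nat -> R, [/\ q 0%N = 0, forall k, q k < q k.+1 &
    forall t, t \in l -> exists k, t = q k.+1].
Proof.
move=> ul l0.
pose l' := 0 :: sort <=%R l.
have sl' : sorted <%R l'.
  rewrite /= path_min_sorted ?sort_lt_sorted//.
  by apply/allP => t; rewrite mem_sort => /l0.
(* the sorted times, continued by unit steps after the last one *)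
pose q k := nth 0 l' (minn k (size l)) + (k - size l)%:R.
have szl' : size l' = (size l).+1 by rewrite /= size_sort.
exists q; split.
- by rewrite /q min0n sub0n addr0.
- move=> k; rewrite /q; have [kl|lk] := ltnP k (size l).
    rewrite (minn_idPl kl).
    have -> : (k - size l = 0)%N by lia.
    have -> : (k.+1 - size l = 0)%N by lia.
    rewrite !addr0.
    by apply: (sorted_ltn_nth lt_trans) => //; rewrite inE szl'; lia.
  rewrite (minn_idPr (leqW lk)) ltrD2l ltr_nat; lia.
- move=> t tl; have : t \in l' by rewrite inE mem_sort tl orbT.
  move=> tl'; exists (index t l').-1.
  have i0 : (0 < index t l')%N.
    by rewrite /=; case: eqP => // t0; move: (l0 _ tl); rewrite -t0 ltxx.
  have il : (index t l' <= size l)%N by rewrite -ltnS -szl' index_mem.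
  rewrite /q prednK// (minn_idPl il).
  have -> : (index t l' - size l = 0)%N by lia.
  by rewrite addr0 nth_index.
Qed.

Section levy_markov.
Context {R : realType} d (T : measurableType d) (P : probability T R)
  (L : R -> {RV P >-> R}) (L_levy : levy_process P L).
Local Open Scope ereal_scope.

(** Simple Markov property. On a cylinder, the values of the shifted path are
    partial sums of increments after [s] along one increasing sequence of times,
    to which [increments_law] applies. *)
Lemma levy_markov (s : R) (A : set R) (C : set (path_space R)) : (0 < s)%R ->
  measurable A -> measurable C ->
  P (L s @^-1` A `&` (fun w => shift_path s (path_of L w)) @^-1` C) =
  P (L s @^-1` A) * P (path_of L @^-1` C).
Proof.
move=> s0 mA mC.
have [L0 _ Lind Lstat] := L_levy.
have mL t : measurable_fun setT (L t) by [].
have mLA : measurable (L s @^-1` A).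
  by rewrite -[X in measurable X]setTI; exact: mL.
have mX : measurable_fun setT (fun w => shift_path s (path_of L w)).
  apply: (measurableT_comp (f := shift_path s)).
    exact: measurable_shift_path.
  exact: measurable_path_of.
have mY := measurable_path_of L.
pose r : {nonneg R} := NngNum (fine_ge0 (measure_ge0 P (L s @^-1` A))).
have rE : r%:num%:E = P (L s @^-1` A) by rewrite /= fineK// fin_num_measure.
suff : mrestr P mLA ((fun w => shift_path s (path_of L w)) @^-1` C)
    = mscale r P (path_of L @^-1` C).
  by rewrite setIC /mscale rE.
apply: (coordinate_law_unique mX mY) => //.
  by rewrite /= /mrestr setTI (le_lt_trans (probability_le1 _ _)) ?ltry.
move=> l B ul l0 mB.
change (P ([set w | forall i, i \in l -> B i (L (s + i)%R w - L s w)%R] `&`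
    L s @^-1` A) =
  r%:num%:E * P [set w | forall i, i \in l -> B i (L i w)]); rewrite rE.
have [q [q0 qS lq]] := increasing_sequence_through ul l0.
have /choice[kk hkk] : forall t, exists k, t \in l -> t = q k.+1.
  move=> t; have [/lq[k ->]|_] := boolP (t \in l); by [exists k|exists 0%N].
(* the first increment along [p] is [L s]; the others are those of the shifted
   path along [q] *)
pose p k := if k is j.+1 then (s + q j)%R else 0%R.
have pS k : (p k < p k.+1)%R.
  by case: k => [|k] /=; rewrite ?q0 ?addr0// ltrD2l.
pose D : set (coordinate_space R [set: nat]) :=
  [set x : nat -> R | forall t, t \in l -> B t (\sum_(j < (kk t).+1) x j)%R].
have mD : measurable D.
  rewrite (_ : D = \bigcap_(t in [set` l])
    ((fun x : coordinate_space R [set: nat] => (\sum_(j < (kk t).+1) x j)%R)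
       @^-1` B t)); last by apply/seteqP; split.
  apply: fin_bigcap_measurable; first exact: finite_seq.
  move=> t _; rewrite -[X in measurable X]setTI.
  have : measurable_fun setT
      (fun x : coordinate_space R [set: nat] => (\sum_(j < (kk t).+1) x j)%R).
    apply: measurable_sum => j.
    exact: measurable_coordinate.
  by apply.
have sumE (u : nat -> R) n w : (\sum_(j < n) (L (u j.+1) w - L (u j) w) =
    L (u n) w - L (u 0%N) w)%R.
  by rewrite -(big_mkord xpredT (fun j => L (u j.+1) w - L (u j) w)%R) telescope_sumr.
have p0 : (0 <= p 0%N)%R by [].
have q0' : (0 <= q 0%N)%R by rewrite q0.
have pq k : (p k.+2 - p k.+1 = q k.+1 - q k)%R by rewrite /p; ring.
have H := increments_law L_levy p0 q0' pS qS pq mA mD.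
have mpre (l' : seq R) (X : R -> T -> R) : (forall t, measurable_fun setT (X t)) ->
    measurable [set w | forall i, i \in l' -> B i (X i w)].
  move=> mXt; rewrite (_ : [set w | _] = \bigcap_(t in [set` l']) (X t @^-1` B t)).
    apply: fin_bigcap_measurable; first exact: finite_seq.
    by move=> t _; rewrite -[X in measurable X]setTI; exact: mXt.
  by apply/seteqP; split.
transitivity (P ((fun w => L (p 1%N) w - L (p 0%N) w)%R @^-1` A `&`
     (fun w k => L (p k.+2) w - L (p k.+1) w)%R @^-1` D)).
  apply: ae_eq_measure.
  - apply: measurableI => //; apply: mpre => t.
    exact: measurable_funB.
  - apply: measurableI.
      rewrite -[X in measurable X]setTI.
      have : measurable_fun setT (fun w => L (p 1%N) w - L (p 0%N) w)%R.
        exact: measurable_funB.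
      exact.
    rewrite -[X in measurable X]setTI.
    have : @measurable_fun _ _ _ (coordinate_space R [set: nat]) setT
        (fun w k => L (p k.+2) w - L (p k.+1) w)%R.
      by apply: measurable_to_coordinate_space => k _; exact: measurable_funB.
    exact.
  apply: filterS L0 => w L0w; rewrite /= q0 addr0 L0w subr0.
  rewrite /setI /= [X in _ <-> X]and_comm.
  suff DE : D (fun k => L (s + q k.+1) w - L (s + q k) w)%R <->
      forall i, i \in l -> B i (L (s + i)%R w - L s w)%R by rewrite DE.
  by split => h t tl; have := h t tl;
    rewrite (sumE (fun k => s + q k)%R) q0 addr0 -hkk.
rewrite H; congr (_ * _).
  apply: ae_eq_measure => //.
    rewrite -[X in measurable X]setTI.
    have : measurable_fun setT (fun w => L (p 1%N) w - L (p 0%N) w)%R.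
      exact: measurable_funB.
    exact.
  by apply: filterS L0 => w L0w; rewrite /= q0 addr0 L0w subr0.
apply: ae_eq_measure.
- rewrite -[X in measurable X]setTI.
  have : @measurable_fun _ _ _ (coordinate_space R [set: nat]) setT
      (fun w k => L (q k.+1) w - L (q k) w)%R.
    by apply: measurable_to_coordinate_space => k _; exact: measurable_funB.
  exact.
- exact: mpre.
apply: filterS L0 => w L0w.
by split => h t tl; have := h t tl; rewrite (sumE q) q0 L0w subr0 -hkk.
Qed.

Lemma levy_markov_integral (s : R) (f : R * path_space R -> \bar R) :
  (0 < s)%R -> measurable_fun setT f -> (forall z, 0 <= f z) ->
  \int[P]_w f (L s w, shift_path s (path_of L w)) =
  \int[P]_w \int[P]_w' f (L s w, path_of L w').
Proof.
move=> s0 mf f0.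
apply: independent_pair_integral => //.
- apply: (measurableT_comp (f := shift_path s)).
    exact: measurable_shift_path.
  exact: measurable_path_of.
- exact: measurable_path_of.
- by move=> A C mA mC; exact: levy_markov.
Qed.

End levy_markov.

(** * Exponential moments *)
Section upper_grid.
Context {R : realType}.

(** Strictly to the right of [s], so that right-continuity gives convergence
    along these points, and positive, so that the path space sees them. *)
Definition upper_grid (n : nat) (s : R) : R :=
  (Num.truncn (s * n.+1%:R)).+1%:R / n.+1%:R.

Lemma upper_grid_gt n s : s < upper_grid n s.
Proof. by rewrite /upper_grid ltr_pdivlMr// truncnS_gt. Qed.

Lemma upper_grid_le n s : 0 <= s -> upper_grid n s <= s + n.+1%:R^-1.
Proof.
move=> s0; rewrite /upper_grid ler_pdivrMr// mulrDl mulVf// -natr1 lerD2r.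
by have /andP[] := truncn_itv (mulr_ge0 s0 (ler0n _ n.+1)).
Qed.

Lemma cvg_upper_grid s : 0 <= s -> upper_grid n s @[n --> \oo] --> s.
Proof.
move=> s0; apply: (@squeeze_cvgr _ _ _ _ (fun=> s) (fun n => s + n.+1%:R^-1)).
- by near=> n; rewrite ltW ?upper_grid_gt//= upper_grid_le.
- exact: cvg_cst.
- rewrite -[X in _ --> X]addr0; apply: cvgD; first exact: cvg_cst.
  exact: cvg_harmonic.
Unshelve. all: by end_near. Qed.

Lemma cadlag_upper_grid (l : R -> R) s : cadlag l -> 0 <= s ->
  l (upper_grid n s) @[n --> \oo] --> l s.
Proof.
move=> [lr _] s0; have /cvg_at_rightP := lr _ s0; apply; split.
  by move=> n; exact: upper_grid_gt.
exact: cvg_upper_grid.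
Qed.

End upper_grid.

Section exponential_moments.
Context {R : realType} d (T : measurableType d) (P : probability T R)
  (L : R -> {RV P >-> R}) (L_levy : levy_process P L)
  (L_exp : ('E_P[fun w => expR (L 1%R w)] = 1)%E).
Local Open Scope ereal_scope.

Let m s := \int[P]_w (expR (L s w))%:E.

Lemma measurable_expR_path s : measurable_fun setT (fun w => (expR (L s w))%:E).
Proof.
apply/measurable_EFinP; apply: (measurableT_comp (f := @expR R)) => //.
Qed.

Lemma exp_momentD s r : (0 < s)%R -> (0 < r)%R -> m (s + r)%R = m s * m r.
Proof.
move=> s0 r0.
pose f (z : R * path_space R) := (expR (z.1 + z.2 r))%:E.
have mf : measurable_fun setT f.
  apply/measurable_EFinP; apply: (measurableT_comp (f := @expR R)) => //.
  apply: measurable_funD => //.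
  apply: (measurableT_comp (f := fun e : path_space R => e r)) => //.
  exact: measurable_coordinate.
transitivity (\int[P]_w f (L s w, shift_path s (path_of L w))).
  apply: eq_integral => w _.
  by rewrite /f /= /shift_path /path_of subrKC.
rewrite levy_markov_integral//; last by move=> z; rewrite lee_fin expR_ge0.
have mp t := measurable_expR_path t.
transitivity (\int[P]_w ((expR (L s w))%:E * m r)).
  apply: eq_integral => w _; rewrite /m -ge0_integralZl//.
  - by apply: eq_integral => w' _; rewrite /f /= expRD EFinM.
rewrite ge0_integralZr//.
- by apply: integral_ge0 => w _; rewrite lee_fin expR_ge0.
Qed.

Let m_ge0 s : 0 <= m s.
Proof. by apply: integral_ge0 => w _; rewrite lee_fin expR_ge0. Qed.

Lemma exp_momentMn s k : (0 < s)%R -> m (k.+1%:R * s)%R = m s ^+ k.+1.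
Proof.
move=> s0; elim: k => [|k IH]; first by rewrite mul1r.
have -> : (k.+2%:R * s = s + k.+1%:R * s)%R by rewrite -[k.+2%:R]natr1; ring.
by rewrite exp_momentD ?mulr_gt0// IH -expeS.
Qed.

Let m1 : m 1%R = 1.
Proof. by rewrite -L_exp unlock. Qed.

Lemma exp_moment_rat k n : m (k.+1%:R / n.+1%:R)%R = 1.
Proof.
have n0 : (0 < (n.+1%:R : R)^-1)%R by rewrite invr_gt0.
have : m n.+1%:R^-1 = 1.
  have := exp_momentMn n n0; rewrite mulfV// m1.
  have := m_ge0 n.+1%:R^-1.
  case: (m _) => [r||] //.
    rewrite lee_fin => r0 H.
    have /eqP : (r ^+ n.+1 = 1)%R by apply: EFin_inj; rewrite EFin_expe -H.
    by rewrite pexpr_eq1// => /eqP ->.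
  move=> _.
  have -> : +oo ^+ n.+1 = +oo :> \bar R.
    by elim: (n) => // j IH; rewrite expeS IH mulyy.
  by [].
by move=> h; rewrite exp_momentMn// h -EFin_expe expr1n.
Qed.

(** Fatou's lemma along rational times decreasing to [s]. *)
Lemma exp_moment_le1 s : (0 < s)%R -> m s <= 1.
Proof.
move=> s0.
have [_ Lc _ _] := L_levy.
pose f n w := (expR (L (upper_grid n s) w))%:E.
have mf n : measurable_fun setT (f n) by exact: measurable_expR_path.
have := @fatou _ _ _ P _ measurableT f mf (fun n x _ => (expR_ge0 _ : 0 <= f n x)).
have -> : \int[P]_x limn_einf (f ^~ x) = m s.
  apply: eq_integral => w _.
  suff : f ^~ w @ \oo --> (expR (L s w))%:E by move=> /cvg_limn_einf_sup[].
  have h : expR (L (upper_grid n s) w) @[n --> \oo] --> expR (L s w).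
    apply: continuous_cvg; first exact: continuous_expR.
    by apply: (cadlag_upper_grid (Lc w)); exact: ltW.
  by apply: cvg_EFin; [near=> n|exact: h].
move=> /le_trans; apply.
rewrite (_ : (fun n => _) = (fun=> 1)).
  by rewrite (cvg_limn_einf_sup (cvg_cst _)).1.
by apply/funext => n; exact: exp_moment_rat.
Unshelve. all: by end_near. Qed.

(** Both factors of [m s * m (n - s) = m n = 1] are at most 1. *)
Lemma exp_moment s : (0 < s)%R -> \int[P]_w (expR (L s w))%:E = 1.
Proof.
move=> s0; rewrite -/(m s); pose n := (Num.truncn s).
have sn : (s < n.+1%:R)%R by exact: truncnS_gt.
have ns0 : (0 < n.+1%:R - s)%R by rewrite subr_gt0.
have := exp_momentD s0 ns0; rewrite subrKC.
have -> : (n.+1%:R = n.+1%:R / 1%:R :> R)%R by rewrite divr1.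
rewrite exp_moment_rat => ms.
have le1 : m s * m (n.+1%:R / 1%:R - s)%R <= m s.
  rewrite -[leRHS]mule1; apply: lee_pmul => //.
  by apply: exp_moment_le1; rewrite divr1.
apply/eqP; rewrite eq_le exp_moment_le1//=.
by rewrite [leLHS]ms.
Qed.

End exponential_moments.

(** * Integrability of the running supremum *)
Section sections.
Context {R : realType} d d1 d2 (T : measurableType d) (F : measurableType d1)
  (E : measurableType d2) (P : probability T R) (X : T -> E).
Hypothesis mX : measurable_fun setT X.
Local Open Scope ereal_scope.

Lemma measurable_preimage_pair (A : set (F * E)) (x : F) : measurable A ->
  measurable [set w | A (x, X w)].
Proof.
move=> mA; have : measurable_fun setT (fun w => (x, X w)).
  exact: measurable_fun_pair.
by move=> /(_ measurableT _ mA); rewrite setTI.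
Qed.

Lemma measurable_section_measure (A : set (F * E)) : measurable A ->
  measurable_fun setT (fun x => P [set w | A (x, X w)]).
Proof.
move=> mA; have mp : measurable_fun setT (fun z : F * T => (z.1, X z.2)).
  by apply: measurable_fun_pair => //; exact: measurableT_comp.
pose A' := (fun z : F * T => (z.1, X z.2)) @^-1` A.
have mA' : measurable A' by rewrite -[A']setTI; exact: mp.
have := measurable_fun_xsection P mA'.
apply: eq_measurable_fun => x _ /=; congr (P _).
by apply/seteqP; split => w; rewrite /xsection /= inE.
Qed.

Lemma section_measure_integral (A : set (F * E)) (x : F) : measurable A ->
  P [set w | A (x, X w)] = \int[P]_w (\1_A (x, X w))%:E.
Proof.
move=> mA; transitivity (\int[P]_w (\1_[set w | A (x, X w)] w)%:E).
  by rewrite integral_indic ?setIT//; exact: measurable_preimage_pair.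
by apply: eq_integral => w _; rewrite !indicE.
Qed.

End sections.

Section tails.
Context {R : realType} d (T : measurableType d) (P : probability T R)
  (L : R -> {RV P >-> R}) (L_levy : levy_process P L)
  (L_exp : ('E_P[fun w => expR (L 1%R w)] = 1)%E).
Local Open Scope ereal_scope.

Let mLpre s (A : set R) : measurable A -> measurable (L s @^-1` A).
Proof. exact: measurable_funPTI. Qed.

(** Markov's inequality for [exp (L s)], since [exp 1 >= 2]. *)
Lemma upper_tail s : (0 < s)%R -> P [set w | (1 < L s w)%R] <= (2^-1)%:E.
Proof.
move=> s0; set A := [set w | _].
have mA : measurable A.
  rewrite (_ : A = L s @^-1` `]1%R, +oo[); first exact: mLpre.
  by apply/seteqP; split => w /=; rewrite in_itv/= andbT.
have : 2%:E * P A <= 1.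
  rewrite -(exp_moment L_levy L_exp s0) -(setIT A) -integral_indic//.
  rewrite -ge0_integralZl//; last by apply/measurable_EFinP; exact: measurable_indic.
  apply: ge0_le_integral => //.
  - by apply/measurable_EFinP; apply: measurable_funM => //; exact: measurable_indic.
  - exact: measurable_expR_path.
  move=> w _; rewrite -EFinM lee_fin indicE.
  have [|_] := boolP (w \in A); last by rewrite mulr0 expR_ge0.
  rewrite inE /A /= mulr1 => h.
  by apply: le_trans (expR_ge1Dx _); lra.
have : P A \is a fin_num by rewrite fin_num_measure.
case: (P A) => // r _; rewrite -EFinM !lee_fin; lra.
Qed.

(** The terminal value controls the lower tails at all earlier times, because the
    remaining increment has a bounded upper tail. *)
Lemma lower_tail S : (0 < S)%R -> exists2 c : R, (0 < c)%R &
  forall s, (0 < s <= S)%R -> (2^-1)%:E <= P [set w | (- c < L s w)%R].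
Proof.
move=> S0.
pose F n := L S @^-1` `]-oo, (- n%:R)%R].
have mF n : measurable (F n) by exact: mLpre.
have FI : \bigcap_n F n = set0.
  rewrite -subset0 => w /(_ (Num.truncn (- L S w)%R).+1 I).
  rewrite /F /= in_itv /= => h.
  by have := truncnS_gt (- L S w)%R; lra.
have cF : P (F n) @[n --> \oo] --> (0 : \bar R).
  rewrite -(measure0 P) -FI; apply: nonincreasing_cvg_mu => //.
  - by apply: (le_lt_trans (probability_le1 _ _)) => //; rewrite ltry.
  - exact: bigcap_measurable.
  move=> m n mn; apply/subsetPset => w; rewrite /F /= !in_itv/= => /le_trans; apply.
  by rewrite lerN2 ler_nat.
have [n Fn] : exists n, P (F n) <= (4^-1)%:E.
  move/fine_cvgP : cF => [fF cF].
  have : \forall n \near \oo, (fine (P (F n)) < 4^-1)%R.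
    by apply: (cvgr_lt 0%R) => //; rewrite invr_gt0.
  move=> H; near \oo => n; exists n.
  have Ffin : P (F n) \is a fin_num by near: n.
  rewrite -(fineK Ffin) lee_fin ltW//; by near: n.
(* [L s <= - (n + 2)] and an increment at most 1 until [S] force [L S <= - n];
   the second condition is independent of the first and has probability at
   least one half, so the first one has probability at most twice one quarter *)
exists (n%:R + 2)%R => [|s /andP[s0 sS]]; first by rewrite ltr_wpDl.
set B := [set w | _].
pose A := L s @^-1` `]-oo, (- (n%:R + 2))%R].
have mA : measurable A by exact: mLpre.
have BA : B = ~` A.
  by apply/seteqP; split => w; rewrite /A /B /= in_itv/= ltNge => /negP.
suff A12 : P A <= (2^-1)%:E.
  rewrite BA probability_setC//.
  have : P A \is a fin_num by rewrite fin_num_measure.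
  case: (P A) A12 => // r; rewrite -EFinB !lee_fin; lra.
move: sS; rewrite le_eqVlt => /predU1P[sS|sS].
  apply: (@le_trans _ _ (P (F n))).
    apply: le_measure; rewrite ?inE// => w; rewrite /A /F /= !in_itv/= sS; lra.
  by apply: (le_trans Fn); rewrite lee_fin; lra.
have Ss : (0 < S - s)%R by rewrite subr_gt0.
pose C := [set e : path_space R | (e (S - s) <= 1)%R].
have mC : measurable C.
  have := @measurable_coordinate R R [set t : R | (0 < t)%R] (S - s)%R Ss.
  move=> /(_ measurableT [set` `]-oo, 1%R]%R] (measurable_itv _)); rewrite setTI.
  by congr measurable; apply/seteqP; split => e /=; rewrite in_itv.
have mk := levy_markov L_levy s0 (measurable_itv `]-oo, (- (n%:R + 2))%R]) mC.
have PC : (2^-1)%:E <= P (path_of L @^-1` C).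
  pose C' := [set w | (1 < L (S - s) w)%R].
  have mC' : measurable C'.
    rewrite (_ : C' = L (S - s)%R @^-1` `]1%R, +oo[); first exact: mLpre.
    by apply/seteqP; split => w /=; rewrite in_itv/= andbT.
  have -> : path_of L @^-1` C = ~` C'.
    by apply/seteqP; split => w; rewrite /C' /C /path_of /= leNgt => /negP.
  rewrite probability_setC//; have := upper_tail Ss; rewrite -/C'.
  have : P C' \is a fin_num by rewrite fin_num_measure.
  case: (P C') => // r _; rewrite -EFinB !lee_fin; lra.
have : P A * P (path_of L @^-1` C) <= (4^-1)%:E.
  rewrite -mk; apply: le_trans Fn; apply: le_measure; rewrite ?inE//.
    apply: measurableI => //.
    have : measurable_fun setT (fun w => shift_path s (path_of L w)).
      apply: (measurableT_comp (f := shift_path s)).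
        exact: measurable_shift_path.
      exact: measurable_path_of.
    by move=> /(_ measurableT C mC); rewrite setTI.
  move=> w [] ; rewrite /C /F /= !in_itv/= /shift_path /path_of subrKC; lra.
have : P A \is a fin_num by rewrite fin_num_measure.
have : 0 <= P A by [].
have mpC : measurable (path_of L @^-1` C).
  by rewrite -[X in measurable X]setTI; exact: measurable_path_of.
have : P (path_of L @^-1` C) \is a fin_num by rewrite fin_num_measure.
case: (P (path_of L @^-1` C)) PC => // q; rewrite lee_fin => q2 _.
case: (P A) => // r; rewrite -EFinM !lee_fin => r0 _ ?; nra.
Unshelve. all: by end_near. Qed.

End tails.

Section exponential_integral.
Context {R : realType}.
Notation mu := (@lebesgue_measure R).

Lemma integral_expRN_ray (a : R) :
  (\int[mu]_(x in `]a, +oo[) (expR (- x))%:E = (expR (- a))%:E)%E.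
Proof.
have mf : measurable_fun `]a, +oo[ (fun x : R => (expR (- x))%:E).
  apply/measurable_EFinP; apply: measurable_funTS.
  by apply: (measurableT_comp (f := @expR R)).
have cexpN : continuous (fun x : R => expR (- x)).
  move=> x; apply: continuous_comp; last exact: continuous_expR.
  exact: opp_continuous.
rewrite integral_itv_obnd_cbnd//.
rewrite (@ge0_continuous_FTC2y _ _ (fun x => - expR (- x)) _ 0)//.
- by rewrite EFinN oppeK add0e.
- exact: continuous_subspaceT.
- rewrite -oppr0; apply: cvgN.
  exact: cvgr_expR.
- by apply: cvgN; apply/cvg_at_right_filter; exact: cexpN.
- move=> x _; rewrite derive1_comp// derive1N// derive1_id mulN1r.
  rewrite derive1_comp// derive1E; have /funeqP -> := @derive_expR R.
  by rewrite derive1N// derive1_id mulrN1 opprK.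
Qed.

End exponential_integral.

Section ottaviani.
Context {R : realType} d (T : measurableType d) (P : probability T R)
  (L : R -> {RV P >-> R}) (L_levy : levy_process P L)
  (L_exp : ('E_P[fun w => expR (L 1%R w)] = 1)%E).
Local Open Scope ereal_scope.
Notation mu := (@lebesgue_measure R).

Lemma levy_markov_measure (s : R) (A : set (R * path_space R)) :
  (0 < s)%R -> measurable A ->
  P [set w | A (L s w, shift_path s (path_of L w))] =
  \int[P]_w P [set w' | A (L s w, path_of L w')].
Proof.
move=> s0 mA.
have mS : measurable_fun setT (fun w => (L s w, shift_path s (path_of L w))).
  apply: measurable_fun_pair => //; apply: (measurableT_comp (f := shift_path s)).
    exact: measurable_shift_path.
  exact: measurable_path_of.
transitivity (\int[P]_w (\1_A (L s w, shift_path s (path_of L w)))%:E).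
  pose B := (fun w => (L s w, shift_path s (path_of L w))) @^-1` A.
  have mB : measurable B by rewrite -[B]setTI; exact: mS.
  transitivity (\int[P]_w (\1_B w)%:E); first by rewrite integral_indic// setIT.
  by apply: eq_integral => w _; rewrite !indicE.
rewrite (levy_markov_integral L_levy (f := fun z => (\1_A z)%:E))//; last first.
  by apply/measurable_EFinP; exact: measurable_indic.
apply: eq_integral => w _.
by rewrite -section_measure_integral//; exact: measurable_path_of.
Qed.

(** The starting value is included, so that after one step of the walk the event
    for [N.+1] becomes the event for [N] of the restarted path. *)
Definition exceed (u delta : R) (N : nat) : set (R * path_space R) :=
  [set z | (u < z.1)%R \/
    exists2 k, (k < N)%N & (u < z.1 + z.2 (k.+1%:R * delta))%R].

Lemma measurable_value_gt (u t : R) : (0 < t)%R ->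
  measurable [set z : R * path_space R | (u < z.1 + z.2 t)%R].
Proof.
move=> t0.
have mv : measurable_fun setT (fun z : R * path_space R => z.1 + z.2 t)%R.
  apply: measurable_funD => //.
  apply: (measurableT_comp (f := fun e : path_space R => e t)) => //.
  exact: measurable_coordinate.
have := mv measurableT [set` `]u, +oo[%R] (measurable_itv _); rewrite setTI.
by congr measurable; apply/seteqP; split => z /=; rewrite in_itv/= andbT.
Qed.

Lemma measurable_exceed u delta N : (0 < delta)%R ->
  measurable (exceed u delta N).
Proof.
move=> d0; rewrite (_ : exceed u delta N = [set z | (u < z.1)%R] `|`
  \bigcup_(k in `I_N) [set z | (u < z.1 + z.2 (k.+1%:R * delta)%R)%R]).
  apply: measurableU.
    have := @measurable_fst _ _ R (path_space R) measurableT [set` `]u, +oo[%R] (measurable_itv _).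
    rewrite setTI; by congr measurable; apply/seteqP; split => z /=; rewrite in_itv/= andbT.
  apply: bigcup_measurable => k _.
  by apply: measurable_value_gt; rewrite mulr_gt0.
apply/seteqP; split => z /=.
  by move=> [|[k kN h]]; [left|right; exists k].
by move=> [|[k kN h]]; [left|right; exists k].
Qed.

(** Ottaviani's inequality on a grid. Once the level [u] is passed, the final
    value is above [u - c] with probability at least one half. The proof is by
    induction on the number of steps with the Markov property at the first one,
    which replaces the usual first passage time. *)
Lemma ottaviani (delta c u : R) (n : nat) : (0 < delta)%R -> (0 < c)%R ->
  (forall k, (k <= n)%N ->
    (2^-1)%:E <= P [set w | (- c < L (k.+1%:R * delta) w)%R]) ->
  forall x, P [set w | exceed u delta n.+1 (x, path_of L w)] <=
    2%:E * P [set w | (u - c < x + L (n.+1%:R * delta) w)%R].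
Proof.
move=> d0 c0.
have mpath := measurable_path_of L.
have mG v s x : (0 < s)%R -> measurable [set w | (v < x + L s w)%R].
  move=> s0; have := measurable_preimage_pair mpath x (measurable_value_gt v s0).
  exact.
have mE k x : measurable [set w | exceed u delta k (x, path_of L w)].
  by apply: (measurable_preimage_pair mpath); exact: measurable_exceed.
have above k x : (u < x)%R ->
    (2^-1)%:E <= P [set w | (- c < L (k.+1%:R * delta) w)%R] ->
    P [set w | exceed u delta k.+1 (x, path_of L w)] <=
    2%:E * P [set w | (u - c < x + L (k.+1%:R * delta) w)%R].
  move=> ux hc; apply: (@le_trans _ _ (2%:E * (2^-1)%:E)).
    by rewrite -EFinM mulfV//; exact: probability_le1.
  rewrite lee_pmul2l//; apply: le_trans hc _; apply: le_measure; rewrite ?inE.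
  - have := mG (- c)%R (k.+1%:R * delta)%R 0%R (mulr_gt0 _ d0).
    by under eq_set do rewrite add0r; apply.
  - by apply: mG; rewrite mulr_gt0.
  - by move=> w /=; lra.
elim: n => [|n IH] hc x.
  have [ux|xu] := ltP u x; first exact: above (hc _ _).
  apply: (@le_trans _ _ (P [set w | (u - c < x + L (1%:R * delta) w)%R])).
    apply: le_measure; rewrite ?inE//; first by apply: mG; rewrite mul1r.
    move=> w [/=|[k]] ; first by lra.
    by rewrite ltnS leqn0 => /eqP -> /=; rewrite /path_of; lra.
  by rewrite -{1}[P _]mul1e lee_pmul// lee_fin; lra.
have [ux|xu] := ltP u x; first exact: above (hc _ _).
have xab (a b : R) : (x + a + (b - a) = x + b)%R by ring.
pose E1 : set (R * path_space R) := [set z | exceed u delta n.+1 (x + z.1, z.2)%R].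
have mxz : measurable_fun setT (fun z : R * path_space R => (x + z.1, z.2)%R).
  by apply: measurable_fun_pair => //; apply: measurable_funD.
have mE1 : measurable E1.
  by rewrite -[E1]setTI; apply: mxz => //; exact: measurable_exceed.
have nd0 : (0 < n.+1%:R * delta)%R by rewrite mulr_gt0.
pose G : set (R * path_space R) :=
  [set z | (u - c < (x + z.1) + z.2 (n.+1%:R * delta))%R].
have mGG : measurable G.
  by rewrite -[G]setTI; apply: (mxz measurableT _ (measurable_value_gt (u - c) nd0)).
have EE1 : [set w | exceed u delta n.+2 (x, path_of L w)] =
    [set w | E1 (L delta w, shift_path delta (path_of L w))].
  apply/seteqP; split => w; rewrite /E1 /exceed /shift_path /path_of /=.
    move=> [|[[|k] kn]]; first by lra.
      by rewrite mul1r => h; left.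
    move=> h; right; exists k => //.
    have -> : (delta + k.+1%:R * delta = k.+2%:R * delta)%R.
      by rewrite -[k.+2%:R]natr1; ring.
    by rewrite xab.
  move=> [h|[k kn h]]; right; first by exists 0%N; rewrite ?mul1r.
  move: h; have -> : (delta + k.+1%:R * delta = k.+2%:R * delta)%R.
    by rewrite -[k.+2%:R]natr1; ring.
  by rewrite xab => h; exists k.+1.
rewrite EE1 levy_markov_measure//.
apply: (@le_trans _ _ (\int[P]_w (2%:E * P [set w' | G (L delta w, path_of L w')]))).
  apply: ge0_le_integral => //.
  - have := measurable_section_measure P mpath mE1.
    by move=> h; apply: (measurableT_comp h).
  - apply: measurable_funeM.
    have := measurable_section_measure P mpath mGG.
    by move=> h; apply: (measurableT_comp h).
  move=> w _; apply: (IH _ (x + L delta w)%R) => k kn.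
  by apply: hc; exact: leqW.
rewrite ge0_integralZl//; last first.
  have := measurable_section_measure P mpath mGG.
  by move=> h; apply: (measurableT_comp h).
rewrite -levy_markov_measure// lee_pmul2l//.
rewrite (_ : [set w | G _] = [set w | (u - c < x + L (n.+2%:R * delta) w)%R])//.
apply/seteqP; split => w; rewrite /G /shift_path /path_of /=;
  have -> : (delta + n.+1%:R * delta = n.+2%:R * delta)%R
    by [rewrite -[n.+2%:R]natr1; ring]; rewrite xab;
  exact: id.
Qed.

End ottaviani.

Section exceed_before.
Context {R : realType}.

(** The dyadic fractions of [S] suffice for right-continuous paths and make the
    event measurable; the grids refine each other, so the union is increasing. *)
Definition exceed_before (u S : R) : set (R * path_space R) :=
  \bigcup_n exceed u (S / (2 ^ n)%:R) (2 ^ n).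

Lemma pow2_gt0 n : 0 < (2 ^ n)%:R :> R.
Proof. by rewrite ltr0n expn_gt0. Qed.

Lemma measurable_exceed_before u S : 0 < S -> measurable (exceed_before u S).
Proof.
move=> S0; apply: bigcupT_measurable => n; apply: measurable_exceed.
by rewrite divr_gt0// pow2_gt0.
Qed.

Lemma exceed_dyadicS (u S : R) n :
  exceed u (S / (2 ^ n)%:R) (2 ^ n) `<=`
  exceed u (S / (2 ^ n.+1)%:R) (2 ^ n.+1).
Proof.
move=> z [h|[k kn h]]; [by left|right].
exists (k.*2.+1); first by rewrite expnS; lia.
move: h; have -> : k.*2.+2%:R * (S / (2 ^ n.+1)%:R) = k.+1%:R * (S / (2 ^ n)%:R).
  have -> : k.*2.+2 = (2 * k.+1)%N by lia.
  rewrite expnS !natrM invfM.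
  by have := pow2_gt0 n => h; field; rewrite gt_eqF.
exact: id.
Qed.

Lemma cvg_pow2V : ((2 ^ n)%:R : R)^-1 @[n --> \oo] --> (0 : R).
Proof.
under eq_fun do rewrite natrX -exprVn.
by apply: cvg_expr; rewrite ger0_norm ?invr_ge0// invf_lt1//; lra.
Qed.

Lemma cadlag_exceed_before (l : R -> R) x u S t : cadlag l -> 0 <= t < S ->
  u < l t + x -> exceed_before u S (x, l).
Proof.
move=> [lr _] /andP[t0 tS] ult.
have S0 : 0 < S by apply: le_lt_trans tS.
pose delta n := S / (2 ^ n)%:R.
have delta0 n : 0 < delta n by rewrite divr_gt0// pow2_gt0.
pose g n := (Num.truncn (t / delta n)).+1%:R * delta n.
have gt n : t < g n by rewrite -ltr_pdivrMr// truncnS_gt.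
have gle n : g n <= t + delta n.
  rewrite /g -natr1 mulrDl mul1r lerD2r -ler_pdivlMr//.
  have : 0 <= t / delta n by rewrite divr_ge0// ltW.
  by move=> /truncn_itv /andP[].
have cdelta : delta n @[n --> \oo] --> 0.
  by rewrite -(mulr0 S); apply: cvgMr; exact: cvg_pow2V.
have cg : g n @[n --> \oo] --> t.
  apply: (@squeeze_cvgr _ _ _ _ (fun=> t) (fun n => t + delta n)).
  - by near=> n; rewrite ltW ?gt//= gle.
  - exact: cvg_cst.
  - by rewrite -[X in _ --> X]addr0; apply: cvgD => //; exact: cvg_cst.
have clg : l (g n) @[n --> \oo] --> l t.
  by have /cvg_at_rightP := lr t t0; apply; split.
have : \forall n \near \oo, u - x < l (g n).
  by apply: (cvgr_gt (l t)) => //; lra.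
move=> [N _ /(_ N (leqnn _)) /= h].
exists N => //; right; exists (Num.truncn (t / delta N)).
  rewrite -(ltr_nat R); apply: (@le_lt_trans _ _ (t / delta N)).
    have : 0 <= t / delta N by rewrite divr_ge0// ltW.
    by move=> /truncn_itv /andP[].
  rewrite ltr_pdivrMr//.
  have -> : (2 ^ N)%:R * delta N = S; last by [].
  by rewrite /delta mulrC divfK// gt_eqF// pow2_gt0.
by rewrite /= -/(delta N) -/(g N); lra.
Unshelve. all: by end_near. Qed.

End exceed_before.

Section maximal_integral.
Context {R : realType} d (T : measurableType d) (P : probability T R)
  (L : R -> {RV P >-> R}) (L_levy : levy_process P L)
  (L_exp : ('E_P[fun w => expR (L 1%R w)] = 1)%E).
Local Open Scope ereal_scope.
Notation mu := (@lebesgue_measure R).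

(** For a fixed path, [exp (- x)] integrates to [exp (L s - v)] over the starting
    points [x] with [v < x + L s]; the factor [exp (L s)] has mean 1. *)
Lemma integral_terminal_exceed (v s : R) : (0 < s)%R ->
  \int[mu]_x ((expR (- x))%:E * P [set w | (v < x + L s w)%R]) = (expR (- v))%:E.
Proof.
move=> s0.
pose A := [set z : R * path_space R | (v < z.1 + z.2 s)%R].
have mA : measurable A by exact: measurable_value_gt.
have mpath := measurable_path_of L.
have mI : measurable_fun setT (\1_A : R * path_space R -> R).
  exact: measurable_indic.
pose f (z : R * T) := (expR (- z.1) * \1_A (z.1, path_of L z.2))%:E.
have mf : measurable_fun setT f.
  apply/measurable_EFinP; apply: measurable_funM.
    apply: (measurableT_comp (f := @expR R)) => //.
    exact: measurableT_comp.
  apply: (measurableT_comp mI) => //.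
  by apply: measurable_fun_pair => //; exact: measurableT_comp.
have f0 z : 0 <= f z by rewrite lee_fin mulr_ge0// expR_ge0.
transitivity (\int[mu]_x \int[P]_w f (x, w)).
  apply: eq_integral => x _.
  have := section_measure_integral P mpath x mA; rewrite /A /= => ->.
  rewrite -ge0_integralZl//.
  apply/measurable_EFinP; apply: (measurableT_comp mI) => //.
  exact: measurable_fun_pair.
rewrite (@fubini_tonelli _ _ _ _ _ mu P f mf f0).
transitivity (\int[P]_w ((expR (- v))%:E * (expR (L s w))%:E)).
  apply: eq_integral => w _; rewrite /fubini_G -EFinM -expRD.
  transitivity (\int[mu]_(x in `](v - L s w)%R, +oo[) (expR (- x))%:E).
    rewrite [RHS]integral_mkcond; apply: eq_integral => x _.
    rewrite /f patchE /= indicE.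
    have [vx|xv] := ltP v (x + L s w)%R.
      have -> : (x, path_of L w) \in A by rewrite inE.
      have -> : x \in [set` `](v - L s w)%R, +oo[%R].
        by rewrite inE /= in_itv/= andbT ltrBlDr.
      by rewrite mulr1.
    have -> : ((x, path_of L w) \in A) = false.
      by apply: memNset => /=; apply/negP; rewrite -leNgt.
    have -> : (x \in [set` `](v - L s w)%R, +oo[%R]) = false.
      by apply: memNset => /=; rewrite in_itv/= andbT ltrBlDr; apply/negP; rewrite -leNgt.
    by rewrite mulr0.
  by rewrite integral_expRN_ray opprB addrC.
rewrite ge0_integralZl//; last exact: measurable_expR_path.
by rewrite exp_moment// mule1.
Qed.

(** [ottaviani] with a constant [c] common to all the dyadic grids, followed by
    monotone convergence along the grids. *)
Lemma exceed_before_integral_lty (u S : R) : (0 < S)%R ->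
  \int[mu]_x ((expR (- x))%:E *
     P [set w | exceed_before u S (x, path_of L w)]) < +oo.
Proof.
move=> S0.
have [c c0 hc] := lower_tail L_levy L_exp S0.
have mpath := measurable_path_of L.
pose F n := exceed u (S / (2 ^ n)%:R) (2 ^ n).
have delta0 n : (0 < S / (2 ^ n)%:R)%R by rewrite divr_gt0// pow2_gt0.
have mF n : measurable (F n) by exact: measurable_exceed.
have mFx n x : measurable [set w | F n (x, path_of L w)].
  exact: measurable_preimage_pair.
pose g n x := (expR (- x))%:E * P [set w | F n (x, path_of L w)].
have g0 n x : 0 <= g n x by rewrite mule_ge0// lee_fin expR_ge0.
have mexp : measurable_fun setT (fun x : R => (expR (- x))%:E).
  by apply/measurable_EFinP; apply: (measurableT_comp (f := @expR R)).
have mg n : measurable_fun setT (g n).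
  by apply: emeasurable_funM => //; exact: measurable_section_measure.
have ndF n m x : (n <= m)%N ->
    [set w | F n (x, path_of L w)] `<=` [set w | F m (x, path_of L w)].
  move=> nm w; elim: m nm => [|m IH]; first by rewrite leqn0 => /eqP ->.
  rewrite leq_eqVlt => /predU1P[->//|nm h].
  by apply: exceed_dyadicS; exact: IH.
have ndg x : setT x -> {homo g ^~ x : n m / (n <= m)%N >-> n <= m}.
  move=> _ n m nm; rewrite /g; apply: lee_pmul => //.
  by apply: le_measure; rewrite ?inE//; exact: ndF.
have cg x : g n x @[n --> \oo] --> (expR (- x))%:E *
     P [set w | exceed_before u S (x, path_of L w)].
  apply: cvgeZl => //.
  have -> : [set w | exceed_before u S (x, path_of L w)] =
      \bigcup_n [set w | F n (x, path_of L w)].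
    by apply/seteqP; split => w [n _ h]; exists n.
  apply: nondecreasing_cvg_mu => //; first exact: bigcupT_measurable.
  by move=> n m nm; apply/subsetPset; exact: ndF.
have gle n : \int[mu]_x g n x <= 2%:E * (expR (- (u - c)))%:E.
  rewrite -(integral_terminal_exceed (u - c) S0).
  rewrite -ge0_integralZl//; last 2 first.
    apply: emeasurable_funM => //.
    have := measurable_section_measure P mpath (measurable_value_gt (u - c) S0).
    exact.
    by move=> x _; rewrite mule_ge0// lee_fin expR_ge0.
  apply: ge0_le_integral => //.
    exact: mg.
    apply: measurable_funeM; apply: emeasurable_funM => //.
    have := measurable_section_measure P mpath (measurable_value_gt (u - c) S0).
    exact.
  move=> x _; rewrite muleCA lee_pmul2l//; last by rewrite lte_fin expR_gt0.
  have n2 : (2 ^ n = (2 ^ n).-1.+1)%N by rewrite prednK// expn_gt0.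
  have SE : ((2 ^ n).-1.+1%:R * (S / (2 ^ n)%:R) = S)%R.
    by rewrite -n2 mulrC divfK// gt_eqF// pow2_gt0.
  have := ottaviani L_levy u (n := (2 ^ n).-1) (delta0 n) c0.
  rewrite SE -n2; apply => k kn; apply: hc.
  rewrite mulr_gt0//=.
  rewrite -[leRHS]SE ler_pM2r// ler_nat; lia.
have -> : \int[mu]_x ((expR (- x))%:E *
     P [set w | exceed_before u S (x, path_of L w)]) =
    \int[mu]_x limn (g ^~ x).
  by apply: eq_integral => x _; apply/esym/cvg_lim => //; exact: cg.
rewrite monotone_convergence//.
apply: (@le_lt_trans _ _ (2%:E * (expR (- (u - c)))%:E)); last by rewrite -EFinM ltry.
apply: lime_le; last by apply: nearW => n; exact: gle.
apply: ereal_nondecreasing_is_cvgn => n m nm.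
by apply: ge0_le_integral => //; [exact: mg|exact: mg|move=> x _; exact: ndg].
Qed.

End maximal_integral.

(** * Invariance under the flow of the Levy process *)
Section translation.
Context {R : realType}.
Notation mu := (@lebesgue_measure R).
Local Open Scope ereal_scope.

Lemma lebesgue_measure_translation (y : R) (A : set R) : measurable A ->
  mu [set x | A (x + y)%R] = mu A.
Proof.
move=> mA.
have mt : measurable_fun setT (fun x : measurableTypeR R => (x + y)%R : measurableTypeR R).
  by apply: measurable_funD.
apply/esym.
apply: (lebesgue_measure_unique (mu := pushforward mu (fun x : measurableTypeR R => (x + y)%R : measurableTypeR R))) => //.
move=> _ [[a b] _ <-].
rewrite /= /pushforward (_ : _ @^-1` _ = `](a - y)%R, (b - y)%R]%classic); last first.
  by apply/seteqP; split => x /=; rewrite !in_itv/= ltrBlDr lerBrDr.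
rewrite !lebesgue_measure_itv/= !lte_fin ltrD2r; case: ifP => // _.
by rewrite -!EFinB; congr EFin; ring.
Qed.

Lemma ge0_integral_translation (y : R) (h : R -> \bar R) :
  measurable_fun setT h -> (forall x, 0 <= h x) ->
  \int[mu]_x h (x + y)%R = \int[mu]_x h x.
Proof.
move=> mh h0.
have mt : measurable_fun setT (fun x : measurableTypeR R => (x + y)%R : measurableTypeR R).
  by apply: measurable_funD.
transitivity (\int[pushforward mu (fun x : measurableTypeR R => (x + y)%R : measurableTypeR R)]_x h x).
  by rewrite ge0_integral_pushforward.
apply: eq_measure_integral => //= A mA _.
exact: lebesgue_measure_translation.
Qed.

End translation.

Section scaling.
Context {R : realType} d (T : measurableType d) (m : {measure set T -> \bar R}).
Local Open Scope ereal_scope.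

Lemma ge0_integralZlT (k : \bar R) (f : T -> \bar R) :
  measurable_fun setT f -> (forall x, 0 <= f x) -> 0 <= k ->
  \int[m]_x (k * f x) = k * \int[m]_x f x.
Proof. by move=> mf f0 k0; rewrite ge0_integralZl. Qed.

Lemma ge0_integralZrT (k : \bar R) (f : T -> \bar R) :
  measurable_fun setT f -> (forall x, 0 <= f x) -> 0 <= k ->
  \int[m]_x (f x * k) = \int[m]_x f x * k.
Proof. by move=> mf f0 k0; rewrite ge0_integralZr. Qed.

End scaling.

Section flow.
Context {R : realType} d (T : measurableType d) (P : probability T R)
  (L : R -> {RV P >-> R}) (L_levy : levy_process P L)
  (L_exp : ('E_P[fun w => expR (L 1%R w)] = 1)%E).
Local Open Scope ereal_scope.
Notation mu := (@lebesgue_measure R).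

(** The integral of [f] when the starting point has the infinite law
    [exp (- x) dx] and is independent of the path. *)
Definition flow_integral (f : R * T -> \bar R) :=
  \int[mu \x P]_z ((expR (- z.1))%:E * f z).

Lemma measurable_weight : measurable_fun setT (fun z : R * T => (expR (- z.1))%:E).
Proof.
apply/measurable_EFinP; apply: (measurableT_comp (f := @expR R)) => //.
exact: measurableT_comp.
Qed.

Lemma flow_integralE f : measurable_fun setT f -> (forall z, 0 <= f z) ->
  flow_integral f = \int[mu]_x ((expR (- x))%:E * \int[P]_w f (x, w)).
Proof.
move=> mf f0; rewrite /flow_integral fubini_tonelli1//; last 2 first.
- by apply: emeasurable_funM => //; exact: measurable_weight.
- by move=> z; rewrite mule_ge0// lee_fin expR_ge0.
apply: eq_integral => x _; rewrite /fubini_F /= ge0_integralZl//.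
- exact: measurable_fun_pair2.
Qed.

(** For a fixed value of [L s], moving the starting point by [L s] multiplies
    [exp (- x) dx] by [exp (L s)], and the shifted path does not depend on [L s].
    The mean of [exp (L s)] is 1. *)
Lemma flow_shift_invariance (s : R) (f : R * path_space R -> \bar R) :
  (0 < s)%R -> measurable_fun setT f -> (forall z, 0 <= f z) ->
  flow_integral (fun z => f (z.1 + L s z.2, shift_path s (path_of L z.2))%R) =
  flow_integral (fun z => f (z.1, path_of L z.2)).
Proof.
move=> s0 mf f0.
have mpath := measurable_path_of L.
have mshift : measurable_fun setT (fun w => shift_path s (path_of L w)).
  apply: (measurableT_comp (f := shift_path s)) => //.
  exact: measurable_shift_path.
have mf2 : measurable_fun setT (fun z : R * T => f (z.1, path_of L z.2)).
  apply: (measurableT_comp mf); apply: measurable_fun_pair => //.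
  exact: measurableT_comp.
have mf1 : measurable_fun setT (fun z : R * T =>
    f (z.1 + L s z.2, shift_path s (path_of L z.2))%R).
  apply: (measurableT_comp mf); apply: measurable_fun_pair => //.
    apply: measurable_funD => //.
    exact: measurableT_comp.
  exact: (measurableT_comp mshift).
rewrite (flow_integralE mf1 (fun z => f0 _)) (flow_integralE mf2 (fun z => f0 _)).
pose F y := \int[P]_w f (y, path_of L w).
have mF : measurable_fun setT F.
  exact: (measurable_fun_fubini_tonelli_F _ mf2 (fun z => f0 _)).
have F0 y : 0 <= F y by apply: integral_ge0.
have mexp : measurable_fun setT (fun x : R => (expR (- x))%:E).
  by apply/measurable_EFinP; apply: (measurableT_comp (f := @expR R)).
transitivity (\int[mu]_x \int[P]_w ((expR (- x))%:E * F (x + L s w)%R)).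
  apply: eq_integral => x _.
  have mfx : measurable_fun setT (fun z : R * path_space R => f (x + z.1, z.2)%R).
    apply: (measurableT_comp mf); apply: measurable_fun_pair => //.
    exact: measurable_funD.
  have := levy_markov_integral L_levy s0 mfx (fun z => f0 _) => /= ->.
  rewrite ge0_integralZl//.
  apply: (measurableT_comp mF); exact: measurable_funD.
pose H (z : R * T) := (expR (- z.1))%:E * F (z.1 + L s z.2)%R.
have mH : measurable_fun setT H.
  apply: emeasurable_funM; first exact: measurable_weight.
  apply: (measurableT_comp mF); apply: measurable_funD => //.
  exact: measurableT_comp.
have H0 z : 0 <= H z by rewrite mule_ge0// lee_fin expR_ge0.
rewrite (@fubini_tonelli _ _ _ _ _ mu P H mH H0).
pose I := \int[mu]_x (fun y : R => (expR (- y))%:E * F y) x.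
rewrite -[RHS]/I.
transitivity (\int[P]_w ((expR (L s w))%:E * I)).
  apply: eq_integral => w _; rewrite /fubini_G /H /=.
  transitivity (\int[mu]_x ((expR (L s w))%:E * ((expR (- (x + L s w)))%:E * F (x + L s w)%R))).
    apply: eq_integral => x _; rewrite muleA -EFinM -expRD.
    by congr (_%:E * _); congr expR; ring.
  have mexpF : measurable_fun setT (fun x : R => (expR (- x))%:E * F x).
    exact: emeasurable_funM.
  have expF0 x : 0 <= (expR (- x))%:E * F x by rewrite mule_ge0.
  rewrite /I -(ge0_integral_translation (L s w) mexpF expF0).
  apply: (@ge0_integralZlT _ _ _ mu (expR (L s w))%:E
    (fun x : R => (expR (- (x + L s w)))%:E * F (x + L s w)%R)).
  - apply: (measurableT_comp mexpF).
    exact: measurable_funD.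
  - by move=> x; exact: expF0.
  - by rewrite lee_fin expR_ge0.
rewrite ge0_integralZrT.
- by rewrite exp_moment// mul1e.
- exact: measurable_expR_path.
- by move=> w; rewrite lee_fin expR_ge0.
- by apply: integral_ge0 => x _; rewrite mule_ge0.
Qed.

End flow.

Section truncn_measurable.
Context {R : realType}.

Lemma measurable_truncn : measurable_fun setT (@Num.truncn R).
Proof.
move=> _ Y _; rewrite setTI.
have mle k : measurable [set s : R | (Num.truncn s <= k)%N].
  rewrite (_ : [set s | _] = [set` `]-oo, k.+1%:R[%R]); first exact: measurable_itv.
  by apply/seteqP; split => s /=; rewrite in_itv/= truncn_le_nat.
have m1 k : measurable [set s : R | Num.truncn s = k].
  case: k => [|k].
    rewrite (_ : [set s | _] = [set s : R | (Num.truncn s <= 0)%N])//.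
    by apply/seteqP; split => s /=; rewrite leqn0 => /eqP.
  rewrite (_ : [set s | _] = [set s : R | (Num.truncn s <= k.+1)%N] `\`
      [set s : R | (Num.truncn s <= k)%N]); first exact: measurableD.
  apply/seteqP; split => s /=; first by move=> ->; lia.
  by move: (Num.truncn s) => N [h1 /negP h2]; lia.
rewrite (_ : _ @^-1` Y = \bigcup_(k in Y) [set s : R | Num.truncn s = k]).
  by apply: bigcup_measurable => k _.
by apply/seteqP; split => s /=; [move=> h; exists (Num.truncn s)|move=> [k Yk /= ->]].
Qed.

Lemma measurable_comp_truncn (f : nat -> R) :
  measurable_fun setT (fun s : R => f (Num.truncn s)).
Proof. by apply: (measurableT_comp (f := f)) => //; exact: measurable_truncn. Qed.

End truncn_measurable.

(** * The time change *)
Section extension.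
Context {R : realType}.

(** The values of a right-continuous path at nonnegative times are recovered
    from countably many positive times, by a formula that makes sense for every
    element of the path space and is jointly measurable in path and time. *)
Definition path_value (e : path_space R) (s : R) : R :=
  fine (limn_esup (fun n => (e (upper_grid n s))%:E)).

Lemma path_value_cadlag (l : R -> R) s : cadlag l -> 0 <= s ->
  path_value l s = l s.
Proof.
move=> cl s0; rewrite /path_value.
suff -> : limn_esup (fun n => (l (upper_grid n s))%:E) = (l s)%:E by [].
have : (l (upper_grid n s))%:E @[n --> \oo] --> (l s)%:E.
  apply: cvg_EFin; first by near=> n.
  exact: (cadlag_upper_grid cl).
by move=> /cvg_limn_einf_sup[].
Unshelve. all: by end_near. Qed.

Lemma measurable_upper_grid_value n :
  measurable_fun setT (fun z : path_space R * R => z.1 (upper_grid n z.2)).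
Proof.
move=> _ B mB; rewrite setTI.
pose V k := [set s : R | Num.truncn (s * n.+1%:R) = k].
have mV k : measurable (V k).
  have mt : measurable_fun setT (fun s : R => Num.truncn (s * n.+1%:R)).
    by apply: (measurableT_comp measurable_truncn); exact: measurable_funM.
  have : measurable (setT `&` (fun s : R => Num.truncn (s * n.+1%:R)) @^-1` [set k]).
    exact: mt.
  by rewrite setTI.
rewrite (_ : _ @^-1` _ = \bigcup_k
   ([set e : path_space R | B (e (k.+1%:R / n.+1%:R))] `*` V k)).
  apply: bigcupT_measurable => k; apply: measurableX => //.
  have h0 : (0 : R) < k.+1%:R / n.+1%:R by rewrite divr_gt0.
  have := @measurable_coordinate R R [set t : R | 0 < t] _ h0 measurableT B mB.
  by rewrite setTI.
apply/seteqP; split => -[e s] /=; first by move=> h; exists (Num.truncn (s * n.+1%:R)).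
by move=> [k _ [/= h]]; rewrite /V /= /upper_grid => ->.
Qed.

Lemma measurable_path_value :
  measurable_fun setT (fun z : path_space R * R => path_value z.1 z.2).
Proof.
apply: (measurableT_comp (f := @fine R)) => //.
apply: measurable_fun_limn_esup => n.
by apply/measurable_EFinP; exact: measurable_upper_grid_value.
Qed.

Lemma cadlag_measurable (l : R -> R) : cadlag l -> measurable_fun `[(0 : R), +oo[ l.
Proof.
move=> cl; apply: (eq_measurable_fun (path_value l)).
  move=> s; rewrite inE /= in_itv/= andbT => s0.
  by rewrite path_value_cadlag.
apply: measurable_funTS.
exact: (measurable_fun_pair2 (f := fun z : path_space R * R => path_value z.1 z.2)
  (l : path_space R) measurable_path_value).
Qed.

Lemma cadlag_shift (l : R -> R) s : 0 <= s -> cadlag l ->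
  cadlag (shift_path s l).
Proof.
move=> s0 [lr ll]; split => t t0.
  apply/cvg_at_rightP => u [ut cu]; apply: cvgB; last exact: cvg_cst.
  have /cvg_at_rightP := lr (s + t) (addr_ge0 s0 t0); apply; split.
    by move=> n; rewrite ltrD2l.
  by apply: cvgD => //; exact: cvg_cst.
have /cvg_ex[y /cvg_at_leftP ly] := ll (s + t) (ltr_wpDl s0 t0).
apply/cvg_ex; exists (y - l s); apply/cvg_at_leftP => u [ut cu].
apply: cvgB; last exact: cvg_cst.
apply: (ly (fun n => s + u n)); split.
  by move=> n; rewrite ltrD2l.
by apply: cvgD => //; exact: cvg_cst.
Qed.

End extension.

(** The inverse of a function whose increments are comparable to those of time:
    it is increasing and Lipschitz continuous, and the infimum that defines it
    solves [A s = t]. *)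
Section inverse_clock.
Context {R : realType} (A : R -> R) (a b : R).
Hypotheses (a0 : 0 < a) (A0 : A 0 = 0).
Hypothesis A_lip : forall s s', 0 <= s -> s <= s' ->
  a * (s' - s) <= A s' - A s <= b * (s' - s).

Definition inverse_clock t := inf [set s | 0 <= s /\ t < A s].

Let b0 : 0 < b.
Proof.
have := @A_lip 0 1 (lexx _) ler01; rewrite subr0 !mulr1 => /andP[h1 h2].
by apply: lt_le_trans a0 _; exact: le_trans h2.
Qed.

Lemma clock_lt s s' : 0 <= s -> s < s' -> A s < A s'.
Proof.
move=> s0 ss'; have /andP[h _] := A_lip s0 (ltW ss').
by rewrite -subr_gt0; apply: lt_le_trans h; rewrite mulr_gt0// subr_gt0.
Qed.

Let S t := [set s | 0 <= s /\ t < A s].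

Lemma clock_unbounded t : 0 <= t -> S t (t / a + 1).
Proof.
move=> t0; have h : 0 <= t / a + 1.
  by rewrite addr_ge0// divr_ge0// ltW.
split => //; have /andP[h1 _] := A_lip (lexx 0) h.
have e : a * (t / a + 1) = t + a by field; rewrite gt_eqF.
rewrite A0 !subr0 e in h1; apply: lt_le_trans h1; by rewrite ltrDl.
Qed.

Let S_lb t : lbound (S t) 0.
Proof. by move=> s []. Qed.

Lemma inverse_clock_ge0 t : 0 <= t -> 0 <= inverse_clock t.
Proof.
move=> t0; apply: lb_le_inf; last exact: S_lb.
by exists (t / a + 1); exact: clock_unbounded.
Qed.

Lemma inverse_clockK t : 0 <= t -> A (inverse_clock t) = t.
Proof.
move=> t0; set tau := inverse_clock t.
have tau0 : 0 <= tau by exact: inverse_clock_ge0.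
have hinf : has_inf (S t).
  split; first by exists (t / a + 1); exact: clock_unbounded.
  by exists 0; exact: S_lb.
apply/eqP; rewrite eq_le; apply/andP; split; rewrite leNgt; apply/negP => h.
  have tau_gt0 : 0 < tau.
    by rewrite lt_neqAle tau0 andbT; apply/eqP => t0'; move: h; rewrite -t0' A0; lra.
  pose delta := Num.min tau ((A tau - t) / (2 * b)).
  have d0 : 0 < delta.
    by rewrite lt_min tau_gt0 /= divr_gt0 ?mulr_gt0// subr_gt0.
  have dt : delta <= tau by rewrite ge_min lexx.
  have db : b * delta <= (A tau - t) / 2.
    rewrite (_ : (A tau - t) / 2 = b * ((A tau - t) / (2 * b))).
      by rewrite ler_pM2l// ge_min lexx orbT.
    by field; rewrite gt_eqF.
  have td : 0 <= tau - delta by rewrite subr_ge0.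
  have dle : tau - delta <= tau by rewrite gerBl ltW.
  have /andP[_ h2] := A_lip td dle.
  have : S t (tau - delta).
    by split => //; move: h2; rewrite subKr; lra.
  by move=> /(ge_inf hinf.2); rewrite -/tau /inverse_clock -/(S t) => h3; 
     move: h3; rewrite -[inf _]/tau; lra.
pose delta := (t - A tau) / (2 * b).
have d0 : 0 < delta by rewrite divr_gt0 ?mulr_gt0// subr_gt0.
have [s [s0 tA] sd] := inf_adherent d0 hinf.
have ts : tau <= s by apply: (ge_inf hinf.2).
have /andP[_ h2] := A_lip tau0 ts.
have : b * (s - tau) <= b * delta.
  by rewrite ler_pM2l// lerBlDl ltW.
have -> : b * delta = (t - A tau) / 2 by rewrite /delta; field; rewrite gt_eqF.
lra.
Qed.

Lemma clockK s : 0 <= s -> inverse_clock (A s) = s.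
Proof.
move=> s0.
have As0 : 0 <= A s.
  have /andP[h _] := A_lip (lexx 0) s0; move: h; rewrite A0 !subr0.
  by apply: le_trans; rewrite mulr_ge0// ltW.
have K := inverse_clockK As0; have := inverse_clock_ge0 As0.
move: K; set tau := inverse_clock _ => K tau0.
have [ts|st|//] := ltgtP tau s.
  by have := clock_lt tau0 ts; rewrite K ltxx.
by have := clock_lt s0 st; rewrite K ltxx.
Qed.

Lemma clock_ge0 s : 0 <= s -> 0 <= A s.
Proof.
move=> s0; have /andP[h _] := A_lip (lexx 0) s0; move: h; rewrite A0 !subr0.
by apply: le_trans; rewrite mulr_ge0// ltW.
Qed.

Lemma inverse_clock_lt t t' : 0 <= t -> t < t' -> inverse_clock t < inverse_clock t'.
Proof.
move=> t0 tt'; have t'0 : 0 <= t' by apply: le_trans t0 (ltW _).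
rewrite ltNge; apply/negP; rewrite le_eqVlt => /predU1P[e|h].
  by have := inverse_clockK t0; rewrite -e inverse_clockK//; move: tt' => /[swap] ->; rewrite ltxx.
have := clock_lt (inverse_clock_ge0 t'0) h; rewrite !inverse_clockK//; lra.
Qed.

Lemma inverse_clock_lip t t' : 0 <= t -> t <= t' ->
  inverse_clock t' - inverse_clock t <= (t' - t) / a.
Proof.
move=> t0 tt'; have t'0 : 0 <= t' by apply: le_trans t0 _.
have tau : inverse_clock t <= inverse_clock t'.
  by move: tt'; rewrite le_eqVlt => /predU1P[->//|/(inverse_clock_lt t0)/ltW].
have /andP[h _] := A_lip (inverse_clock_ge0 t0) tau.
by move: h; rewrite !inverse_clockK// ler_pdivlMr// mulrC.
Qed.

End inverse_clock.

Section clock.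
Context {R : realType} (alpha : R -> R) (a b : R).
Hypotheses (a0 : 0 < a) (alpha_bnd : forall z, a <= alpha z <= b)
  (malpha : measurable_fun setT alpha).
Notation mu := (@lebesgue_measure R).

Definition clock (l : R -> R) (x s : R) : R :=
  fine (\int[mu]_(r in `[0%R, s]) (alpha (l r + x))%:E)%E.

Let alpha0 z : 0 <= alpha z.
Proof. by have /andP[h _] := alpha_bnd z; apply: le_trans h; exact: ltW. Qed.

Section cadlag_path.
Variables (l : R -> R) (x : R).
Hypothesis cl : cadlag l.

Lemma measurable_clock_rate :
  measurable_fun `[(0 : R), +oo[ (fun r => (alpha (l r + x))%:E).
Proof.
apply/measurable_EFinP; apply: (measurableT_comp malpha).
by apply: measurable_funD => //; exact: cadlag_measurable.
Qed.

Lemma integral_clock_rate_bounds s s' : 0 <= s -> s <= s' ->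
  ((a * (s' - s))%:E <= \int[mu]_(r in `]s, s']) (alpha (l r + x))%:E
    <= (b * (s' - s))%:E)%E.
Proof.
move=> s0 ss'.
have ms : measurable_fun `]s, s'] (fun r => (alpha (l r + x))%:E).
  apply: measurable_funS measurable_clock_rate => //.
  by move=> r /=; rewrite !in_itv/= andbT => /andP[h _]; apply: le_trans s0 (ltW h).
have mE c : (c * (s' - s))%:E = (\int[mu]_(r in `]s, s']) (cst c%:E r))%E.
  rewrite integral_cst//= lebesgue_measure_itv/= lte_fin.
  move: ss'; rewrite le_eqVlt => /predU1P[->|ss'].
    by rewrite ltxx subrr mulr0 mule0.
  by rewrite ss' EFinM EFinB.
have b0 : 0 <= b by have /andP[_ h] := alpha_bnd 0; exact: le_trans h.
rewrite !mE; apply/andP; split; apply: ge0_le_integral => //=.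
- by move=> r _; rewrite lee_fin ltW.
- by move=> r _; rewrite lee_fin; have /andP[] := alpha_bnd (l r + x).
- by move=> r _; rewrite lee_fin.
- by move=> r _; rewrite lee_fin; have /andP[] := alpha_bnd (l r + x).
Qed.

Lemma integral_clock_rate_add s s' : 0 <= s -> s <= s' ->
  (\int[mu]_(r in `[0%R, s']) (alpha (l r + x))%:E =
   \int[mu]_(r in `[0%R, s]) (alpha (l r + x))%:E +
   \int[mu]_(r in `]s, s']) (alpha (l r + x))%:E)%E.
Proof.
move=> s0 ss'.
have E : `[0, s']%classic = `[0, s]%classic `|` `]s, s']%classic.
  by apply: itv_bndbnd_setU; rewrite bnd_simp.
rewrite {1}E ge0_integral_setU//.
- rewrite -E; apply: measurable_funS measurable_clock_rate => //.
  by move=> r /=; rewrite !in_itv/= andbT => /andP[].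
- by move=> r _; rewrite lee_fin.
- apply/disj_set2P; rewrite -subset0 => r [] /=; rewrite !in_itv/=; lra.
Qed.

Lemma integral_clock_rate_fin s : 0 <= s ->
  (\int[mu]_(r in `[0%R, s]) (alpha (l r + x))%:E)%E = (clock l x s)%:E.
Proof.
move=> s0; rewrite /clock fineK//.
rewrite (integral_clock_rate_add (lexx 0) s0) set_itv1 integral_set1 add0e.
have /andP[h1 h2] := integral_clock_rate_bounds (lexx 0) s0.
rewrite ge0_fin_numE; first by apply: le_lt_trans h2 _; rewrite ltry.
by apply: integral_ge0 => r _; rewrite lee_fin.
Qed.

Lemma clock_at0 : clock l x 0 = 0.
Proof. by rewrite /clock set_itv1 integral_set1. Qed.

Lemma clock_lip s s' : 0 <= s -> s <= s' ->
  a * (s' - s) <= clock l x s' - clock l x s <= b * (s' - s).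
Proof.
move=> s0 ss'; have s'0 : 0 <= s' by apply: le_trans ss'.
have := integral_clock_rate_add s0 ss'.
rewrite !integral_clock_rate_fin//.
have := integral_clock_rate_bounds s0 ss'.
case: (integral _ _ _) => [r| |]; rewrite ?lee_fin ?leey_eq ?andbF//.
move=> h [->]; have -> : clock l x s + r - clock l x s = r by ring.
exact: h.
Qed.

Lemma time_change_inverse t : time_change alpha l x t = inverse_clock (clock l x) t.
Proof.
rewrite /time_change /inverse_clock; congr inf; apply/seteqP.
by split => s /= [s0]; rewrite integral_clock_rate_fin// lte_fin.
Qed.

Lemma time_change_ge0 t : 0 <= t -> 0 <= time_change alpha l x t.
Proof.
move=> t0; rewrite time_change_inverse.
exact: (inverse_clock_ge0 a0 clock_at0 clock_lip).
Qed.

Lemma clock_time_change t : 0 <= t -> clock l x (time_change alpha l x t) = t.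
Proof.
by move=> t0; rewrite time_change_inverse (inverse_clockK a0 clock_at0 clock_lip).
Qed.

Lemma time_change_clock s : 0 <= s -> time_change alpha l x (clock l x s) = s.
Proof.
by move=> s0; rewrite time_change_inverse (clockK a0 clock_at0 clock_lip).
Qed.

Lemma clock_path_ge0 s : 0 <= s -> 0 <= clock l x s.
Proof. exact: (clock_ge0 a0 clock_at0 clock_lip). Qed.

Lemma clock_path_lt s s' : 0 <= s -> s < s' -> clock l x s < clock l x s'.
Proof. exact: (clock_lt a0 clock_lip). Qed.

Lemma le_time_change s t : 0 <= s -> 0 <= t ->
  (s <= time_change alpha l x t) = (clock l x s <= t).
Proof.
move=> s0 t0; have K := clock_time_change t0; have T0 := time_change_ge0 t0.
apply/idP/idP.
  rewrite le_eqVlt => /predU1P[->|/(clock_path_lt s0)]; first by rewrite K.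
  by rewrite K => /ltW.
by rewrite -{1}K; apply: contraTT; rewrite -!ltNge; exact: clock_path_lt.
Qed.

Lemma time_change_le t : 0 <= t -> time_change alpha l x t <= t / a.
Proof.
move=> t0; have /andP[h _] := clock_lip (lexx 0) (time_change_ge0 t0).
by move: h; rewrite clock_time_change// clock_at0 !subr0 mulrC ler_pdivlMr.
Qed.

End cadlag_path.

Lemma clock_shift (l : R -> R) x s r : cadlag l -> 0 <= s -> 0 <= r ->
  clock (shift_path s l) (x + l s) r = clock l x (s + r) - clock l x s.
Proof.
move=> cl s0 r0.
have sr0 : 0 <= s + r by exact: addr_ge0.
have ssr : s <= s + r by rewrite lerDl.
have cs := cadlag_shift s0 cl.
have := integral_clock_rate_add x cl s0 ssr.
rewrite !integral_clock_rate_fin//.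
suff -> : (\int[mu]_(r0 in `]s, (s + r)%R]) (alpha (l r0 + x))%:E)%E =
    (clock (shift_path s l) (x + l s) r)%:E.
  by move=> [->]; ring.
rewrite -integral_clock_rate_fin//.
rewrite integral_itv_obnd_cbnd; last first.
  apply: measurable_funS (measurable_clock_rate x cl) => //.
  by move=> q /=; rewrite !in_itv/= andbT => /andP[h _]; apply: le_trans s0 (ltW h).
rewrite [LHS]integral_mkcond [RHS]integral_mkcond.
set h := (fun q : R => (alpha (l q + x))%:E) \_ `[s, (s + r)%R].
have mh : measurable_fun setT h.
  apply/(measurable_restrictT _ _).1 => //.
  apply: measurable_funS (measurable_clock_rate x cl) => //.
  by move=> q /=; rewrite !in_itv/= andbT => /andP[h' _]; apply: le_trans s0 h'.
have h0 q : (0 <= h q)%E.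
  by rewrite /h patchE; case: ifP => // _; rewrite lee_fin.
rewrite -(ge0_integral_translation s mh h0).
apply: eq_integral => q _; rewrite /h !patchE.
have -> : (q + s \in `[s, (s + r)]%classic) = (q \in `[0, r]%classic).
  apply/idP/idP; rewrite !inE /= !in_itv/=; lra.
case: ifP => // _; congr EFin; congr alpha.
rewrite /shift_path [q + s]addrC; ring.
Qed.

(** The flow property: both sides follow the same path, and by [clock_shift]
    restarting the clock subtracts its current value. *)
Lemma time_changed_shift (l : R -> R) x s t : cadlag l -> 0 <= s -> 0 <= t ->
  time_changed alpha (shift_path s l) (x + l s) t =
  time_changed alpha l x (clock l x s + t).
Proof.
move=> cl s0 t0; have cs := cadlag_shift s0 cl.
have tau0 := time_change_ge0 (x + l s) cs t0.
rewrite /time_changed.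
have -> : time_change alpha l x (clock l x s + t) =
    s + time_change alpha (shift_path s l) (x + l s) t.
  rewrite -[RHS](time_change_clock x cl); last exact: addr_ge0.
  congr time_change; rewrite -{1}(clock_time_change (x + l s) cs t0).
  by rewrite clock_shift//; ring.
by rewrite /shift_path; ring.
Qed.

(** By clock time [t] the path has been run until a natural time at most [t / a]. *)
Lemma time_changed_exceed (l : R -> R) x t u S : cadlag l ->
  0 <= t -> t < S -> u < time_changed alpha l x t -> exceed_before u (S / a) (x, l).
Proof.
move=> cl t0 tS ut; apply: (@cadlag_exceed_before _ l x u _ (time_change alpha l x t)) => //.
rewrite time_change_ge0//=; apply: le_lt_trans (time_change_le x cl t0) _.
by rewrite ltr_pM2r// invr_gt0.
Qed.

End clock.

Section process_value.
Context {R : realType} (alpha : R -> R) (a b : R).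
Hypotheses (a0 : 0 < a) (alpha_bnd : forall z, a <= alpha z <= b)
  (malpha : measurable_fun setT alpha).
Notation mu := (@lebesgue_measure R).
Local Notation start_path := (R * path_space R)%type.

(** Extensions to the whole path space, jointly measurable in the starting point,
    the path and the time. The infimum in the time change becomes the length of
    the set of times at which the clock is at most [z.2], so that measurability
    follows from Tonelli's theorem at each step. *)
Definition rate_value (z : start_path * R) : R :=
  alpha (path_value z.1.2 z.2 + z.1.1).

Definition clock_value (z : start_path * R) : R :=
  fine (\int[mu]_r ((if (0 <= r) && (r <= z.2)
    then rate_value (z.1, r) else 0)%:E))%E.

Definition time_change_value (z : start_path * R) : R :=
  fine (\int[mu]_s ((if (0 <= s) && (clock_value (z.1, s) <= z.2)
    then 1 else 0)%:E))%E.

Definition process_value (z : start_path * R) : R :=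
  path_value z.1.2 (time_change_value z) + z.1.1.

Let rate0 z : 0 <= rate_value z.
Proof.
by have /andP[h _] := alpha_bnd (path_value z.1.2 z.2 + z.1.1); apply: le_trans h; exact: ltW.
Qed.

Lemma measurable_path_value_comp d (T : measurableType d)
    (f : T -> path_space R) (g : T -> R) :
  measurable_fun setT f -> measurable_fun setT g ->
  measurable_fun setT (fun z => path_value (f z) (g z)).
Proof.
move=> mf mg.
exact: (measurableT_comp measurable_path_value (measurable_fun_pair mf mg)).
Qed.

Lemma measurable_rate_value : measurable_fun setT rate_value.
Proof.
apply: (measurableT_comp malpha); apply: measurable_funD.
  apply: measurable_path_value_comp => //.
  exact: (measurableT_comp measurable_snd measurable_fst).
exact: (measurableT_comp measurable_fst measurable_fst).
Qed.

Lemma measurable_clock_value : measurable_fun setT clock_value.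
Proof.
apply: (measurableT_comp (f := @fine R)) => //.
pose F (z : (start_path * R) * R) : \bar R := (if (0 <= z.2) && (z.2 <= z.1.2)
    then rate_value (z.1.1, z.2) else 0)%:E.
have mF : measurable_fun setT F.
  apply/measurable_EFinP; apply: measurable_fun_ifT => //.
    apply: measurable_and; apply: measurable_fun_ler => //.
    exact: (measurableT_comp measurable_snd measurable_fst).
  apply: (measurableT_comp measurable_rate_value).
  apply: measurable_fun_pair => //.
  exact: (measurableT_comp measurable_fst measurable_fst).
apply: (measurable_fun_fubini_tonelli_F F (m2 := mu) mF).
by move=> z; rewrite /F lee_fin; case: ifP.
Qed.

Lemma measurable_time_change_value : measurable_fun setT time_change_value.
Proof.
apply: (measurableT_comp (f := @fine R)) => //.
pose F (z : (start_path * R) * R) : \bar R :=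
  (if (0 <= z.2) && (clock_value (z.1.1, z.2) <= z.1.2) then 1 else 0)%:E.
have mF : measurable_fun setT F.
  apply/measurable_EFinP; apply: measurable_fun_ifT => //.
  apply: measurable_and; apply: measurable_fun_ler => //.
    apply: (measurableT_comp measurable_clock_value).
    apply: measurable_fun_pair => //.
    exact: (measurableT_comp measurable_fst measurable_fst).
  exact: (measurableT_comp measurable_snd measurable_fst).
apply: (measurable_fun_fubini_tonelli_F F (m2 := mu) mF).
by move=> z; rewrite /F lee_fin; case: ifP.
Qed.

Lemma measurable_process_value : measurable_fun setT process_value.
Proof.
apply: measurable_funD.
  apply: measurable_path_value_comp; last exact: measurable_time_change_value.
  exact: (measurableT_comp measurable_snd measurable_fst).
exact: (measurableT_comp measurable_fst measurable_fst).
Qed.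

Section cadlag_path.
Variables (l : R -> R) (x : R).
Hypothesis cl : cadlag l.

Lemma rate_valueE u : 0 <= u -> rate_value ((x, l), u) = alpha (l u + x).
Proof. by move=> u0; rewrite /rate_value /= path_value_cadlag. Qed.

Lemma clock_valueE s : clock_value ((x, l), s) = clock alpha l x s.
Proof.
rewrite /clock_value /clock; congr fine; rewrite [RHS]integral_mkcond.
apply: eq_integral => r _; rewrite patchE mem_setE in_itv/=.
by case: ifP => // /andP[r0 _]; rewrite rate_valueE.
Qed.

Lemma time_change_valueE t : 0 <= t ->
  time_change_value ((x, l), t) = time_change alpha l x t.
Proof.
move=> t0; have T0 := time_change_ge0 a0 alpha_bnd malpha x cl t0.
rewrite /time_change_value.
transitivity (fine (\int[mu]_(s in `[0%R, time_change alpha l x t]) (cst 1%E s)))%E.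
  congr fine; rewrite [RHS]integral_mkcond.
  apply: eq_integral => s _; rewrite patchE mem_setE in_itv/= clock_valueE.
  have [s0|//] := boolP (0 <= s).
  rewrite (le_time_change a0 alpha_bnd malpha x cl s0 t0)/=.
  by case: ifP.
rewrite integral_cst//= mul1e lebesgue_measure_itv/= lte_fin.
move: T0; rewrite le_eqVlt => /predU1P[<-|T0]; first by rewrite ltxx.
by rewrite T0 sube0.
Qed.

Lemma process_valueE t : 0 <= t ->
  process_value ((x, l), t) = time_changed alpha l x t.
Proof.
move=> t0; rewrite /process_value /= time_change_valueE// path_value_cadlag//.
exact: (time_change_ge0 a0 alpha_bnd malpha x cl t0).
Qed.

End cadlag_path.

End process_value.

Section density.
Context {R : realType} d (T : measurableType d) (m : {measure set T -> \bar R})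
  (f : T -> \bar R).
Hypotheses (mf : measurable_fun setT f) (f0 : forall x, (0 <= f x)%E).
Local Open Scope ereal_scope.

Definition density_measure (A : set T) : \bar R := \int[m]_(x in A) f x.

Let dens0 : density_measure set0 = 0.
Proof. by rewrite /density_measure integral_set0. Qed.

Let dens_ge0 A : 0 <= density_measure A.
Proof. by apply: integral_ge0. Qed.

Let dens_sigma_additive : semi_sigma_additive density_measure.
Proof.
move=> F mF tF mUF; rewrite /density_measure ge0_integral_bigcup//.
  by apply: is_cvg_nneseries => n _ _; exact: dens_ge0.
exact: measurable_funTS.
Qed.

HB.instance Definition _ := isMeasure.Build _ _ _ density_measure
  dens0 dens_ge0 dens_sigma_additive.

End density.

Section clock_transport.
Context {R : realType} (alpha : R -> R) (a b : R).
Hypotheses (a0 : 0 < a) (alpha_bnd : forall z, a <= alpha z <= b)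
  (malpha : measurable_fun setT alpha).
Notation mu := (@lebesgue_measure R).

Variables (l : R -> R) (x : R).
Hypothesis cl : cadlag l.
Local Open Scope ereal_scope.

Let y : R * path_space R := (x, l).

Let rate (u : R) : \bar R :=
  (if (0 < u)%R then rate_value alpha (y, u) else 0%R)%:E.

Let rate0 u : 0 <= rate u.
Proof.
rewrite /rate lee_fin; case: ifP => // u0.
by have /andP[h _] := alpha_bnd (path_value l u + x)%R; apply: le_trans h; exact: ltW.
Qed.

Let mrate : measurable_fun setT rate.
Proof.
apply/measurable_EFinP; apply: measurable_fun_ifT => //.
  exact: measurable_fun_ltr.
exact: (measurableT_comp (measurable_rate_value malpha) (pair1_measurable y)).
Qed.

Let c (u : R) : R := clock_value alpha (y, u).

Let mc : measurable_fun setT c.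
Proof.
exact: (measurableT_comp (measurable_clock_value a0 alpha_bnd malpha)
  (pair1_measurable y)).
Qed.

Let dens : set R -> \bar R := density_measure mu rate.

Let kappa_itv (p q : R) : (0 <= p)%R -> (p < q)%R ->
  dens (c @^-1` `]p, q]) = (q - p)%:E.
Proof.
move=> p0 pq; have q0 : (0 <= q)%R by apply: le_trans p0 (ltW pq).
have CE u : c u = clock alpha l x u by exact: clock_valueE.
pose tau := time_change alpha l x.
have tp0 : (0 <= tau p)%R by exact: (time_change_ge0 a0 alpha_bnd malpha x cl).
have tq0 : (0 <= tau q)%R by exact: (time_change_ge0 a0 alpha_bnd malpha x cl).
have letau := le_time_change a0 alpha_bnd malpha x cl.
have tpq : (tau p <= tau q)%R.
  rewrite /tau letau//.
  by rewrite (clock_time_change a0 alpha_bnd malpha x cl p0) ltW.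
rewrite /dens /density_measure.
transitivity (\int[mu]_(u in `]tau p, tau q]) (alpha (l u + x))%:E).
  rewrite [LHS]integral_mkcond [RHS]integral_mkcond.
  apply: eq_integral => u _; rewrite !patchE.
  have [u0|u0] := ltP 0%R u; last first.
    rewrite /rate ltNge u0 /=.
    case: ifP => _; rewrite mem_setE in_itv/=;
      by have -> : (tau p < u)%R = false by apply/negbTE; rewrite -leNgt; apply: le_trans u0 _.
  have -> : (u \in c @^-1` `]p, q]) = (u \in `]tau p, tau q]%classic).
    have H1 := letau _ _ (ltW u0) q0.
    have H2 : (tau p < u)%R = (p < clock alpha l x u)%R.
      by rewrite !ltNge /tau letau// ltW.
    by apply/idP/idP; rewrite !inE /= CE !in_itv/= H2 H1.
  by rewrite /rate u0 /y (rate_valueE alpha x cl (ltW u0)).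
have := integral_clock_rate_add a0 alpha_bnd malpha x cl tp0 tpq.
rewrite !(integral_clock_rate_fin a0 alpha_bnd malpha x cl)//.
rewrite !(clock_time_change a0 alpha_bnd malpha x cl)//.
case: (integral _ _ _) => // r [->].
by congr EFin; ring.
Qed.

(** The clock transports [alpha (l u + x) du] to Lebesgue measure on the positive
    half-line: while it runs through an interval it spends there the length of
    the interval. Restoring Lebesgue measure on the negative half-line gives a
    measure on [R] that is recognized by its values on intervals. *)
Lemma clock_transport (A : set R) : measurable A ->
  \int[mu]_u ((if (0 < u)%R && (clock_value alpha (y, u) \in A)
     then rate_value alpha (y, u) else 0)%R)%:E = mu (A `&` `]0%R, +oo[).
Proof.
move=> mA.
transitivity (dens (c @^-1` A)).
  rewrite /dens /density_measure [RHS]integral_mkcond.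
  apply: eq_integral => u _; rewrite patchE /rate.
  have -> : (u \in c @^-1` A) = (clock_value alpha (y, u) \in A).
    by apply/idP/idP; rewrite !inE.
  by case: (0 < u)%R; case: (_ \in A).
(* the measure structures on densities and push-forwards are indexed by proofs *)
pose densm0 := density_measure
  (mu : {measure set (measurableTypeR R) -> \bar R}) rate
  : {measure set (measurableTypeR R) -> \bar R}.
pose densm := densm0 mrate rate0.
pose kap0 := pushforward densm (c : measurableTypeR R -> measurableTypeR R)
  : {measure set (measurableTypeR R) -> \bar R}.
pose kap := kap0 mc.
pose neg := `]-oo, 0%R]%classic : set (measurableTypeR R).
have mneg : measurable neg by exact: measurable_itv.
pose m' : {measure set (measurableTypeR R) -> \bar R} :=
  measure_add kap (mrestr mu mneg).
have m'E B : m' B = dens (c @^-1` B) + mu (B `&` neg) by exact: (measure_addE kap (mrestr mu mneg) B).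
suff key : forall B, measurable B -> mu B = m' B.
  have mAp : measurable (A `&` `]0%R, +oo[) by exact: measurableI.
  rewrite (key _ mAp) m'E -setIA.
  have -> : `]0%R, +oo[ `&` neg = set0 :> set R.
    by rewrite -subset0 => u [] /=; rewrite /neg /= !in_itv/=; lra.
  rewrite setI0 measure0 adde0 /dens /density_measure.
  rewrite [LHS]integral_mkcond [RHS]integral_mkcond.
  apply: eq_integral => u _; rewrite !patchE.
  have [u0|u0] := ltP 0%R u; last first.
    by rewrite /rate ltNge u0 /= !if_same.
  have cu0 : (0 < c u)%R.
    have CE v : c v = clock alpha l x v by exact: clock_valueE.
    rewrite CE -(clock_at0 alpha l x).
    exact: (clock_path_lt a0 alpha_bnd malpha x cl (lexx 0%R) u0).
  congr (if _ then _ else _); apply/idP/idP; rewrite !inE /=.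
    by move=> ?; split => //; rewrite in_itv/= andbT.
  by move=> [].
apply: lebesgue_measure_unique => _ [[p q] _ <-].
rewrite [RHS]m'E /=.
have [pq|qp] := ltP p q; last first.
  rewrite set_itv_ge; last by rewrite bnd_simp -leNgt.
  by rewrite set0I measure0 preimage_set0 /dens /density_measure integral_set0 adde0.
have dens_neg v w : (w <= 0)%R -> dens (c @^-1` `]v, w]) = 0.
  move=> w0; rewrite /dens /density_measure; apply: integral0_eq => u /=.
  rewrite in_itv/= => /andP[_ cw]; rewrite /rate; case: ifPn => // u0; exfalso.
  have CE v' : c v' = clock alpha l x v' by exact: clock_valueE.
  have := clock_path_lt a0 alpha_bnd malpha x cl (lexx 0%R) u0.
  by rewrite clock_at0 -CE; lra.
rewrite lebesgue_measure_itv/= lte_fin pq.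
have [q0|q0] := leP q 0%R.
  rewrite dens_neg// add0e (_ : _ `&` neg = `]p, q]%classic).
    by rewrite lebesgue_measure_itv/= lte_fin pq.
  by apply/seteqP; split => u; rewrite /neg /= !in_itv/=; lra.
have [p0|p0] := leP 0%R p.
  rewrite kappa_itv// (_ : _ `&` neg = set0).
    by rewrite measure0 adde0.
  by rewrite -subset0 => u; rewrite /neg /= !in_itv/=; lra.
have -> : dens (c @^-1` `]p, q]) = dens (c @^-1` `]0%R, q]).
  rewrite /dens /density_measure [LHS]integral_mkcond [RHS]integral_mkcond.
  apply: eq_integral => u _; rewrite !patchE.
  have [u0|u0] := ltP 0%R u; last by rewrite /rate ltNge u0 /= !if_same.
  have cu0 : (0 < c u)%R.
    have CE v : c v = clock alpha l x v by exact: clock_valueE.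
    rewrite CE -(clock_at0 alpha l x).
    exact: (clock_path_lt a0 alpha_bnd malpha x cl (lexx 0%R) u0).
  congr (if _ then _ else _); apply/idP/idP; rewrite !inE /= !in_itv/=; lra.
rewrite kappa_itv// (_ : _ `&` neg = `]p, 0%R]%classic).
  by rewrite lebesgue_measure_itv/= lte_fin p0 -!EFinB -EFinD; congr EFin; ring.
by apply/seteqP; split => u; rewrite /neg /= !in_itv/=; lra.
Qed.

End clock_transport.

(** * Invariance under the time-changed flow *)
Section path_integral.
Context {R : realType} d (T : measurableType d) (P : probability T R)
  (L : R -> {RV P >-> R}) (L_levy : levy_process P L)
  (L_exp : ('E_P[fun w => expR (L 1%R w)] = 1)%E).
Local Open Scope ereal_scope.
Notation mu := (@lebesgue_measure R).
Local Notation start_path := (R * path_space R)%type.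

Definition path_integral (f : start_path -> \bar R) : \bar R :=
  flow_integral P (fun z => f (z.1, path_of L z.2)).

Let mpath := measurable_path_of L.

Lemma measurable_start_path :
  measurable_fun setT (fun z : R * T => (z.1, path_of L z.2)).
Proof.
by apply: measurable_fun_pair => //; exact: (measurableT_comp mpath measurable_snd).
Qed.

Lemma measurable_weighted (f : start_path -> \bar R) : measurable_fun setT f ->
  measurable_fun setT (fun z : R * T => (expR (- z.1))%:E * f (z.1, path_of L z.2)).
Proof.
move=> mf; apply: emeasurable_funM; first exact: measurable_weight.
exact: (measurableT_comp mf measurable_start_path).
Qed.

Lemma weighted_ge0 (f : start_path -> \bar R) : (forall y, 0 <= f y) ->
  forall z : R * T, 0 <= (expR (- z.1))%:E * f (z.1, path_of L z.2).
Proof. by move=> f0 z; rewrite mule_ge0// lee_fin expR_ge0. Qed.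

Lemma path_integralE (f : start_path -> \bar R) : measurable_fun setT f -> (forall y, 0 <= f y) ->
  path_integral f =
  \int[mu]_x ((expR (- x))%:E * \int[P]_w f (x, path_of L w)).
Proof.
move=> mf f0; rewrite /path_integral flow_integralE//.
exact: (measurableT_comp mf measurable_start_path).
Qed.

Lemma eq_path_integral (f g : start_path -> \bar R) :
  (forall x l, cadlag l -> f (x, l) = g (x, l)) -> path_integral f = path_integral g.
Proof.
move=> fg; apply: eq_integral => z _; congr (_ * _); apply: fg.
by have [_ + _ _] := L_levy; apply.
Qed.

Lemma path_integral_shift s (f : start_path -> \bar R) : (0 < s)%R -> measurable_fun setT f ->
  (forall y, 0 <= f y) ->
  path_integral (fun y => f (y.1 + y.2 s, shift_path s y.2)%R) = path_integral f.
Proof. by move=> s0 mf f0; exact: (flow_shift_invariance L_levy L_exp s0 mf f0). Qed.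

Lemma path_integralD (f g : start_path -> \bar R) : measurable_fun setT f -> (forall y, 0 <= f y) ->
  measurable_fun setT g -> (forall y, 0 <= g y) ->
  path_integral (fun y => f y + g y) = path_integral f + path_integral g.
Proof.
move=> mf f0 mg g0; rewrite /path_integral /flow_integral.
rewrite -(ge0_integralD _ measurableT).
- by apply: eq_integral => z _; rewrite ge0_muleDr.
- by move=> z _; exact: weighted_ge0.
- exact: measurable_weighted.
- by move=> z _; exact: weighted_ge0.
- exact: measurable_weighted.
Qed.

Lemma path_integral_ge0 (f : start_path -> \bar R) : (forall y, 0 <= f y) -> 0 <= path_integral f.
Proof. by move=> f0; apply: integral_ge0 => z _; exact: weighted_ge0. Qed.

Lemma le_path_integral (f g : start_path -> \bar R) : measurable_fun setT f -> (forall y, 0 <= f y) ->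
  measurable_fun setT g ->
  (forall x l, cadlag l -> f (x, l) <= g (x, l)) ->
  path_integral f <= path_integral g.
Proof.
move=> mf f0 mg fg; apply: ge0_le_integral => //.
- by move=> z _; exact: weighted_ge0.
- exact: measurable_weighted.
- exact: measurable_weighted.
- move=> z _; apply: lee_wpmul2l; first by rewrite lee_fin expR_ge0.
  by apply: fg; have [_ + _ _] := L_levy; apply.
Qed.

Lemma path_integral_tonelli (F : start_path * R -> \bar R) :
  measurable_fun setT F -> (forall z, 0 <= F z) ->
  path_integral (fun y => \int[mu]_u F (y, u)) =
  \int[mu]_u path_integral (fun y => F (y, u)).
Proof.
move=> mF F0.
have mFu u : measurable_fun setT (fun y => F (y, u)).
  exact: (measurableT_comp mF (pair2_measurable u)).
have mFint : measurable_fun setT (fun y => \int[mu]_u F (y, u)).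
  exact: (measurable_fun_fubini_tonelli_F F (m2 := mu) mF F0).
have Fint0 y : 0 <= \int[mu]_u F (y, u) by apply: integral_ge0.
rewrite (path_integralE mFint Fint0).
under [RHS]eq_integral do rewrite (path_integralE (mFu _) (fun y => F0 (y, _))).
pose G (z : (R * R) * T) := F ((z.1.1, path_of L z.2), z.1.2).
have mG : measurable_fun setT G.
  apply: (measurableT_comp mF); apply: measurable_fun_pair; last first.
    exact: (measurableT_comp measurable_snd measurable_fst).
  apply: measurable_fun_pair.
    exact: (measurableT_comp measurable_fst measurable_fst).
  exact: (measurableT_comp mpath measurable_snd).
pose H (z : R * R) := (expR (- z.1))%:E * \int[P]_w G (z, w).
have mH : measurable_fun setT H.
  apply: emeasurable_funM.
    apply/measurable_EFinP; apply: (measurableT_comp (f := @expR R)) => //.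
    exact: measurableT_comp.
  exact: (measurable_fun_fubini_tonelli_F G (m2 := P) mG (fun z => F0 _)).
have H0 z : 0 <= H z.
  by apply: mule_ge0; [rewrite lee_fin expR_ge0|apply: integral_ge0 => w _; exact: F0].
rewrite -[RHS](@fubini_tonelli _ _ _ _ _ mu mu H mH H0).
apply: eq_integral => x _; rewrite /fubini_F /H /= ge0_integralZlT.
- congr (_ * _).
  have mGx : measurable_fun setT (fun z : T * R => G ((x, z.2), z.1)).
    apply: (measurableT_comp mG); apply: measurable_fun_pair => //.
    by apply: measurable_fun_pair.
  exact: (@fubini_tonelli _ _ _ _ _ P mu (fun z : T * R => G ((x, z.2), z.1)) mGx (fun z => F0 _)).
- have := measurable_fun_fubini_tonelli_F G (m2 := P) mG (fun z => F0 _).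
  move=> h; exact: (measurableT_comp h (pair1_measurable x)).
- by move=> u; apply: integral_ge0 => w _; exact: F0.
- by rewrite lee_fin expR_ge0.
Qed.

End path_integral.

Section invariance.
Context {R : realType} (alpha : R -> R) (a b : R).
Hypotheses (a0 : 0 < a) (alpha_bnd : forall z, a <= alpha z <= b)
  (malpha : measurable_fun setT alpha).
Context d (T : measurableType d) (P : probability T R)
  (L : R -> {RV P >-> R}) (L_levy : levy_process P L)
  (L_exp : ('E_P[fun w => expR (L 1%R w)] = 1)%E).
Notation mu := (@lebesgue_measure R).
Local Notation start_path := (R * path_space R)%type.
Local Notation rate := (rate_value alpha).
Local Notation clk := (clock_value alpha).
Local Notation Q := (path_integral L).

Let rate0 z : 0 <= rate z.
Proof.
by have /andP[h _] := alpha_bnd (path_value z.1.2 z.2 + z.1.1); apply: le_trans h; exact: ltW.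
Qed.

Let alpha0 x : 0 <= alpha x.
Proof. by have /andP[h _] := alpha_bnd x; apply: le_trans h; exact: ltW. Qed.

Definition clock_spent (S : start_path * R -> bool) (y : start_path) : \bar R :=
  (\int[mu]_u (if S (y, u) then rate (y, u) else 0)%:E)%E.

Let mclk : measurable_fun setT clk := measurable_clock_value a0 alpha_bnd malpha.

Let mrateS (S : start_path * R -> bool) : measurable_fun setT S ->
  measurable_fun setT (fun z => (if S z then rate z else 0)%:E).
Proof.
move=> mS; apply/measurable_EFinP; apply: measurable_fun_ifT => //.
exact: measurable_rate_value.
Qed.

Let rateS0 (S : start_path * R -> bool) z : (0 <= (if S z then rate z else 0)%:E)%E.
Proof. by rewrite lee_fin; case: ifP. Qed.

Lemma measurable_clock_spent S : measurable_fun setT S ->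
  measurable_fun setT (clock_spent S).
Proof.
move=> mS.
exact: (measurable_fun_fubini_tonelli_F _ (m2 := mu) (mrateS mS) (rateS0 S)).
Qed.

Lemma clock_spent_ge0 S y : (0 <= clock_spent S y)%E.
Proof. by apply: integral_ge0. Qed.

Let clock_spentU S1 S2 S y : measurable_fun setT S1 -> measurable_fun setT S2 ->
  (forall u, S (y, u) = S1 (y, u) || S2 (y, u)) ->
  (forall u, ~~ (S1 (y, u) && S2 (y, u))) ->
  (clock_spent S y = clock_spent S1 y + clock_spent S2 y)%E.
Proof.
move=> mS1 mS2 SE S12; rewrite /clock_spent -ge0_integralD//.
- apply: eq_integral => u _; rewrite SE; have := S12 u.
  by case: (S1 _); case: (S2 _) => //= _; rewrite -EFinD ?addr0 ?add0r.
- exact: (measurableT_comp (mrateS mS1) (pair1_measurable y)).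
- exact: (measurableT_comp (mrateS mS2) (pair1_measurable y)).
Qed.

(** A property of the time-changed process seen from time [t]. *)
Variable E : start_path * R -> bool.
Hypothesis mE : measurable_fun setT E.
Hypothesis flowE : forall l x s t, cadlag l -> 0 < s -> 0 <= t ->
  E ((x + l s, shift_path s l), t) = E ((x, l), clock alpha l x s + t).

Let G h := Q (fun y => (if E (y, h) then alpha y.1 else 0)%:E).

Let mEh h : measurable_fun setT (fun y => (if E (y, h) then alpha y.1 else 0)%:E).
Proof.
apply/measurable_EFinP; apply: measurable_fun_ifT => //.
  exact: (measurableT_comp mE (pair2_measurable h)).
exact: (measurableT_comp malpha measurable_fst).
Qed.

Let mEclk h : measurable_fun setT (fun z => E (z.1, clk z + h)).
Proof.
apply: (measurableT_comp mE); apply: measurable_fun_pair => //.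
exact: measurable_funD.
Qed.

(** Natural times at most [c] at which the process, [h] later in clock time,
    satisfies [E]. *)
Let strip c h (z : start_path * R) := (0 < z.2) && (z.2 <= c) && E (z.1, clk z + h).

Let mstrip c h : measurable_fun setT (strip c h).
Proof.
apply: measurable_and => //; apply: measurable_and; exact: measurable_fun_ler || exact: measurable_fun_ltr.
Qed.

(** The flow-invariant law gives every instant of the original time scale the
    same weight, so the time scale disappears from the integral over a strip. *)
Lemma path_integral_strip c h : 0 <= c -> 0 <= h ->
  (Q (clock_spent (strip c h)) = c%:E * G h)%E.
Proof.
move=> c0 h0.
transitivity (\int[mu]_u Q (fun y =>
    (if strip c h (y, u) then rate (y, u) else 0)%:E))%E.
  exact: (path_integral_tonelli L (mrateS (mstrip c h)) (rateS0 _)).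
transitivity (\int[mu]_(u in `]0%R, c]) (cst (G h) u))%E; last first.
  rewrite integral_cst//= lebesgue_measure_itv/= lte_fin muleC.
  by move: c0; rewrite le_eqVlt => /predU1P[<-|->]; rewrite ?ltxx ?sube0.
rewrite [RHS]integral_mkcond; apply: eq_integral => u _.
rewrite patchE mem_setE in_itv/=.
have [u0|u0] := ltP 0 u; last first.
  rewrite /=; transitivity (Q (cst 0%E)).
    by apply: (eq_path_integral L_levy) => x l cl; rewrite /strip /= ltNge u0.
  by apply: integral0_eq => z _; rewrite mule0.
have [uc|uc] := leP u c; last first.
  transitivity (Q (cst 0%E)).
    by apply: (eq_path_integral L_levy) => x l cl; rewrite /strip /= leNgt uc andbF.
  by apply: integral0_eq => z _; rewrite mule0.
rewrite /= /G -(path_integral_shift L_levy L_exp u0 (mEh h)); last first.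
  by move=> y; rewrite lee_fin; case: ifP.
apply: (eq_path_integral L_levy) => x l cl.
rewrite /strip /= u0 uc /= flowE// clock_valueE//.
by rewrite (rate_valueE alpha x cl (ltW u0)) [l u + x]addrC.
Qed.

(** Natural times whose clock value is at most [h]. *)
Let early h (z : start_path * R) := (0 < z.2) && (clk z <= h) && E (z.1, clk z + 0).

Let mearly h : measurable_fun setT (early h).
Proof.
apply: measurable_and => //; apply: measurable_and.
  exact: measurable_fun_ltr.
exact: measurable_fun_ler.
Qed.

(** The clock reaches [h] before natural time [h / a]. *)
Lemma path_integral_clock_lty h : 0 <= h -> (G 0 < +oo)%E ->
  (Q (clock_spent (early h)) < +oo)%E.
Proof.
move=> h0 Gfin.
have ha0 : 0 <= h / a by apply: divr_ge0; [exact: h0|exact: ltW].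
apply: (@le_lt_trans _ _ (Q (clock_spent (strip (h / a) 0)))); last first.
  rewrite (path_integral_strip ha0 (lexx 0)).
  by apply: lte_mul_pinfty; [rewrite lee_fin|by []|exact: Gfin].
apply: (le_path_integral L_levy).
- exact: (measurable_clock_spent (mearly h)).
- exact: clock_spent_ge0.
- exact: (measurable_clock_spent (mstrip (h / a) 0)).
move=> x l cl; apply: ge0_le_integral.
- exact: measurableT.
- by move=> u _; exact: rateS0.
- exact: (measurableT_comp (mrateS (mearly h)) (pair1_measurable ((x, l) : start_path))).
- exact: (measurableT_comp (mrateS (mstrip (h / a) 0)) (pair1_measurable ((x, l) : start_path))).
move=> u _; rewrite lee_fin /early /strip /=.
have [u0|u0] := ltP 0 u; last exact: lexx.
rewrite /=; have [uh|uh] := leP (clk ((x, l), u)) h; last by case: ifP.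
have -> : u <= h / a.
  rewrite ler_pdivlMr; last exact: a0.
  rewrite mulrC; apply: le_trans uh.
  have /andP[+ _] := clock_lip a0 alpha_bnd malpha x cl (lexx 0) (ltW u0).
  by rewrite clock_at0 !subr0 clock_valueE.
exact: lexx.
Qed.

(** Cut the clock times up to [c + h], where [c] is the clock at natural time 1,
    in two ways: at [c], into [S1] and [S2], and at [h], into [S3] and [S4]. The
    means of [S1] and of [S4] are [G 0] and [G h], the latter because translating
    clock time by [- h] turns [S4] into a strip. The mean of [S2] is that of
    [S3], by invariance under the shift by one unit of natural time, and it is
    finite. *)
Lemma alpha_weighted_invariance h : 0 <= h -> (G 0 < +oo)%E -> G h = G 0.
Proof.
move=> h0 Gfin.
pose S1 := strip 1 0; pose S5 := strip 1 h.
pose S2 (z : start_path * R) := (1 < z.2) && (clk z <= clk (z.1, 1) + h) && E (z.1, clk z + 0).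
pose S3 := early h.
pose S4 (z : start_path * R) := (0 < z.2) && ((h < clk z) && (clk z <= clk (z.1, 1) + h)) && E (z.1, clk z + 0).
pose S (z : start_path * R) := (0 < z.2) && (clk z <= clk (z.1, 1) + h) && E (z.1, clk z + 0).
have mclk1 : measurable_fun setT (fun z : start_path * R => clk (z.1, 1) + h).
  apply: measurable_funD => //.
  apply: (measurableT_comp mclk); exact: measurable_fun_pair.
have mS1 : measurable_fun setT S1 by exact: mstrip.
have mS5 : measurable_fun setT S5 by exact: mstrip.
have mS2 : measurable_fun setT S2.
  apply: measurable_and => //; apply: measurable_and.
    exact: measurable_fun_ltr.
  exact: measurable_fun_ler.
have mS3 : measurable_fun setT S3 by exact: mearly.
have mS4 : measurable_fun setT S4.
  apply: measurable_and => //; apply: measurable_and.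
    exact: measurable_fun_ltr.
  apply: measurable_and; first exact: measurable_fun_ltr.
  exact: measurable_fun_ler.
have clk_lt x l u v : cadlag l -> 0 <= u -> (clk ((x, l), u) < clk ((x, l), v)) = (u < v).
  move=> cl u0; rewrite !clock_valueE//.
  have [v0|v0] := leP 0 v; last first.
    have -> : (u < v) = false by apply/negbTE; rewrite -leNgt ltW// (lt_le_trans v0).
    have -> : clock alpha l x v = 0.
      by rewrite /clock set_itv_ge ?integral_set0// bnd_simp -ltNge.
    apply/negbTE; rewrite -leNgt.
    exact: (clock_path_ge0 a0 alpha_bnd malpha x cl u0).
  have [uv|vu|->] := ltgtP u v; last by rewrite ltxx.
    by rewrite (clock_path_lt a0 alpha_bnd malpha x cl).
  by apply/negbTE; rewrite -leNgt ltW// (clock_path_lt a0 alpha_bnd malpha x cl).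
have clk0 x l : cadlag l -> clk ((x, l), 0) = 0.
  by move=> cl; rewrite clock_valueE// clock_at0.
have clk1_ge0 x l : cadlag l -> 0 < clk ((x, l), 1).
  by move=> cl; rewrite -(clk0 x l cl) clk_lt.
have eq12 x l : cadlag l -> (clock_spent S (x, l) = clock_spent S1 (x, l) + clock_spent S2 (x, l))%E.
  move=> cl; apply: clock_spentU => // u.
    rewrite /S /S1 /S2 /strip /= -andb_orl; congr (_ && _).
    have [u0|u0] := ltP 0 u; last by rewrite /= ltNge (le_trans u0).
    rewrite /=; have [u1|//] := leP u 1.
    rewrite orbF; apply: le_trans (_ : clk ((x, l), 1) <= _); last by rewrite lerDl.
    by rewrite leNgt clk_lt// -leNgt.
  by rewrite /S1 /S2 /strip /=; have [] := ltP 1 u; rewrite ?andbF.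
have eq34 x l : cadlag l -> (clock_spent S (x, l) = clock_spent S3 (x, l) + clock_spent S4 (x, l))%E.
  move=> cl; apply: clock_spentU => // u.
    rewrite /S /S3 /early /S4 /= -andb_orl; congr (_ && _).
    case: (0 < u) => //=; have [uh|//] := leP (clk ((x, l), u)) h.
    by rewrite orbF; apply: le_trans uh _; rewrite lerDr ltW// clk1_ge0.
  by rewrite /S3 /early /S4 /=; have [] := leP (clk ((x, l), u)) h; rewrite ?andbF.
pose B x l := [set t : R | (h < t <= clk ((x, l), 1) + h) && E ((x, l), t)].
have mB x (l : path_space R) : measurable (B x l).
  have mEl : measurable_fun setT (fun t => E ((x, l), t)).
    exact: (measurableT_comp mE (pair1_measurable (x, l))).
  have : measurable_fun setT (fun t : R => (h < t <= clk ((x, l), 1) + h) && E ((x, l), t)).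
    apply: measurable_and => //; apply: measurable_and.
      exact: measurable_fun_ltr.
    exact: measurable_fun_ler.
  by move=> /(_ measurableT [set true] I); rewrite setTI.
have eq45 x l : cadlag l -> clock_spent S4 (x, l) = clock_spent S5 (x, l).
  move=> cl.
  transitivity (mu (B x l)).
    rewrite -[B x l](_ : B x l `&` `]0%R, +oo[ = _); last first.
      by apply/seteqP; split => t /=; rewrite in_itv/= andbT;
        [move=> []|move=> tB; split => //; have /andP[/andP[]] := tB; lra].
    rewrite -(clock_transport a0 alpha_bnd malpha x cl (mB x l)).
    apply: eq_integral => u _; rewrite /S4 /= addr0 -andbA.
    by congr (if _ && _ then _ else _)%:E; rewrite /B; apply/idP/idP; rewrite inE.
  pose B5 := [set t : R | (0 < t <= clk ((x, l), 1)) && E ((x, l), t + h)].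
  have mB5 : measurable B5.
    have : measurable_fun setT (fun t : R => (t + h)) by exact: measurable_funD.
    move=> /(_ measurableT _ (mB x l)); rewrite setTI; congr measurable.
    by apply/seteqP; split => t; rewrite /B /B5 /= ltrDr lerD2r.
  transitivity (mu B5).
    rewrite -(lebesgue_measure_translation h (mB x l)); congr (mu _).
    by apply/seteqP; split => t; rewrite /B /B5 /= ltrDr lerD2r.
  rewrite -[B5](_ : B5 `&` `]0%R, +oo[ = _); last first.
    by apply/seteqP; split => t /=; rewrite in_itv/= andbT;
      [move=> []|move=> tB; split => //; have /andP[/andP[]] := tB].
  rewrite -(clock_transport a0 alpha_bnd malpha x cl mB5).
  apply: eq_integral => u _; rewrite /S5 /strip /= -andbA.
  have [u0|//] := ltP 0 u; rewrite /=.
  have -> : (clk ((x, l), u) \in B5) = (u <= 1) && E ((x, l), clk ((x, l), u) + h).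
    have uc : 0 < clk ((x, l), u) by rewrite -(clk0 x l cl) clk_lt.
    have u1 : (clk ((x, l), u) <= clk ((x, l), 1)) = (u <= 1).
      by rewrite leNgt clk_lt// -leNgt.
    by apply/idP/idP; rewrite ?inE /B5 /= uc u1.
  by [].
have eq23 x l : cadlag l -> clock_spent S2 (x, l) = clock_spent S3 (x + l 1, shift_path 1 l).
  move=> cl; have cs := cadlag_shift ler01 cl.
  have mS2y : measurable_fun setT (fun u => (if S2 ((x, l) : start_path, u) then rate ((x, l) : start_path, u) else 0)%:E).
    exact: (measurableT_comp (mrateS mS2) (pair1_measurable ((x, l) : start_path))).
  rewrite {1}/clock_spent -(ge0_integral_translation 1 mS2y (fun u => rateS0 _ _)).
  apply: eq_integral => u _; rewrite /S2 /S3 /early /=.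
  rewrite ltrDr; have [u0|//] := ltP 0 u; rewrite /= !addr0.
  have cE : clk ((x, l), u + 1) = clk ((x, l), 1) + clk ((x + l 1, shift_path 1 l), u).
    rewrite !clock_valueE// (clock_shift a0 alpha_bnd malpha x cl ler01 (ltW u0)).
    by rewrite [1 + u]addrC; ring.
  have u0' : 0 <= clk ((x + l 1, shift_path 1 l), u).
    rewrite clock_valueE//; exact: (clock_path_ge0 a0 alpha_bnd malpha _ cs (ltW u0)).
  rewrite cE lerD2l flowE// -clock_valueE//.
  case: ifP => // _.
  rewrite !rate_valueE ?(ltW u0)//; last by rewrite addr_ge0// ltW.
  by congr (alpha _)%:E; rewrite /shift_path [u + 1]addrC; ring.
have Q2 : Q (clock_spent S2) = Q (clock_spent S3).
  rewrite -(path_integral_shift L_levy L_exp ltr01 (measurable_clock_spent mS3)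
    (clock_spent_ge0 S3)).
  by apply: (eq_path_integral L_levy) => x l cl; rewrite eq23.
have Q3 := path_integral_clock_lty h0 Gfin.
have main : (Q (clock_spent S1) + Q (clock_spent S2) = Q (clock_spent S3) + Q (clock_spent S4))%E.
  have m S0 : measurable_fun setT S0 -> measurable_fun setT (clock_spent S0).
    exact: measurable_clock_spent.
  have p S0 := clock_spent_ge0 S0.
  transitivity (Q (fun y => clock_spent S1 y + clock_spent S2 y)%E).
    exact: (esym (path_integralD L (m _ mS1) (p S1) (m _ mS2) (p S2))).
  transitivity (Q (fun y => clock_spent S3 y + clock_spent S4 y)%E).
    apply: (eq_path_integral L_levy) => x l cl.
    by rewrite -(eq12 x l cl) -(eq34 x l cl).
  exact: (path_integralD L (m _ mS3) (p S3) (m _ mS4) (p S4)).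
have Q4 : Q (clock_spent S4) = Q (clock_spent S5).
  by apply: (eq_path_integral L_levy) => x l cl; exact: eq45.
move: main; rewrite Q2 Q4 /S1 /S5 (path_integral_strip ler01 (lexx 0)).
rewrite (path_integral_strip ler01 h0) !mul1e => main.
have Q3fin : Q (clock_spent S3) \is a fin_num.
  rewrite ge0_fin_numE; first exact: Q3.
  by apply: path_integral_ge0; exact: clock_spent_ge0.
have G0E := @addeK R (Q (clock_spent S3)) (G 0) Q3fin.
rewrite -G0E main [X in (X - _)%E]addeC.
by rewrite (@addeK R (Q (clock_spent S3)) (G h) Q3fin).
Qed.

End invariance.

(** * Laplace functional of a Poisson point process *)
Section independent_family.
Context {R : realType} d (T : measurableType d) (P : probability T R).
Local Open Scope ereal_scope.

(** Integrates out the member [k] of an independent family; [f] may depend on all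
    the other members. *)
Lemma family_integral (I : choiceType) (G : I -> set (set T)) (D : set I) (k : I)
    d' d2 (T' : measurableType d') (E : measurableType d2)
    (P' : probability T' R) (X : T -> E) (X' : T' -> E)
    (f : g_sigma_algebraType (\bigcup_(i in D) G i) * E -> \bar R) :
  (forall i, G i `<=` measurable) -> (forall i, setI_closed (G i)) ->
  independent_systems P G -> ~ D k ->
  measurable_fun setT X -> (forall C, measurable C -> G k (X @^-1` C)) ->
  measurable_fun setT X' ->
  (forall C, measurable C -> P (X @^-1` C) = P' (X' @^-1` C)) ->
  measurable_fun setT f -> (forall z, 0 <= f z) ->
  \int[P]_w f (w, X w) = \int[P]_w \int[P']_w' f (w, X' w').
Proof.
move=> Gm GI indG Dk mX GX mX' XX' mf f0.
pose Y : T -> g_sigma_algebraType (\bigcup_(i in D) G i) := id.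
have mY : measurable_fun setT Y.
  move=> _ B mB; rewrite setTI.
  have sub : (\bigcup_(i in D) G i) `<=` (measurable : set (set T)).
    by move=> A [i _ GA]; exact: Gm GA.
  exact: (smallest_sub (@sigma_algebra_measurable _ T) sub mB).
apply: (independent_pair_integral (Y := Y)) => // A C mA mC.
rewrite -XX'//; exact: (independent_sigma_algebra Gm GI indG Dk mA (GX _ mC)).
Qed.

Lemma independent_variables_prod d' (E : measurableType d') (I : choiceType)
    (X : I -> T -> E) (g : I -> E -> R) (s : seq I) :
  (forall i, measurable_fun setT (X i)) -> independent_variables P X ->
  (forall i, measurable_fun setT (g i)) -> (forall i x, (0 <= g i x)%R) -> uniq s ->
  \int[P]_w (\prod_(i <- s) g i (X i w))%:E =
  \prod_(i <- s) \int[P]_w (g i (X i w))%:E.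
Proof.
move=> mX indX mg g0; elim: s => [_|k s IH /= /andP[ks us]].
  rewrite big_nil; under eq_integral do rewrite big_nil.
  by rewrite integral_cst//= mul1e probability_setT.
rewrite big_cons -IH//; under eq_integral do rewrite big_cons.
pose G i := preimage_set_system setT (X i) measurable.
pose D := [set i : I | i \in s].
pose GT := g_sigma_algebraType (\bigcup_(i in D) G i).
have mXs i : i \in s -> measurable_fun setT (X i : GT -> E).
  move=> si _ B mB; rewrite setTI; apply: sub_sigma_algebra; exists i => //.
  by exists B => //; rewrite setTI.
pose h (w : GT) := (\prod_(i <- s) g i (X i w))%R.
have h0 w : (0 <= h w)%R by apply: prodr_ge0.
pose f (z : GT * E) := (g k z.2 * h z.1)%:E.
have mprod : measurable_fun setT h.
  apply: measurable_prod => i si.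
  exact: (measurableT_comp (mg i) (mXs i si)).
have mf : measurable_fun setT f.
  apply/measurable_EFinP; apply: measurable_funM.
    exact: (measurableT_comp (mg k) measurable_snd).
  exact: (measurableT_comp mprod measurable_fst).
have f0 z : 0 <= f z by rewrite lee_fin mulr_ge0.
have Gm i : G i `<=` measurable.
  by move=> _ [B mB <-]; exact: mX.
have GI i : setI_closed (G i).
  move=> _ _ [B mB <-] [C mC <-]; exists (B `&` C); first exact: measurableI.
  by rewrite !setTI preimage_setI.
have Dk : ~ D k by apply/negP.
have GX C : measurable C -> G k (X k @^-1` C).
  by move=> mC; exists C => //; rewrite setTI.
have H := family_integral Gm GI indX Dk (mX k) GX (mX k) (fun C _ => erefl _) mf f0.
rewrite [LHS]H /f /=.
have mgk : measurable_fun setT (fun w => (g k (X k w))%:E).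
  by apply/measurable_EFinP; exact: (measurableT_comp (mg k) (mX k)).
have mh : measurable_fun setT (fun w : T => (h w)%:E).
  apply/measurable_EFinP; apply: measurable_prod => i si.
  exact: (measurableT_comp (mg i) (mX i)).
have gk0 w : 0 <= (g k (X k w))%:E by rewrite lee_fin.
have h0' w : 0 <= (h w)%:E by rewrite lee_fin.
transitivity (\int[P]_w ((\int[P]_w' (g k (X k w'))%:E) * (h w)%:E)).
  apply: eq_integral => w _; under eq_integral do rewrite EFinM.
  exact: (ge0_integralZrT P mgk gk0 (h0' w)).
by apply: (ge0_integralZlT P mh h0'); apply: integral_ge0.
Qed.

End independent_family.

Section poisson_counts.
Context {R : realType} d d' (T : measurableType d) (E : measurableType d')
  (P : probability T R) (U : nat -> {RV P >-> E}) (mu : {measure set E -> \bar R}).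
Hypothesis U_poisson : poisson_point_process P U mu.
Local Open Scope ereal_scope.

Definition count_points (m : nat) (A : set E) (w : T) : nat :=
  \sum_(i < m) (U i w \in A : nat).

Lemma cvg_count_points A w :
  (count_points m A w)%:R%:E @[m --> \oo] --> nb_points U A w.
Proof.
rewrite /nb_points counting_dirac.
have -> : (fun m => (count_points m A w)%:R%:E) =
    (fun m => \sum_(0 <= i < m) \d_i [set i | A (U i w)]) :> (nat -> \bar R); last first.
  by apply: is_cvg_nneseries => n _ _.
apply/funext => m; rewrite big_mkord sumEFin; congr EFin.
rewrite /count_points natr_sum; apply: eq_bigr => i _.
by rewrite indicE; congr (nat_of_bool _)%:R.
Qed.

Lemma measurable_in (A : set E) : measurable A ->
  measurable_fun setT (fun x : E => x \in A).
Proof.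
move=> mA; apply: (measurable_fun_bool true).
rewrite setTI (_ : _ @^-1` _ = A)//.
by apply/seteqP; split => x /=; [move/set_mem|move/mem_set].
Qed.

Lemma measurable_count_points m A : measurable A ->
  measurable_fun setT (fun w => (count_points m A w)%:R%:E : \bar R).
Proof.
move=> mA; apply/measurable_EFinP.
rewrite (_ : (fun w => _) = (fun w => \sum_(i < m) \1_A (U i w))%R).
  apply: measurable_sum => i.
  by apply: (measurableT_comp (f := \1_A : E -> R)) => //; exact: measurable_indic.
apply/funext => w; rewrite /count_points natr_sum.
by apply: eq_bigr => i _; rewrite indicE.
Qed.

Lemma measurable_nb_points A : measurable A ->
  measurable_fun setT (nb_points U A).
Proof.
move=> mA; apply: (emeasurable_fun_cvg
  (fun m w => (count_points m A w)%:R%:E)) => //.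
- by move=> m; exact: measurable_count_points.
- by move=> w _; exact: cvg_count_points.
Qed.

(** A finite total count is reached after finitely many points. *)
Lemma nb_points_stationary A w k : nb_points U A w = k%:R%:E ->
  \forall m \near \oo, count_points m A w = k.
Proof.
move=> nbk; have := cvg_count_points (A := A) (w := w).
rewrite nbk => /fine_cvgP[_] /= c.
have h1 : (0 < 1 :> R)%R by [].
move/cvgrPdist_lt : c => /(_ _ h1); apply: filterS => m /=.
have [->//|nk] := eqVneq (count_points m A w) k.
move: nk; rewrite neq_lt => /orP[] mk.
  rewrite ger0_norm; last by rewrite subr_ge0 ler_nat ltnW.
  by rewrite ltrBlDl natr1 ltr_nat; lia.
rewrite distrC ger0_norm; last by rewrite subr_ge0 ler_nat ltnW.
by rewrite ltrBlDl natr1 ltr_nat; lia.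
Qed.

Lemma count_points_le A w k m : nb_points U A w = k%:R%:E ->
  (count_points m A w <= k)%N.
Proof.
move=> /nb_points_stationary [N _ h].
have := h (maxn N m) (leq_maxl _ _) => <-.
rewrite /count_points -!(big_mkord xpredT (fun i => (U i w \in A : nat))).
by rewrite (big_cat_nat (leq0n _) (leq_maxr N m))/= leq_addr.
Qed.

(** A geometric weight changes the parameter of a Poisson law. *)
Lemma poisson_prob_thinning (c l : R) k : (0 <= c)%R -> (0 <= l)%R ->
  (c ^+ k)%:E * poisson_prob l 0 [set k] =
  (expR (- ((1 - c) * l)))%:E * poisson_prob (c * l) 0 [set k].
Proof.
move=> c0 l0; rewrite /poisson_prob.
have es (r : R) : \esum_(j in [set k]) (poisson_pmf r j)%:E = (poisson_pmf r k)%:E.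
  by rewrite esum_set1// lee_fin poisson_pmf_ge0.
move: l0; rewrite le_eqVlt => /predU1P[<-|l0].
  rewrite !mulr0 ltxx oppr0 expR0 mul1e diracE.
  by case: k {es} => [|k]; [rewrite expr0 mul1e|rewrite memNset ?mule0].
move: c0; rewrite le_eqVlt => /predU1P[<-|c0].
  rewrite mul0r ltxx l0 es diracE /poisson_pmf l0 subr0 mul1r.
  case: k {es} => [|k].
    by rewrite mem_set// !expr0 fact0 invr1 !mul1r mul1e mule1.
  by rewrite exprS mul0r mul0e memNset ?mule0.
rewrite mulr_gt0// l0 !es /poisson_pmf mulr_gt0// l0 -!EFinM; congr EFin.
rewrite exprMn.
have -> : (expR (- l) = expR (- ((1 - c) * l)) * expR (- (c * l)))%R.
  by rewrite -expRD; congr expR; ring.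
ring.
Qed.

Lemma poisson_prob_sum (l : R) : \sum_(k <oo) poisson_prob l 0 [set k] = 1.
Proof.
rewrite -(probability_setT (poisson_prob l 0)).
have -> : [set: nat] = \bigcup_k [set k] by apply/seteqP; split => // k _; exists k.
rewrite measure_semi_bigcup//.
by apply/trivIsetP => i j _ _ ij; rewrite -subset0 => k [/= -> /eqP]; apply/negP.
Qed.

Let level A k := [set w | nb_points U A w = k%:R%:E].

Let mlevel A k : measurable A -> measurable (level A k).
Proof.
move=> mA; have := measurable_nb_points mA measurableT (emeasurable_set1 k%:R%:E).
by rewrite setTI.
Qed.

Let tlevel A : trivIset setT (level A).
Proof.
apply/trivIsetP => i j _ _ ij; rewrite -subset0 => w [h1 h2].
have [/eqP] := etrans (esym h1) h2.
by rewrite eqr_nat; apply/negP.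
Qed.

Lemma nb_points_finite A : measurable A -> mu A < +oo ->
  P (~` \bigcup_k level A k) = 0.
Proof.
move=> mA muA; have [h _ _] := U_poisson.
rewrite probability_setC; last by apply: bigcupT_measurable => k; exact: mlevel.
rewrite measure_semi_bigcup//; last 2 first.
- by move=> k; exact: mlevel.
- by apply: bigcupT_measurable => k; exact: mlevel.
have hl k : P (level A k) = poisson_prob (fine (mu A)) 0 [set k] := h A mA muA k.
by rewrite (eq_eseriesr (fun k _ => hl k)) poisson_prob_sum subee.
Qed.

(** Summing over the values of the count with [poisson_prob_thinning]; the value
    [+oo] has probability 0 because the Poisson weights sum to 1. *)
Lemma nb_points_generating A (c : R) : measurable A -> mu A < +oo ->
  (0 <= c <= 1)%R ->
  \int[P]_w (c ^+ Num.truncn (fine (nb_points U A w)))%:E =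
  (expR (- ((1 - c) * fine (mu A))))%:E.
Proof.
move=> mA muA /andP[c0 c1]; have [h _ _] := U_poisson.
have mg : measurable_fun setT
    (fun w => (c ^+ Num.truncn (fine (nb_points U A w)))%:E).
  apply/measurable_EFinP.
  apply: (measurableT_comp (measurable_comp_truncn (fun n => c ^+ n)%R)).
  by apply: (measurableT_comp (f := @fine R)) => //; exact: measurable_nb_points.
have mB : measurable (\bigcup_k level A k) by apply: bigcupT_measurable => k; exact: mlevel.
have g0 w : 0 <= (c ^+ Num.truncn (fine (nb_points U A w)))%:E.
  by rewrite lee_fin exprn_ge0.
rewrite (ge0_negligible_integral (measurableC mB) measurableT mg (fun w _ => g0 w)
  (nb_points_finite mA muA)).
rewrite setTD setCK ge0_integral_bigcup//; last first.
- exact: measurable_funTS.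
- by move=> k; exact: mlevel.
have hl k : P (level A k) = poisson_prob (fine (mu A)) 0 [set k] := h A mA muA k.
under eq_eseriesr => k _.
  have -> : \int[P]_(w in level A k) (c ^+ Num.truncn (fine (nb_points U A w)))%:E
      = (expR (- ((1 - c) * fine (mu A))))%:E * poisson_prob (c * fine (mu A)) 0 [set k].
    rewrite -poisson_prob_thinning ?fine_ge0// -hl.
    rewrite -integral_cst//; last exact: mlevel.
    by apply: eq_integral => w; rewrite inE /level /= => ->; rewrite /= natrK.
  over.
rewrite nneseriesZl//.
by rewrite poisson_prob_sum mule1.
Qed.

End poisson_counts.

Section poisson_laplace.
Context {R : realType} d d' (T : measurableType d) (E : measurableType d')
  (P : probability T R) (U : nat -> {RV P >-> E}) (mu : {measure set E -> \bar R}).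
Hypothesis U_poisson : poisson_point_process P U mu.
Local Open Scope ereal_scope.

Section step_functions.
Variables (n : nat) (A : 'I_n -> set E) (c : 'I_n -> R).
Hypotheses (mA : forall k, measurable (A k)) (tA : trivIset setT A)
  (muA : forall k, mu (A k) < +oo) (c01 : forall k, (0 <= c k <= 1)%R).

Let psi (x : E) : R := (\prod_(k < n) (if x \in A k then c k else 1))%R.

Let c0 k : (0 <= c k)%R. Proof. by have /andP[] := c01 k. Qed.

Let psi01 x : (0 <= psi x <= 1)%R.
Proof.
apply/andP; split; first by apply: prodr_ge0 => k _; case: ifP.
apply: prodr_ile1 => k _; case: ifP => _; first exact: c01.
by rewrite ler01 lexx.
Qed.

Let mpsi : measurable_fun setT psi.
Proof.
apply: measurable_prod => k _; apply: measurable_fun_ifT => //.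
exact: measurable_in.
Qed.

Let W m w : R := (\prod_(i < m) psi (U i w))%R.

Let W01 m w : (0 <= W m w <= 1)%R.
Proof.
apply/andP; split; first by apply: prodr_ge0 => i _; have /andP[] := psi01 (U i w).
by apply: prodr_ile1 => i _; exact: psi01.
Qed.

Let WE m w : W m w = (\prod_(k < n) c k ^+ count_points U m (A k) w)%R.
Proof.
rewrite /W /psi exchange_big/=; apply: eq_bigr => k _.
rewrite /count_points -prodrXr; apply: eq_bigr => i _.
by case: (_ \in _); rewrite ?expr1 ?expr0.
Qed.

Let mW m : measurable_fun setT (fun w => (W m w)%:E).
Proof.
apply/measurable_EFinP; apply: measurable_prod => i _.
exact: (measurableT_comp mpsi).
Qed.

Let Winf w : R := (\prod_(k < n) c k ^+ Num.truncn (fine (nb_points U (A k) w)))%R.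

Let mWinf : measurable_fun setT (fun w => (Winf w)%:E).
Proof.
apply/measurable_EFinP; apply: measurable_prod => k _.
apply: (measurableT_comp (measurable_comp_truncn (fun n => c k ^+ n)%R)).
by apply: (measurableT_comp (f := @fine R)) => //; exact: measurable_nb_points.
Qed.

Let Winf0 w : (0 <= Winf w)%R.
Proof. by apply: prodr_ge0 => k _; rewrite exprn_ge0. Qed.

Let nb_finite : {ae P, forall w, forall k, exists j, nb_points U (A k) w = j%:R%:E}.
Proof.
apply: filter_forall => k.
have ml : measurable (\bigcup_j [set w | nb_points U (A k) w = j%:R%:E]).
  apply: bigcupT_measurable => j.
  have := measurable_nb_points U (mA k) measurableT (emeasurable_set1 j%:R%:E).
  by rewrite setTI.
exists (~` \bigcup_j [set w | nb_points U (A k) w = j%:R%:E]); split.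
- exact: measurableC.
- exact: (nb_points_finite U_poisson (mA k) (muA k)).
by move=> w h [j _ e]; apply: h; exists j.
Qed.

Let W_Winf : {ae P, forall w, (forall m, (Winf w <= W m w)%R) /\
  (\forall m \near \oo, W m w = Winf w)}.
Proof.
apply: filterS nb_finite => w h.
have /choice[j hj] := h.
have WI : Winf w = (\prod_(k < n) c k ^+ j k)%R.
  by apply: eq_bigr => k _; rewrite hj /= natrK.
split.
  move=> m; rewrite WI WE; apply: ler_prod => k _.
  rewrite exprn_ge0//=; apply: ler_wiXn2l => //; first by have /andP[] := c01 k.
  exact: (count_points_le _ (hj k)).
have : \forall m \near \oo, forall k, count_points U m (A k) w = j k.
  by apply: filter_forall => k; exact: nb_points_stationary.
apply: filterS => m e; rewrite WI WE; apply: eq_bigr => k _.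
by rewrite e.
Qed.

Let limit := expR (- (\sum_(k < n) (1 - c k) * fine (mu (A k)))%R).

Let intWinf : \int[P]_w (Winf w)%:E = limit%:E.
Proof.
have [_ _ ind] := U_poisson.
have indA := ind n A mA tA.
pose g (k : 'I_n) (y : \bar R) : R := (c k ^+ Num.truncn (fine y))%R.
have mg k : measurable_fun setT (g k).
  by apply: (measurableT_comp (measurable_comp_truncn (fun n => c k ^+ n)%R)).
have g0 k y : (0 <= g k y)%R by rewrite exprn_ge0.
have mnb k := measurable_nb_points U (mA k).
rewrite (independent_variables_prod mnb indA mg g0 (index_enum_uniq _)).
under eq_bigr => k _ do
  rewrite (nb_points_generating U_poisson (mA k) (muA k) (c01 k)).
by rewrite prodEFin -expR_sum /limit -sumrN; congr (expR _)%:E; apply: eq_bigr.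
Qed.

(** The product over the first [m] points decreases to [Winf], which is almost
    surely reached and whose mean factorizes over the disjoint sets [A k]. *)
Lemma step_laplace_ge m : limit%:E <= \int[P]_w (\prod_(i < m) psi (U i w))%:E.
Proof.
rewrite -intWinf; apply: ae_ge0_le_integral => //.
- by move=> w _; rewrite lee_fin.
- by move=> w _; rewrite lee_fin; have /andP[] := W01 m w.
- exact: mW.
by apply: filterS W_Winf => w [h _] _; rewrite lee_fin; exact: h.
Qed.

Lemma step_laplace_cvg :
  \int[P]_w (\prod_(i < m) psi (U i w))%:E @[m --> \oo] --> limit%:E.
Proof.
rewrite -intWinf.
have [] := @dominated_convergence _ _ _ P _ measurableT
  (fun m w => (W m w)%:E) (fun w => (Winf w)%:E) (cst 1) mW mWinf.
- apply: filterS W_Winf => w [_ h] _; apply: cvg_near_cst.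
  by apply: filterS h => m ->.
- exact: (finite_measure_integrable_cst P 1%R).
- apply: aeW => w m _; rewrite /= lee_fin.
  by have /andP[h1 h2] := W01 m w; rewrite ger0_norm.
by move=> _ _.
Qed.

End step_functions.
End poisson_laplace.

Lemma cvg_prod_ord {R : realType} (u : nat -> nat -> R) (l : nat -> R) m :
  (forall i, u i n @[n --> \oo] --> l i) ->
  \prod_(i < m) u i n @[n --> \oo] --> \prod_(i < m) l i.
Proof.
move=> ul; elim: m => [|m IH].
  by under eq_fun do rewrite big_ord0; rewrite big_ord0; exact: cvg_cst.
under eq_fun do rewrite big_ord_recr /=.
by rewrite big_ord_recr; apply: cvgM.
Qed.

Section poisson_laplace_general.
Context {R : realType} d d' (T : measurableType d) (E : measurableType d')
  (P : probability T R) (U : nat -> {RV P >-> E}) (mu : {measure set E -> \bar R}).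
Hypothesis U_poisson : poisson_point_process P U mu.
Local Open Scope ereal_scope.
Variables (m0 : {measure set E -> \bar R}) (f : E -> \bar R).
Hypotheses (mf : measurable_fun setT f) (f0 : forall x, 0 <= f x)
  (ffin : forall x, f x \is a fin_num)
  (mu_density : forall A, measurable A -> mu A = \int[m0]_(x in A) f x).
Variable p : E -> R.
Hypotheses (mp : measurable_fun setT p) (p01 : forall x, (0 <= p x <= 1)%R).
Hypothesis int_p : \int[m0]_x ((p x)%:E * f x) < +oo.

(** [p] is approximated from below by [pn n], its rounding to multiples of
    [2 ^- n], a step function with level sets [A n k]. *)
Let K n : R := (2 ^ n)%:R.

Let K0 n : (0 < K n)%R. Proof. exact: pow2_gt0. Qed.

Let idx n x := Num.truncn (K n * p x)%R.

Let pn n x : R := ((idx n x)%:R / K n)%R.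

Let p0 x : (0 <= p x)%R. Proof. by have /andP[] := p01 x. Qed.

Let idx_le n x : ((idx n x)%:R <= K n * p x)%R.
Proof. by have /andP[] := truncn_itv (mulr_ge0 (ltW (K0 n)) (p0 x)). Qed.

Let idx_gt n x : (K n * p x < (idx n x).+1%:R)%R.
Proof. exact: truncnS_gt. Qed.

Let idx_bound n x : (idx n x <= 2 ^ n)%N.
Proof.
rewrite -(ler_nat R); apply: le_trans (idx_le n x) _.
by rewrite -[leRHS]mulr1 ler_pM2l//; have /andP[] := p01 x.
Qed.

Let pn_le n x : (pn n x <= p x)%R.
Proof. by rewrite /pn ler_pdivrMr// mulrC. Qed.

Let pn0 n x : (0 <= pn n x)%R.
Proof. by rewrite /pn divr_ge0// ltW. Qed.

Let pn_gt n x : (p x - (K n)^-1 <= pn n x)%R.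
Proof.
rewrite lerBlDr /pn -[X in (_ + X)%R]mul1r -mulrDl natr1 ler_pdivlMr//.
by rewrite mulrC ltW.
Qed.

Let cvg_pn x : pn n x @[n --> \oo] --> p x.
Proof.
apply: (@squeeze_cvgr _ _ _ _ (fun n => p x - (K n)^-1)%R (fun=> p x)).
- by near=> n; rewrite pn_gt pn_le.
- rewrite -[X in _ --> X]subr0; apply: cvgB; first exact: cvg_cst.
  exact: cvg_pow2V.
- exact: cvg_cst.
Unshelve. all: by end_near. Qed.

Let mKp n : measurable_fun setT (fun x => K n * p x)%R.
Proof. exact: measurable_funM. Qed.

Let mpn n : measurable_fun setT (pn n).
Proof.
apply: (measurableT_comp (measurable_comp_truncn (fun j => j%:R / K n)%R)).
exact: mKp.
Qed.

Let A n (k : 'I_(2 ^ n)) := [set x | idx n x = k.+1].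

Let mA n k : measurable (A (n := n) k).
Proof.
have midx : measurable_fun setT (idx n).
  by apply: (measurableT_comp measurable_truncn); exact: mKp.
by have := midx measurableT [set k.+1] I; rewrite setTI.
Qed.

Let tA n : trivIset setT (@A n).
Proof.
apply/trivIsetP => i j _ _ ij; rewrite -subset0 => x [h1 h2].
have [/val_inj e] := etrans (esym h1) h2.
by rewrite e eqxx in ij.
Qed.

Let c n (k : 'I_(2 ^ n)) : R := (1 - k.+1%:R / K n)%R.

Let c01 n k : (0 <= @c n k <= 1)%R.
Proof.
rewrite /c subr_ge0 ler_pdivrMr// mul1r ler_nat ltn_ord/= gerBl.
by rewrite divr_ge0// ltW.
Qed.

Let psiE n x : (\prod_(k < 2 ^ n) (if x \in A k then c k else 1) = 1 - pn n x)%R.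
Proof.
have [i0|i0] := posnP (idx n x).
  rewrite /pn i0 mul0r subr0; apply: big1 => k _.
  by rewrite memNset// /A /= i0.
have ib : ((idx n x).-1 < 2 ^ n)%N by rewrite prednK// idx_bound.
rewrite (bigD1 (Ordinal ib))//= mem_set; last by rewrite /A /= prednK.
rewrite /c /= prednK// big1 ?mulr1// => k kn.
rewrite memNset// /A /= => e; move: kn => /eqP; apply; apply: val_inj => /=.
by rewrite e.
Qed.

Let int_pn n : \int[m0]_x ((pn n x)%:E * f x) =
  \sum_(k < 2 ^ n) (k.+1%:R / K n)%:E * mu (A k).
Proof.
transitivity (\int[m0]_x \sum_(k < 2 ^ n) ((k.+1%:R / K n)%:E * (f \_ (A k)) x)).
  apply: eq_integral => x _.
  have [i0|i0] := posnP (idx n x).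
    rewrite /pn i0 mul0r mul0e big1// => k _.
    by rewrite patchE memNset ?mule0// /A /= i0.
  have ib : ((idx n x).-1 < 2 ^ n)%N by rewrite prednK// idx_bound.
  rewrite (bigD1 (Ordinal ib))//= patchE mem_set; last by rewrite /A /= prednK.
  rewrite /= prednK// big1 ?adde0// => k kn.
  rewrite patchE memNset ?mule0// /A /= => e; move: kn => /eqP; apply.
  by apply: val_inj => /=; rewrite e.
have mfA k : measurable_fun setT (f \_ (A (n := n) k)).
  by apply/(measurable_restrictT _ _).1 => //; exact: measurable_funTS.
have fA0 k x : 0 <= (f \_ (A (n := n) k)) x by rewrite patchE; case: ifP.
have k0 (k : 'I_(2 ^ n)) : 0 <= (k.+1%:R / K n)%:E by rewrite lee_fin divr_ge0// ltW.
rewrite ge0_integral_sum//.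
- apply: eq_bigr => k _; rewrite (ge0_integralZlT m0 (mfA k) (fA0 k) (k0 k)).
  by rewrite mu_density// [in RHS]integral_mkcond.
- by move=> k; apply: measurable_funeM.
- by move=> k x _; rewrite mule_ge0.
Qed.

Let mpf (q : E -> R) : measurable_fun setT q ->
  measurable_fun setT (fun x => (q x)%:E * f x).
Proof. by move=> mq; apply: emeasurable_funM => //; exact/measurable_EFinP. Qed.

Let int_pn_le n : \int[m0]_x ((pn n x)%:E * f x) <= \int[m0]_x ((p x)%:E * f x).
Proof.
apply: ge0_le_integral => //.
- by move=> x _; rewrite mule_ge0// lee_fin.
- exact: mpf.
- exact: mpf.
- by move=> x _; apply: lee_wpmul2r => //; rewrite lee_fin.
Qed.

Let muA n k : mu (A (n := n) k) < +oo.
Proof.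
rewrite ltey; apply/eqP => muoo.
have := le_lt_trans (int_pn_le n) int_p; rewrite int_pn (bigD1 k)//= muoo.
rewrite gt0_muley; last by rewrite lte_fin divr_gt0.
rewrite addye// gt_eqF// (lt_le_trans (ltNyr 0))//.
apply: sume_ge0 => j _; apply: mule_ge0 => //.
by rewrite lee_fin divr_ge0// ltW.
Qed.

Let I := fine (\int[m0]_x ((p x)%:E * f x)).

Let IE : \int[m0]_x ((p x)%:E * f x) = I%:E.
Proof.
rewrite /I fineK// ge0_fin_numE//.
by apply: integral_ge0 => x _; rewrite mule_ge0// lee_fin.
Qed.

Let In n := (\sum_(k < 2 ^ n) (1 - @c n k) * fine (mu (A k)))%R.

Let InE n : \int[m0]_x ((pn n x)%:E * f x) = (In n)%:E.
Proof.
rewrite int_pn /In -sumEFin; apply: eq_bigr => k _.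
rewrite [in RHS]EFinM fineK ?ge0_fin_numE//; congr (_%:E * _).
by rewrite /c; ring.
Qed.

Let In_le n : (In n <= I)%R.
Proof. by rewrite -lee_fin -InE -IE. Qed.

Let cvg_In : In n @[n --> \oo] --> I.
Proof.
have := @dominated_convergence _ _ _ m0 _ measurableT
  (fun n x => (pn n x)%:E * f x) (fun x => (p x)%:E * f x)
  (fun x => (p x)%:E * f x) (fun n => mpf (mpn n)) (mpf mp).
case.
- apply: aeW => x _; apply: cvgeZr => //.
  by apply: cvg_EFin; [near=> n|exact: cvg_pn].
- apply/integrableP; split; first exact: mpf.
  under eq_integral do rewrite gee0_abs ?mule_ge0 ?lee_fin//.
  exact: int_p.
- apply: aeW => x n _; rewrite gee0_abs; last by rewrite mule_ge0 ?lee_fin.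
  by apply: lee_wpmul2r => //; rewrite lee_fin.
move=> _ _; rewrite IE.
by under eq_fun do rewrite InE; move=> /fine_cvgP[].
Unshelve. all: by end_near. Qed.

Let V (q : E -> R) m := \int[P]_w (\prod_(i < m) (1 - q (U i w)))%:E.

Let mVq (q : E -> R) m : measurable_fun setT q ->
  measurable_fun setT (fun w => (\prod_(i < m) (1 - q (U i w)))%:E).
Proof.
move=> mq; apply/measurable_EFinP; apply: measurable_prod => i _.
by apply: measurable_funB => //; exact: (measurableT_comp mq).
Qed.

Let q01 n x : (0 <= 1 - pn n x <= 1)%R.
Proof.
rewrite subr_ge0 gerBl pn0 andbT; apply: le_trans (pn_le n x) _.
by have /andP[] := p01 x.
Qed.

Let p01' x : (0 <= 1 - p x <= 1)%R.
Proof. by have /andP[h1 h2] := p01 x; rewrite subr_ge0 gerBl h1 h2. Qed.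

Let Vpn_ge n m : (expR (- I))%:E <= V (pn n) m.
Proof.
apply: (@le_trans _ _ (expR (- In n))%:E).
  by rewrite lee_fin ler_expR lerN2.
have := step_laplace_ge U_poisson (@mA n) (@tA n) (@muA n) (@c01 n) m.
by under eq_integral do under eq_bigr do rewrite psiE.
Qed.

(** The bound holds for each step function [pn n] and passes to the limit in [n]
    with [m] fixed. *)
Lemma poisson_laplace_ge m : (expR (- I))%:E <= V p m.
Proof.
have cV : V (pn n) m @[n --> \oo] --> V p m.
  have := @dominated_convergence _ _ _ P _ measurableT
    (fun n w => (\prod_(i < m) (1 - pn n (U i w)))%:E)
    (fun w => (\prod_(i < m) (1 - p (U i w)))%:E) (cst 1)
    (fun n => mVq m (mpn n)) (mVq m mp).
  case.
  - apply: aeW => w _; apply: cvg_EFin; first by near=> n.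
    apply: (@cvg_prod_ord R (fun i n => 1 - pn n (U i w))%R
      (fun i => 1 - p (U i w))%R m) => i.
    by apply: cvgB; [exact: cvg_cst|exact: cvg_pn].
  - exact: (finite_measure_integrable_cst P 1%R).
  - apply: aeW => w n _; rewrite /= lee_fin ger0_norm; last first.
      by apply: prodr_ge0 => i _; have /andP[] := q01 n (U i w).
    by apply: prodr_ile1 => i _; exact: q01.
  by move=> _ _.
have <- : limn (fun n => V (pn n) m) = V p m by exact: cvg_lim.
apply: lime_ge; first by apply/cvg_ex; exists (V p m).
by apply: nearW => n; exact: Vpn_ge.
Unshelve. all: by end_near. Qed.

(** The Laplace functional in multiplicative form. Replacing [p] by the smaller
    step function [pn n] increases the products, which bounds the limit from
    above; [poisson_laplace_ge] bounds every term from below. *)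
Lemma poisson_laplace_cvg : V p m @[m --> \oo] --> (expR (- I))%:E.
Proof.
have V0 q m : (forall x, 0 <= 1 - q x <= 1)%R -> 0 <= V q m.
  move=> q01'; apply: integral_ge0 => w _; rewrite lee_fin.
  by apply: prodr_ge0 => i _; have /andP[] := q01' (U i w).
have V1 m : V p m <= 1.
  apply: (@le_trans _ _ (\int[P]_w cst 1 w)).
    apply: ge0_le_integral => //.
    - move=> w _; rewrite lee_fin; apply: prodr_ge0 => i _.
      by have /andP[] := p01' (U i w).
    - exact: mVq.
    - by move=> w _; rewrite lee_fin; apply: prodr_ile1 => i _; exact: p01'.
  by rewrite integral_cst//= mul1e probability_setT.
have Vfin m : V p m \is a fin_num.
  by rewrite ge0_fin_numE ?V0//; apply: le_lt_trans (V1 m) _; rewrite ltry.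
apply/fine_cvgP; split; first by near=> m.
apply/cvgrPdist_lt => e e0.
have cexp : expR (- In n) @[n --> \oo] --> expR (- I).
  by apply: continuous_cvg; [exact: continuous_expR|apply: cvgN; exact: cvg_In].
have [n hn] : exists n, (expR (- In n) < expR (- I) + e / 2)%R.
  have : \forall n \near \oo, (expR (- In n) < expR (- I) + e / 2)%R.
    by apply: (cvgr_lt (expR (- I))) => //; rewrite ltrDl divr_gt0.
  by move=> [N _ /(_ N (leqnn _))]; exists N.
have cVn : V (pn n) m @[m --> \oo] --> (expR (- In n))%:E.
  have := step_laplace_cvg U_poisson (@mA n) (@tA n) (@muA n) (@c01 n).
  rewrite -/(In n); apply: cvg_trans; apply: near_eq_cvg; near=> m.
  by rewrite /V; apply: eq_integral => w _; congr EFin; apply: eq_bigr => i _; rewrite psiE.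
move/fine_cvgP : cVn => [fin_n c_n].
have h2 : \forall m \near \oo, (fine (V (pn n) m) < expR (- In n) + e / 2)%R.
  by apply: (cvgr_lt (expR (- In n))) => //; rewrite ltrDl divr_gt0.
near=> m.
have ge : (expR (- I) <= fine (V p m))%R.
  by rewrite -lee_fin fineK//; exact: poisson_laplace_ge.
rewrite distrC ger0_norm ?subr_ge0// ltrBlDl.
have finm : V (pn n) m \is a fin_num by near: m; exact: fin_n.
have le : (fine (V p m) <= fine (V (pn n) m))%R.
  rewrite fine_le//; apply: ge0_le_integral => //.
  - move=> w _; rewrite lee_fin; apply: prodr_ge0 => i _.
    by have /andP[] := p01' (U i w).
  - exact: mVq.
  - exact: mVq.
  - move=> w _; rewrite lee_fin; apply: ler_prod => i _.
    by have /andP[-> _] := p01' (U i w); rewrite lerD2l lerN2 pn_le.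
apply: le_lt_trans le _.
have : (fine (V (pn n) m) < expR (- In n) + e / 2)%R by near: m; exact: h2.
lra.
Unshelve. all: by end_near. Qed.

End poisson_laplace_general.

(** * Marked Poisson processes *)
Section path_laws.
Context {R : realType} d d0 (T : measurableType d) (T0 : measurableType d0)
  (P : probability T R) (P0 : probability T0 R).

Lemma same_path_law (X : R -> {RV P >-> R}) (L : R -> {RV P0 >-> R}) :
  same_process_law P P0 X L ->
  forall C : set (path_space R), measurable C ->
  P (path_of X @^-1` C) = P0 (path_of L @^-1` C).
Proof.
move=> XL; apply: (coordinate_law_unique (measurable_path_of X) (measurable_path_of L)).
  by apply: (le_lt_trans (probability_le1 _ _)) => //; rewrite ltry.
move=> s B us s0 mB.
pose t := in_tuple (sort <=%R s).
have st : sorted <%R t by rewrite sort_lt_sorted.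
have t0 : all (>= 0) t.
  by apply/allP => x; rewrite mem_sort => /s0 /= /ltW.
pose A := [set v : (size (sort <=%R s)).-tuple R | forall k, B (tnth t k) (tnth v k)].
have mA : measurable A.
  rewrite (_ : A = \bigcap_(k in [set: 'I_(size (sort <=%R s))])
    ((fun v => tnth v k) @^-1` B (tnth t k))).
    apply: fin_bigcap_measurable; first exact: finite_finset.
    move=> k _; rewrite -[X in measurable X]setTI.
    exact: measurable_tnth.
  by apply/seteqP; split => v h k; [move=> _|]; exact: h.
have E (T' : Type) (Y : R -> T' -> R) :
    [set w | forall i, i \in s -> B i (Y i w)] = time_vector Y t @^-1` A.
  apply/seteqP; split => w /= h.
    move=> k; rewrite tnth_mktuple; apply: h.
    by rewrite -(mem_sort <=%R) mem_tnth.
  move=> i; rewrite -(mem_sort <=%R) => /(tnthP t)[k ->].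
  by have := h k; rewrite tnth_mktuple.
by have := XL _ t st t0 A mA; rewrite -!E.
Qed.

End path_laws.

Section marked_poisson.
Context {R : realType} d d0 (T : measurableType d) (T0 : measurableType d0)
  (P : probability T R) (P0 : probability T0 R)
  (U : nat -> {RV P >-> R}) (Lc : nat -> R -> {RV P >-> R})
  (L : R -> {RV P0 >-> R}).
Hypothesis Lc_law : forall i, same_process_law P P0 (Lc i) L.
Hypothesis Lc_indep : independent_systems P (fun o : option nat =>
       if o is Some i
       then generated_sigma_algebra [set t : R | 0 <= t] (Lc i)
       else generated_sigma_algebra [set: nat] U).
Local Open Scope ereal_scope.

Let G (o : option nat) : set (set T) :=
  if o is Some i then generated_sigma_algebra [set t : R | (0 <= t)%R] (Lc i)
  else generated_sigma_algebra [set: nat] U.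

Let gen_measurable (I : Type) (D : set I) (X : I -> T -> R) :
  (forall i, measurable_fun setT (X i)) ->
  generated_sigma_algebra D X `<=` (measurable : set (set T)).
Proof.
move=> mX; apply: smallest_sub; first exact: sigma_algebra_measurable.
by move=> _ [i _ [B mB <-]]; exact: mX.
Qed.

Let Gm o : G o `<=` measurable.
Proof.
by case: o => [i|] /=; apply: gen_measurable.
Qed.

Let GI o : setI_closed (G o).
Proof.
by case: o => [i|] A B; exact: (@measurableI _ (g_sigma_algebraType _)).
Qed.

(** [GTU] carries the sigma-algebra of the points alone, and [GT k] that of all
    the variables except the path number [k]. *)
Let GTU := g_sigma_algebraType
  (\bigcup_(n in [set: nat]) preimage_set_system setT (U n) measurable).

Let GT k := g_sigma_algebraType (\bigcup_(o in [set o | o <> Some k]) G o).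

Let mpathG i (C : set (path_space R)) : measurable C ->
  G (Some i) (path_of (Lc i) @^-1` C).
Proof.
pose GL := g_sigma_algebraType
  (\bigcup_(t in [set t : R | (0 <= t)%R]) preimage_set_system setT (Lc i t) measurable).
have h : measurable_fun setT (path_of (Lc i) : GL -> path_space R).
  apply: measurable_to_coordinate_space => t /= t0 _ B mB.
  apply: sub_sigma_algebra; exists t; first exact: ltW.
  by exists B.
by move=> mC; have := h measurableT C mC; rewrite setTI.
Qed.

Let mU k i : measurable_fun setT (U i : GT k -> R).
Proof.
move=> _ B mB; apply: sub_sigma_algebra; exists None => //=.
by apply: sub_sigma_algebra; exists i => //; exists B.
Qed.

Let mpath k i : i != k -> measurable_fun setT (path_of (Lc i) : GT k -> path_space R).
Proof.
move=> ik _ C mC; apply: sub_sigma_algebra; exists (Some i).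
  by move=> [] /eqP; apply/negP.
by rewrite setTI; exact: mpathG.
Qed.

Let mGTU k d' (E : measurableType d') (H : GTU -> E) :
  measurable_fun setT H -> measurable_fun setT (H : GT k -> E).
Proof.
move=> mH _ B mB; apply: sub_sigma_algebra; exists None => //=.
exact: mH.
Qed.

Variable A : set (R * path_space R).
Hypothesis mA : measurable A.

Definition mark_probability (x : R) : R := fine (P0 [set w | A (x, path_of L w)]).

Let mpL := measurable_path_of L.

Let mAx x : measurable [set w | A (x, path_of L w)].
Proof. exact: measurable_preimage_pair. Qed.

Lemma mark_probabilityE x :
  (mark_probability x)%:E = P0 [set w | A (x, path_of L w)].
Proof. by rewrite /mark_probability fineK// fin_num_measure. Qed.

Lemma mark_probability01 x : (0 <= mark_probability x <= 1)%R.
Proof.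
by rewrite -!lee_fin mark_probabilityE measure_ge0 probability_le1.
Qed.

Lemma measurable_mark_probability : measurable_fun setT mark_probability.
Proof.
apply: (measurableT_comp (f := @fine R)) => //.
exact: measurable_section_measure.
Qed.

Let p := mark_probability.

Let nA (z : R * path_space R) : R := if z \in A then 0%R else 1%R.

Let mnA : measurable_fun setT nA.
Proof. by apply: measurable_fun_ifT => //; exact: measurable_in. Qed.

Let nA0 z : (0 <= nA z)%R. Proof. by rewrite /nA; case: ifP. Qed.

Let int_nA x : \int[P0]_w (nA (x, path_of L w))%:E = (1 - p x)%:E.
Proof.
transitivity (\int[P0]_w (\1_(~` [set w | A (x, path_of L w)]) w)%:E).
  apply: eq_integral => w _; rewrite /nA indicE; congr EFin.
  have [h|h] := boolP ((x, path_of L w) \in A).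
    by rewrite memNset//= => /(_ (set_mem h)).
  by rewrite mem_set//= => /mem_set; apply/negP.
have mc : measurable (~` [set w | A (x, path_of L w)]) by exact: measurableC.
transitivity (P0 (~` [set w | A (x, path_of L w)])).
  by rewrite (integral_indic P0 measurableT mc) setIT.
by rewrite (probability_setC P0 (mAx x)) -mark_probabilityE EFinB.
Qed.

(** Marks can be integrated out one at a time. The factor [H] absorbs the factors
    [1 - p (U i)] produced by the marks already integrated. *)
Lemma marked_integral (m : nat) (H : GTU -> R) :
  measurable_fun setT H -> (forall w, (0 <= H w)%R) ->
  \int[P]_w (H w * \prod_(i < m) nA (U i w, path_of (Lc i) w))%:E =
  \int[P]_w (H w * \prod_(i < m) (1 - p (U i w)))%:E.
Proof.
have q0 x : (0 <= 1 - p x)%R by rewrite subr_ge0; have /andP[] := mark_probability01 x.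
elim: m H => [|m IH] H mH H0.
  by apply: eq_integral => w _; rewrite !big_ord0.
pose f (z : GT m * path_space R) : \bar R :=
  (H z.1 * (\prod_(i < m) nA (U i z.1, path_of (Lc i) z.1)) * nA (U m z.1, z.2))%:E.
have mf : measurable_fun setT f.
  apply/measurable_EFinP; apply: measurable_funM.
    apply: (measurableT_comp (f := fun w : GT m =>
      (H w * \prod_(i < m) nA (U i w, path_of (Lc i) w))%R)) => //.
    apply: measurable_funM; first exact: mGTU.
    apply: measurable_prod => i _; apply: (measurableT_comp mnA).
    apply: measurable_fun_pair; first exact: mU.
    by apply: mpath; rewrite neq_ltn ltn_ord.
  apply: (measurableT_comp mnA); apply: measurable_fun_pair => //.
  have h := measurableT_comp (@mU m m) (@measurable_fst _ _ (GT m) (path_space R)).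
  exact: h.
have f0 z : 0 <= f z.
  by rewrite lee_fin mulr_ge0// mulr_ge0//; apply: prodr_ge0.
have Dk : ~ [set o | o <> Some m] (Some m) by move=> /(_ erefl).
have Hf := family_integral Gm GI Lc_indep Dk (measurable_path_of (Lc m))
  (@mpathG m) mpL (same_path_law (Lc_law m)) mf f0.
transitivity (\int[P]_w f (w, path_of (Lc m) w)).
  by apply: eq_integral => w _; rewrite /f /= big_ord_recr/= mulrA.
rewrite Hf.
transitivity (\int[P]_w ((H w * (1 - p (U m w))) *
    \prod_(i < m) nA (U i w, path_of (Lc i) w))%:E).
  apply: eq_integral => w _; rewrite /f /=.
  under eq_integral do rewrite EFinM.
  rewrite ge0_integralZlT.
  - by rewrite int_nA -EFinM; congr EFin; ring.
  - apply/measurable_EFinP; apply: (measurableT_comp mnA).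
    exact: measurable_fun_pair.
  - by move=> w'; rewrite lee_fin.
  - by rewrite lee_fin mulr_ge0//; apply: prodr_ge0.
rewrite (IH (fun w => H w * (1 - p (U m w)))%R); last 2 first.
- apply: measurable_funM => //; apply: measurable_funB => //.
  apply: (measurableT_comp measurable_mark_probability) => // _ B mB.
  by apply: sub_sigma_algebra; exists m => //; exists B.
- by move=> w; rewrite mulr_ge0.
by apply: eq_integral => w _; congr EFin; rewrite big_ord_recr/=; ring.
Qed.

Lemma measurable_mark_hit i : measurable [set w | A (U i w, path_of (Lc i) w)].
Proof.
have mz : measurable_fun setT (fun w => (U i w, path_of (Lc i) w)).
  by apply: measurable_fun_pair => //; exact: measurable_path_of.
by have := mz measurableT A mA; rewrite setTI.
Qed.

Lemma avoid_first m :
  P [set w | forall i, (i < m)%N -> ~ A (U i w, path_of (Lc i) w)] =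
  \int[P]_w (\prod_(i < m) (1 - p (U i w)))%:E.
Proof.
have := @marked_integral m (cst 1%R) (measurable_cst _) (fun=> ler01).
under [in RHS]eq_integral do rewrite /= mul1r.
move=> <-; set B := [set w | _].
have BE : B = \bigcap_(i < m) ~` [set w | A (U i w, path_of (Lc i) w)].
  by apply/seteqP; split => w h i /=; exact: h.
have mB : measurable B.
  by rewrite BE; apply: bigcap_measurableType => i _; apply: measurableC;
    exact: measurable_mark_hit.
transitivity (\int[P]_w (\1_B w)%:E).
  by rewrite (integral_indic P measurableT mB) setIT.
apply: eq_integral => w _; rewrite /= mul1r indicE; congr EFin.
have [h|h] := boolP (w \in B).
  rewrite big1// => i _; rewrite /nA memNset//.
  exact: (set_mem h) (ltn_ord i).
have /existsNP[i /not_implyP[im /contrapT hA]] : ~ B w by move=> /mem_set; apply/negP.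
by rewrite (bigD1 (Ordinal im))//= {1}/nA mem_set// mul0r.
Qed.

Lemma mark_hit i :
  P [set w | A (U i w, path_of (Lc i) w)] = \int[P]_w (p (U i w))%:E.
Proof.
pose f (z : GT i * path_space R) : \bar R := (\1_A (U i z.1, z.2))%:E.
have mI : measurable_fun setT (\1_A : R * path_space R -> R).
  exact: measurable_indic.
have mf : measurable_fun setT f.
  apply/measurable_EFinP; apply: (measurableT_comp mI).
  apply: measurable_fun_pair => //.
  exact: (measurableT_comp (@mU i i) (@measurable_fst _ _ (GT i) (path_space R))).
have f0 z : 0 <= f z by rewrite lee_fin.
have Dk : ~ [set o | o <> Some i] (Some i) by move=> /(_ erefl).
have Hf := family_integral Gm GI Lc_indep Dk (measurable_path_of (Lc i))
  (@mpathG i) mpL (same_path_law (Lc_law i)) mf f0.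
transitivity (\int[P]_w f (w, path_of (Lc i) w)).
  transitivity (\int[P]_w (\1_[set w | A (U i w, path_of (Lc i) w)] w)%:E).
    by rewrite (integral_indic P measurableT (measurable_mark_hit i)) setIT.
  by apply: eq_integral => w _; rewrite /f !indicE; congr ((nat_of_bool _)%:R%:E); apply/idP/idP => /set_mem h; apply/mem_set.
rewrite Hf; apply: eq_integral => w _; rewrite mark_probabilityE /f /=.
transitivity (\int[P0]_w' (\1_[set w' | A (U i w, path_of L w')] w')%:E).
  by apply: eq_integral => w' _; rewrite !indicE; congr ((nat_of_bool _)%:R%:E); apply/idP/idP => /set_mem h; apply/mem_set.
by rewrite (integral_indic P0 measurableT (mAx (U i w))) setIT.
Qed.

End marked_poisson.

Lemma prod_one_sub_le {R : realDomainType} (a : nat -> R) m :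
  (forall i, 0 <= a i <= 1) ->
  \prod_(i < m) (1 - a i) <= 1 - \sum_(i < m) a i + (\sum_(i < m) a i) ^+ 2.
Proof.
move=> a01; elim: m => [|m IH]; first by rewrite !big_ord0; lra.
rewrite !big_ord_recr/=; have /andP[h0 h1] := a01 m.
have s0 : 0 <= \sum_(i < m) a i by apply: sumr_ge0 => i _; have /andP[] := a01 i.
set s := \sum_(i < m) a i in IH s0 *.
apply: (@le_trans _ _ ((1 - s + s ^+ 2) * (1 - a m))).
  by apply: ler_wpM2r => //; rewrite subr_ge0.
have : 0 <= s * a m by rewrite mulr_ge0.
have : 0 <= s ^+ 2 * a m by rewrite mulr_ge0// sqr_ge0.
have : 0 <= a m ^+ 2 by rewrite sqr_ge0.
rewrite !expr2; nra.
Qed.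

Section marked_poisson_process.
Context {R : realType} d d0 (T : measurableType d) (T0 : measurableType d0)
  (P : probability T R) (P0 : probability T0 R)
  (U : nat -> {RV P >-> R}) (Lc : nat -> R -> {RV P >-> R})
  (L : R -> {RV P0 >-> R}).
Hypothesis Lc_law : forall i, same_process_law P P0 (Lc i) L.
Hypothesis Lc_indep : independent_systems P (fun o : option nat =>
       if o is Some i
       then generated_sigma_algebra [set t : R | 0 <= t] (Lc i)
       else generated_sigma_algebra [set: nat] U).
Local Open Scope ereal_scope.
Variables (m0 : {measure set R -> \bar R}) (f : R -> \bar R).
Hypotheses (mf : measurable_fun setT f) (f0 : forall x, 0 <= f x)
  (ffin : forall x, f x \is a fin_num).
Hypothesis U_poisson :
  poisson_point_process P U (fun A => \int[m0]_(x in A) f x).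
Variable A : set (R * path_space R).
Hypothesis mA : measurable A.

Let p := mark_probability L A.
Let mp : measurable_fun setT p := measurable_mark_probability L mA.
Let p01 : forall x, (0 <= p x <= 1)%R := mark_probability01 L mA.

Definition mark_intensity : \bar R :=
  \int[m0]_x (P0 [set w | A (x, path_of L w)] * f x).

Hypothesis A_finite : mark_intensity < +oo.

Let mark_intensityE : mark_intensity = \int[m0]_x ((p x)%:E * f x).
Proof. by apply: eq_integral => x _; rewrite mark_probabilityE. Qed.

Let int_p : \int[m0]_x ((p x)%:E * f x) < +oo.
Proof. by rewrite -mark_intensityE. Qed.


Let I := fine (\int[m0]_x ((p x)%:E * f x)).

Let laplace_ge (q : R -> R) m : measurable_fun setT q ->
  (forall x, 0 <= q x <= 1)%R -> \int[m0]_x ((q x)%:E * f x) < +oo ->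
  (expR (- fine (\int[m0]_x ((q x)%:E * f x))))%:E <=
  \int[P]_w (\prod_(i < m) (1 - q (U i w)))%:E.
Proof.
pose mu := density_measure m0 f : {measure set R -> \bar R}.
move=> mq q01 int_q.
exact: (@poisson_laplace_ge _ _ _ _ _ P U (mu mf f0) U_poisson m0 f mf f0
  (fun _ _ => erefl) q mq q01 int_q m).
Qed.

Let laplace_cvg :
  \int[P]_w (\prod_(i < m) (1 - p (U i w)))%:E @[m --> \oo] --> (expR (- I))%:E.
Proof.
pose mu := density_measure m0 f : {measure set R -> \bar R}.
exact: (@poisson_laplace_cvg _ _ _ _ _ P U (mu mf f0) U_poisson m0 f mf f0 ffin
  (fun _ _ => erefl) p mp p01 int_p).
Qed.

(** Integrating out the marks of the first [m] points turns their avoidance of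
    [A] into the Laplace functional of the mark probability. *)
Lemma avoidance_probability :
  P [set w | forall i, ~ A (U i w, path_of (Lc i) w)] =
  (expR (- fine mark_intensity))%:E.
Proof.
pose F m := [set w | forall i, (i < m)%N -> ~ A (U i w, path_of (Lc i) w)].
have mF m : measurable (F m).
  rewrite (_ : F m = \bigcap_(i < m) ~` [set w | A (U i w, path_of (Lc i) w)]).
    by apply: bigcap_measurableType => i _; apply: measurableC; exact: (measurable_mark_hit U Lc mA).
  by apply/seteqP; split => w h i /=; exact: h.
have -> : [set w | forall i, ~ A (U i w, path_of (Lc i) w)] = \bigcap_m F m.
  apply/seteqP; split => w /= h.
    by move=> m _ i _; exact: h.
  by move=> i; exact: (h i.+1 Logic.I i (ltnSn i)).
have mbF : measurable (\bigcap_m F m) by exact: bigcap_measurableType.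
have dF : nonincreasing_seq F.
  by move=> m n mn; apply/subsetPset => w h i im; apply: (h i); exact: leq_trans im mn.
have Foo : P (F 0%N) < +oo by apply: (le_lt_trans (probability_le1 P (mF 0%N))); rewrite ltry.
have := nonincreasing_cvg_mu Foo mF mbF dF.
under eq_cvg do rewrite /= (avoid_first Lc_law Lc_indep mA).
move=> /cvg_lim <-//; rewrite mark_intensityE.
exact: cvg_lim laplace_cvg.
Qed.

Let Sum m := (\sum_(i < m) \int[P]_w (p (U i w))%:E).

Let mpU i : measurable_fun setT (fun w => p (U i w)).
Proof. exact: measurableT_comp. Qed.

(** Compare [exp (- e * I) >= 1 - e * I] with the second order expansion
    [prod_one_sub_le] of the Laplace functional of [e * p]. *)
Let Sum_le_eps m (e : R) : (0 < e <= 1)%R ->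
  Sum m <= (I + e * (m%:R ^+ 2))%:E.
Proof.
move=> /andP[e0 e1].
have e0' := ltW e0.
have q01 x : (0 <= e * p x <= 1)%R.
  by have /andP[h1 h2] := p01 x; rewrite mulr_ge0//= mulr_ile1.
have pf0 x : 0 <= (p x)%:E * f x.
  by rewrite mule_ge0// lee_fin; have /andP[] := p01 x.
have mpf : measurable_fun setT (fun x => (p x)%:E * f x).
  by apply: emeasurable_funM => //; exact/measurable_EFinP.
have int_eE : \int[m0]_x ((e * p x)%:E * f x) = (e * I)%:E.
  under eq_integral do rewrite EFinM -muleA.
  rewrite (ge0_integralZlT m0 mpf pf0)// EFinM fineK// ge0_fin_numE//.
  exact: integral_ge0.
have := @laplace_ge (fun x => e * p x)%R m.
rewrite int_eE /= => /(_ _ q01); rewrite ltry => /(_ _ isT) hl.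
have {}hl := hl (measurable_funM (measurable_cst _) mp).
have S0 w : (0 <= \sum_(i < m) p (U i w))%R.
  by apply: sumr_ge0 => i _; have /andP[] := p01 (U i w).
have Sm w : (\sum_(i < m) p (U i w) <= m%:R)%R.
  rewrite -[leRHS](mulr_natr 1) mul1r -[in leRHS](card_ord m) -sumr_const.
  by apply: ler_sum => i _; have /andP[] := p01 (U i w).
have mS : measurable_fun setT (fun w => (\sum_(i < m) p (U i w))%R).
  by apply: measurable_sum.
have intS : \int[P]_w (\sum_(i < m) p (U i w))%:E = Sum m.
  under eq_integral do rewrite -sumEFin.
  rewrite ge0_integral_sum//.
  - by move=> i; exact/measurable_EFinP.
  - by move=> i w _; rewrite lee_fin; have /andP[] := p01 (U i w).
have Sfin : Sum m \is a fin_num.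
  rewrite -intS ge0_fin_numE; last by apply: integral_ge0 => w _; rewrite lee_fin.
  apply: (@le_lt_trans _ _ (\int[P]_w (cst m%:R%:E w))).
    by apply: ge0_le_integral => // [w _||w _]; rewrite ?lee_fin//; exact/measurable_EFinP.
  by rewrite integral_cst//= probability_setT mule1 ltry.
have : (expR (- (e * I)))%:E + e%:E * Sum m <= (1 + (e * m%:R) ^+ 2)%:E.
  apply: (@le_trans _ _ (\int[P]_w (\prod_(i < m) (1 - e * p (U i w)))%:E + e%:E * Sum m)).
    exact: leeD2r.
  rewrite -intS -(@ge0_integralZlT _ _ _ P); last 3 first.
  - exact/measurable_EFinP.
  - by move=> w; rewrite lee_fin.
  - by rewrite lee_fin.
  rewrite -ge0_integralD//; last 4 first.
  - move=> w _; rewrite lee_fin; apply: prodr_ge0 => i _.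
    by rewrite subr_ge0; have /andP[] := q01 (U i w).
  - apply/measurable_EFinP; apply: measurable_prod => i _.
    by apply: measurable_funB => //; exact: measurable_funM.
  - by move=> w _; rewrite mule_ge0// lee_fin.
  - by apply: measurable_funeM; exact/measurable_EFinP.
  rewrite -[leRHS]mule1 -(probability_setT P) -integral_cst//.
  apply: ge0_le_integral => //.
  - move=> w _; rewrite adde_ge0// ?mule_ge0 ?lee_fin//; apply: prodr_ge0 => i _.
    by rewrite subr_ge0; have /andP[] := q01 (U i w).
  - apply: emeasurable_funD.
      apply/measurable_EFinP; apply: measurable_prod => i _.
      by apply: measurable_funB => //; exact: measurable_funM.
    by apply: measurable_funeM; exact/measurable_EFinP.
  move=> w _; rewrite /= -EFinM -EFinD lee_fin.
  have := @prod_one_sub_le _ (fun i => e * p (U i w))%R m (fun i => q01 (U i w)).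
  rewrite -mulr_sumr => h; rewrite -lerBrDr; apply: le_trans h _.
  rewrite addrAC lerD2r lerD2l ler_sqr ?nnegrE ?mulr_ge0//.
  by rewrite ler_pM2l.
move: (Sfin); move: (Sum m) => [s| |]// _.
rewrite -EFinM -EFinD !lee_fin => h.
have := expR_ge1Dx (- (e * I))%R => h2.
rewrite -(ler_pM2l e0); move: h; rewrite !expr2; lra.
Qed.

(** Campbell's bound, obtained from [Sum_le_eps] as [e] tends to 0. *)
Let hit_sum_le m :
  \sum_(i < m) P [set w | A (U i w, path_of (Lc i) w)] <= mark_intensity.
Proof.
under eq_bigr do rewrite (mark_hit Lc_law Lc_indep mA).
rewrite -/(Sum m) mark_intensityE.
have -> : \int[m0]_x ((p x)%:E * f x) = I%:E.
  rewrite fineK// ge0_fin_numE//; apply: integral_ge0 => x _.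
  by rewrite mule_ge0// lee_fin; have /andP[] := p01 x.
apply/lee_addgt0Pr => e e0.
pose t : R := Num.min 1%R (e / (m%:R ^+ 2 + 1))%R.
have d0' : (0 < m%:R ^+ 2 + 1 :> R)%R by rewrite ltr_wpDl// sqr_ge0.
have t01 : (0 < t <= 1)%R.
  by rewrite /t lt_min ltr01 divr_gt0//= ge_min lexx.
apply: le_trans (Sum_le_eps m t01) _; rewrite -EFinD lee_fin lerD2l.
have te : (t <= e / (m%:R ^+ 2 + 1))%R by rewrite /t ge_min lexx orbT.
apply: (@le_trans _ _ (t * (m%:R ^+ 2 + 1))%R).
  by apply: ler_wpM2l; [case/andP: t01 => /ltW|rewrite lerDl].
by rewrite -ler_pdivlMr.
Qed.

(** Borel-Cantelli with Campbell's bound. *)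
Lemma finitely_many_hits : {ae P, forall w,
  finite_set [set i | A (U i w, path_of (Lc i) w)]}.
Proof.
pose F i := [set w | A (U i w, path_of (Lc i) w)].
have mF i : measurable (F i) by exact: (measurable_mark_hit U Lc mA).
have SF : \sum_(i <oo) P (F i) < +oo.
  apply: le_lt_trans A_finite; apply: lime_le.
    by apply: is_cvg_nneseries => i _ _.
  by apply: nearW => m; rewrite big_mkord; exact: hit_sum_le.
have L0 := lim_sup_set_cvg0 mF SF.
exists (lim_sup_set F); split => //.
  by apply: bigcap_measurableType => n _; apply: bigcup_measurable => k _.
move=> w hw n _; apply: contrapT => hn; apply: hw.
apply: (sub_finite_set _ (finite_II n)) => i hi /=; rewrite ltnNge; apply/negP => ni.
by apply: hn; exists i.
Qed.

End marked_poisson_process.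

(** * Suprema of locally finite families of paths *)
Section suprema_of_paths.
Context {R : realType}.
Implicit Types (X : nat -> R -> R) (f : R -> R).

Lemma cvg_maxr {T : Type} (F : set_system T) {FF : Filter F} (f g : T -> R) (x y : R) :
  f s @[s --> F] --> x -> g s @[s --> F] --> y ->
  Num.max (f s) (g s) @[s --> F] --> Num.max x y.
Proof.
move=> fx gy; rewrite maxr_absE; under eq_fun do rewrite maxr_absE.
apply: cvgMl; apply: cvgD; first exact: cvgD.
by apply: cvg_norm; exact: cvgB.
Qed.

Lemma cvg_bigmax {T : Type} (F : set_system T) {FF : Filter F} (I : Type)
    (X : I -> T -> R) (x : I -> R) (i0 : I) (J : seq I) :
  (forall i, X i s @[s --> F] --> x i) ->
  \big[Num.max/X i0 s]_(i <- J) X i s @[s --> F] -->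
    \big[Num.max/x i0]_(i <- J) x i.
Proof.
move=> Xx; elim: J => [|j J IH].
  by under eq_fun do rewrite big_nil; rewrite big_nil; exact: Xx.
by under eq_fun do rewrite big_cons; rewrite big_cons; exact: cvg_maxr.
Qed.

Lemma bigmax_is_max X (J : seq nat) z t :
  z < X 0%N t -> (forall i, z < X i t -> i \in J) ->
  is_max [set X i t | i in [set: nat]] (\big[Num.max/X 0%N t]_(i <- J) X i t).
Proof.
move=> z0 zJ; split.
  elim: J {zJ} => [|j J [i _ IH]]; first by rewrite big_nil; exists 0%N.
  rewrite big_cons -IH.
  by rewrite maxEle; case: ifP => _; [exists i|exists j].
have h0 : X 0%N t <= \big[Num.max/X 0%N t]_(i <- J) X i t.
  elim: J {zJ} => [|j J IH]; first by rewrite big_nil.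
  by rewrite big_cons le_max IH orbT.
move=> _ [i _ <-]; have [/zJ iJ|h] := ltP z (X i t).
  elim: J iJ {zJ h0} => // j J IH; rewrite inE big_cons le_max.
  by case/orP => [/eqP->|/IH->]; rewrite ?lexx ?orbT.
by apply: le_trans h0; apply: le_trans h (ltW z0).
Qed.

Lemma is_max_sup (A : set R) m : is_max A m -> sup A = m.
Proof.
move=> [Am ubm]; apply/eqP; rewrite eq_le; apply/andP; split.
  by apply: ge_sup => //; exists m.
by apply: ub_le_sup => //; exists m.
Qed.

Section locally_finite.
Variable X : nat -> R -> R.
Hypothesis hfin : forall z S : R,
  finite_set [set i | exists2 t, 0 <= t < S & z < X i t].
Let Z t := sup [set X i t | i in [set: nat]].

Lemma locally_finite_max (z S : R) : exists J : seq nat,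
  forall t, 0 <= t < S -> z < X 0%N t ->
  is_max [set X i t | i in [set: nat]] (\big[Num.max/X 0%N t]_(i <- J) X i t).
Proof.
have /finite_seqP[J JE] := hfin z S; exists J => t tS zt.
apply: (bigmax_is_max zt) => i zi.
suff : [set` J] i by [].
by rewrite -JE /=; exists t.
Qed.

Lemma locally_finite_is_max t : 0 <= t -> is_max [set X i t | i in [set: nat]] (Z t).
Proof.
move=> t0; have [J hJ] := locally_finite_max (X 0%N t - 1) (t + 1).
have tS : 0 <= t < t + 1 by rewrite t0 ltrDl ltr01.
have h : X 0%N t - 1 < X 0%N t by rewrite ltrBlDr ltrDl ltr01.
by have := hJ t tS h => hm; rewrite /Z (is_max_sup hm).
Qed.

(** Along the filter, only the indices of the paths that pass [x 0 - 1] compete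
    for the supremum, and they are finitely many. The second conclusion, with the
    same [J], identifies the limit when it is the value at a time [t]. *)
Lemma locally_finite_cvg (F : set_system R) {FF : Filter F} (x : nat -> R) (S : R) :
  (\forall s \near F, 0 <= s < S) -> (forall i, X i s @[s --> F] --> x i) ->
  exists2 J : seq nat, Z s @[s --> F] --> \big[Num.max/x 0%N]_(i <- J) x i &
    forall t, 0 <= t < S -> x 0%N = X 0%N t ->
      Z t = \big[Num.max/X 0%N t]_(i <- J) X i t.
Proof.
move=> FS Xx; have [J hJ] := locally_finite_max (x 0%N - 1) S.
exists J; last first.
  move=> t tS xt; apply: is_max_sup; apply: hJ => //.
  by rewrite xt ltrBlDr ltrDl.
have := @cvg_bigmax _ _ FF _ X x 0%N J Xx; apply: cvg_trans; apply: near_eq_cvg.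
have h0 : \forall s \near F, x 0%N - 1 < X 0%N s.
  by apply: (cvgr_gt _ (Xx 0%N)); rewrite ltrBlDr ltrDl.
by near=> s; rewrite /Z (is_max_sup (hJ s _ _))//; near: s.
Unshelve. all: by end_near. Qed.

Let near_right (t : R) : 0 <= t -> \forall s \near t^'+, 0 <= s < t + 1.
Proof.
move=> t0; near=> s; apply/andP; split.
  by apply: (le_trans t0); apply: ltW; near: s; exact: nbhs_right_gt.
by near: s; apply: nbhs_right_lt; rewrite ltrDl.
Unshelve. all: by end_near. Qed.

Let near_left (t : R) : 0 < t -> \forall s \near t^'-, 0 <= s < t + 1.
Proof.
move=> t0; near=> s; apply/andP; split.
  by apply: ltW; near: s; exact: nbhs_left_gt.
by apply: (@lt_trans _ _ t); rewrite ?ltrDl//; near: s; exact: nbhs_left_lt.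
Unshelve. all: by end_near. Qed.

Let sup_right (Xc : forall i, cadlag (X i)) t : 0 <= t -> Z s @[s --> t^'+] --> Z t.
Proof.
move=> t0.
have [J ZJ ->//] := @locally_finite_cvg t^'+ _ (fun i => X i t) (t + 1)
  (near_right t0) (fun i => (Xc i).1 t t0).
by rewrite t0 ltrDl/=.
Qed.

Lemma locally_finite_cadlag : (forall i, cadlag (X i)) -> cadlag Z.
Proof.
move=> Xc; split=> [t t0|t t0]; first exact: sup_right.
have [J ZJ _] := @locally_finite_cvg t^'- _ (fun i => lim (X i s @[s --> t^'-])) (t + 1)
  (near_left t0) (fun i => (Xc i).2 t t0).
by apply/cvg_ex; eexists; exact: ZJ.
Qed.

Lemma locally_finite_continuous : (forall i, continuous_path (X i)) -> continuous_path Z.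
Proof.
move=> Xc; have Xc' i := (continuous_within_itvcyP _ _).1 (Xc i).
apply/continuous_within_itvcyP; split=> [t|].
  rewrite in_itv/= andbT => t0.
  have near_t : \forall s \near t, 0 <= s < t + 1.
    near=> s; apply/andP; split.
      by apply: ltW; near: s; exact: lt_nbhsr.
    by near: s; apply: lt_nbhsl; rewrite ltrDl.
  have [J ZJ e] := @locally_finite_cvg (nbhs t) _ (fun i => X i t) (t + 1) near_t
    (fun i => (Xc' i).1 t ltac:(by rewrite in_itv/= andbT)).
  by rewrite /continuous_at e// ltW//= ltrDl.
have [J ZJ ->//] := @locally_finite_cvg 0^'+ _ (fun i => X i 0) (0 + 1)
  (near_right (lexx 0)) (fun i => (Xc' i).2).
by rewrite lexx ltrDl/=.
Unshelve. all: by end_near. Qed.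

End locally_finite.
End suprema_of_paths.

(** * Regularity of the paths *)
Section time_changed_regularity.
Context {R : realType} (alpha : R -> R) (a b : R).
Hypotheses (a0 : 0 < a) (alpha_bnd : forall z, a <= alpha z <= b)
  (malpha : measurable_fun setT alpha).
Variables (l : R -> R) (x : R).
Hypothesis cl : cadlag l.
Notation tau := (time_change alpha l x).

Let clip := @clock_lip _ _ _ _ a0 alpha_bnd malpha _ x cl.

Let tau_lt (t t' : R) : 0 <= t -> t < t' -> tau t < tau t'.
Proof.
move=> t0 tt'; rewrite !(time_change_inverse a0 alpha_bnd malpha x cl).
exact: (inverse_clock_lt a0 (clock_at0 alpha l x) clip t0 tt').
Qed.

Let tau_lip (t t' : R) : 0 <= t -> t <= t' -> tau t' - tau t <= (t' - t) / a.
Proof.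
move=> t0 tt'; rewrite !(time_change_inverse a0 alpha_bnd malpha x cl).
exact: (inverse_clock_lip a0 (clock_at0 alpha l x) clip t0 tt').
Qed.

Let tau0 (t : R) : 0 < t -> 0 < tau t.
Proof.
move=> t0; apply: le_lt_trans (tau_lt (lexx 0) t0).
exact: (time_change_ge0 a0 alpha_bnd malpha x cl (lexx 0)).
Qed.

(** The time change is strictly increasing and Lipschitz continuous, hence carries
    one-sided limits to one-sided limits of the same side. *)
Let tau_at_right (t : R) : 0 <= t -> tau s @[s --> t^'+] --> (tau t)^'+.
Proof.
move=> t0 B [e /= e0 eB]; change (\forall s \near t^'+, B (tau s)); near=> s.
have ts : t < s by near: s; exact: nbhs_right_gt.
have tts := tau_lt t0 ts.
apply: eB => //=; rewrite distrC gtr0_norm ?subr_gt0//.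
apply: (le_lt_trans (tau_lip t0 (ltW ts))).
rewrite ltr_pdivrMr// ltrBlDr addrC; near: s; apply: nbhs_right_lt.
by rewrite ltrDl mulr_gt0.
Unshelve. all: by end_near. Qed.

Let tau_at_left (t : R) : 0 < t -> tau s @[s --> t^'-] --> (tau t)^'-.
Proof.
move=> t0 B [e /= e0 eB]; change (\forall s \near t^'-, B (tau s)); near=> s.
have ts : s < t by near: s; exact: nbhs_left_lt.
have s0 : 0 <= s by apply: ltW; near: s; exact: nbhs_left_gt.
have tts := tau_lt s0 ts.
apply: eB => //=; rewrite gtr0_norm ?subr_gt0//.
apply: (le_lt_trans (tau_lip s0 (ltW ts))).
rewrite ltr_pdivrMr// ltrBlDr addrC -ltrBlDr; near: s; apply: nbhs_left_gt.
by rewrite ltrBlDr ltrDl mulr_gt0.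
Unshelve. all: by end_near. Qed.

Let tau_ge0 (t : R) : 0 <= t -> 0 <= tau t.
Proof. exact: (time_change_ge0 a0 alpha_bnd malpha x cl). Qed.

Lemma time_changed_cadlag : cadlag (time_changed alpha l x).
Proof.
split=> [t t0|t t0].
  apply: cvgD; last exact: cvg_cst.
  exact: (cvg_comp _ _ (tau_at_right t0) (cl.1 _ (tau_ge0 t0))).
apply/cvg_ex; exists (lim (l s @[s --> (tau t)^'-]) + x).
apply: cvgD; last exact: cvg_cst.
exact: (cvg_comp _ _ (tau_at_left t0) (cl.2 _ (tau0 t0))).
Qed.

Lemma time_changed_continuous : continuous_path l ->
  continuous_path (time_changed alpha l x).
Proof.
move=> /continuous_within_itvcyP[lc _].
apply/continuous_within_itvcyP; split; last exact: (time_changed_cadlag.1 0 (lexx 0)).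
move=> t; rewrite in_itv/= andbT => t0.
apply/left_right_continuousP; split; last exact: (time_changed_cadlag.1 t (ltW t0)).
apply: cvgD; last exact: cvg_cst.
have h : l s @[s --> (tau t)^'-] --> l (tau t).
  by apply: cvg_at_left_filter; apply: lc; rewrite in_itv/= andbT tau0.
exact: (cvg_comp _ _ (tau_at_left t0) h).
Qed.

End time_changed_regularity.

Section uniform_continuity.
Context {R : realType}.

Local Notation toR := (@ratr R).

(** Heine's theorem on [0, S]. *)
Lemma continuous_path_modulus (l : R -> R) (S e : R) : continuous_path l -> 0 < e ->
  exists2 h, 0 < h & forall x y, 0 <= x <= S -> 0 <= y -> `|x - y| < h ->
    `|l x - l y| < e.
Proof.
move=> /continuous_within_itvcyP[lc l0] e0.
have loc x : 0 <= x -> exists2 h, 0 < h &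
    forall y, 0 <= y -> `|x - y| < h -> `|l x - l y| < e / 2.
  have e20 : 0 < e / 2 by rewrite divr_gt0.
  rewrite le_eqVlt => /predU1P[<-|x0].
    have /cvgrPdist_lt/(_ _ e20)[h /= h0 hh] := l0.
    exists h => // y; rewrite le_eqVlt => /predU1P[<-|y0 xy].
      by move=> _; rewrite subrr normr0.
    exact: hh.
  have /cvgrPdist_lt/(_ _ e20)[h /= h0 hh] : l y @[y --> x] --> l x.
    by apply: lc; rewrite in_itv/= andbT.
  by exists h => // y _ xy; exact: hh.
have /compact_near_coveringP cpt := @segment_compact R 0 S.
pose Q (h x : R) := forall y, 0 <= x -> 0 <= y -> `|x - y| < h -> `|l x - l y| < e.
have := @cpt R (0^'+) Q _; case.
  move=> x; rewrite /= in_itv/= => /andP[x0 xS].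
  have [h h0 hh] := loc x x0.
  exists (ball x (h / 2), [set h' | h' < h / 2]).
    split; first by apply: nbhsx_ballx; rewrite divr_gt0.
    by apply: nbhs_right_lt; rewrite divr_gt0.
  move=> [x' h'] /= [xx' h'h] y x'0 y0 x'y.
  have xx'h : `|x - x'| < h by apply: (lt_trans xx'); lra.
  have xyh : `|x - y| < h.
    rewrite (_ : x - y = (x - x') + (x' - y)); last by ring.
    apply: (le_lt_trans (ler_normD _ _)).
    by rewrite [h]splitr ltrD// (lt_trans x'y).
  rewrite (_ : l x' - l y = (l x - l y) - (l x - l x')); last by ring.
  apply: (le_lt_trans (ler_normB _ _)).
  by rewrite [e]splitr ltrD// hh.
move=> h /= h0 hQ; exists (h / 2); first by rewrite divr_gt0.
move=> x y /andP[x0 xS] y0 xy.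
apply: (hQ (h / 2) _ _ x) => //=.
- by rewrite sub0r normrN gtr0_norm ?divr_gt0//; lra.
- by rewrite divr_gt0.
- by rewrite in_itv/= x0.
Qed.

Definition oscillating_paths (S e h : R) : set (path_space R) :=
  \bigcup_(q : rat) \bigcup_(r : rat) [set l | 
    [&& 0 < toR q < S, 0 < toR r < S & `|toR q - toR r| < h] &&
    (e < `|l (toR q) - l (toR r)|)].

(** For a cadlag path, uniform continuity on the positive rationals of each
    bounded interval is continuity; this makes continuity a measurable property
    of the path. *)
Definition rationally_continuous_paths : set (path_space R) :=
  \bigcap_(S : nat) \bigcap_(m : nat) \bigcup_(n : nat)
    ~` oscillating_paths S%:R m.+1%:R^-1 n.+1%:R^-1.

Lemma measurable_oscillating_paths S e h : measurable (oscillating_paths S e h).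
Proof.
apply: bigcupT_measurable_rat => q; apply: bigcupT_measurable_rat => r.
have [/and3P[/andP[q0 _] /andP[r0 _] _]|nc] :=
  boolP [&& 0 < toR q < S, 0 < toR r < S & `|toR q - toR r| < h]; last first.
  by rewrite [X in measurable X](_ : _ = set0)// -subset0 => l /=.
have m : measurable_fun setT (fun l : path_space R => `|l (toR q) - l (toR r)|).
  apply: (measurableT_comp (@normr_measurable R setT)).
  by apply: measurable_funB; exact: measurable_coordinate.
have := m measurableT `]e, +oo[%classic (measurable_itv _).
rewrite setTI; congr measurable; apply/seteqP; split => l /=.
  by rewrite in_itv/= andbT.
by rewrite in_itv/= andbT.
Qed.

Lemma measurable_rationally_continuous_paths : measurable rationally_continuous_paths.
Proof.
apply: bigcap_measurableType => S _; apply: bigcap_measurableType => m _.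
apply: bigcup_measurable => n _; apply: measurableC.
exact: measurable_oscillating_paths.
Qed.

Lemma continuous_rationally_continuous (l : R -> R) : continuous_path l ->
  rationally_continuous_paths l.
Proof.
move=> lc S _ m _.
have [h h0 hl] := @continuous_path_modulus l S%:R m.+1%:R^-1 lc (ltac:(by rewrite invr_gt0)).
have [n nh] := ltr_add_invr h0; exists n => //= -[q _ [r _]] /= /andP[/and3P[/andP[q0 qS] /andP[r0 _] qr]].
apply/negP; rewrite -leNgt ltW// hl//.
- by rewrite (ltW q0) (ltW qS).
- exact: ltW.
- by rewrite add0r in nh; exact: lt_trans nh.
Qed.

(** A jump at [t] is seen by rational times on both sides of [t]. *)
Lemma cadlag_rationally_continuous (l : R -> R) : cadlag l ->
  rationally_continuous_paths l -> continuous_path l.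
Proof.
move=> cl lC; apply/continuous_within_itvcyP; split; last exact: cl.1.
move=> t; rewrite in_itv/= andbT => t0.
apply/left_right_continuousP; split; last exact: (cl.1 t (ltW t0)).
have lim_l := cl.2 t t0; set y := lim (l s @[s --> t^'-]) in lim_l.
suff -> : l t = y by exact: lim_l.
apply/eqP; rewrite -subr_eq0 -normr_eq0 eq_le normr_ge0 andbT.
apply/ler_addgt0Pl => e e0; rewrite addr0.
have e30 : 0 < e / 3 by rewrite divr_gt0.
have [m me] := ltr_add_invr e30; rewrite add0r in me.
have [n _ hn] := lC (Num.truncn t).+2 I m I.
have h0 : 0 < n.+1%:R^-1 :> R by rewrite invr_gt0.
have [q [q0 qt hq yq]] : exists q : rat, [/\ 0 < toR q, toR q < t,
    t - n.+1%:R^-1 / 2 < toR q & `|y - l (toR q)| < e / 3].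
  have /cvgrPdist_lt/(_ _ e30)[d /= d0 hd] := lim_l.
  have lt : Num.max 0 (Num.max (t - d) (t - n.+1%:R^-1 / 2)) < t.
    by rewrite !gt_max t0 !gtrDl !oppr_lt0 d0 divr_gt0.
  have [q] := rat_in_itvoo lt; rewrite in_itv/= !gt_max => /andP[/and3P[q0 dq hq] qt].
  exists q; split => //; apply: hd => //=.
  by rewrite gtr0_norm ?subr_gt0// ltrBlDr addrC -ltrBlDr.
have [r [tr rS hr yr]] : exists r : rat, [/\ t < toR r, toR r < t + 1,
    toR r < t + n.+1%:R^-1 / 2 & `|l t - l (toR r)| < e / 3].
  have /cvgrPdist_lt/(_ _ e30)[d /= d0 hd] := cl.1 t (ltW t0).
  have lt : t < Num.min (t + 1) (Num.min (t + d) (t + n.+1%:R^-1 / 2)).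
    by rewrite !lt_min !ltrDl ltr01 d0 divr_gt0.
  have [r] := rat_in_itvoo lt; rewrite in_itv/= !lt_min => /andP[tr /and3P[rS dr hr]].
  exists r; split => //; apply: hd => //=.
  by rewrite distrC gtr0_norm ?subr_gt0// ltrBlDr addrC.
have S0 : t + 1 < (Num.truncn t).+2%:R.
  by rewrite -[X in X%:R]addn1 natrD ltrD2r truncnS_gt.
have lqr : `|l (toR q) - l (toR r)| <= m.+1%:R^-1.
  rewrite leNgt; apply/negP => h; apply: hn; exists q => //; exists r => //=.
  rewrite h andbT; apply/and3P; split.
  - by rewrite q0 (lt_trans qt)// (lt_trans _ S0)// ltrDl.
  - by rewrite (lt_trans t0 tr) (lt_trans rS).
  - rewrite distrC gtr0_norm ?subr_gt0; last exact: lt_trans tr.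
    by move: hq hr; set k := n.+1%:R^-1; lra.
rewrite (_ : l t - y = (l t - l (toR r)) - (l (toR q) - l (toR r)) - (y - l (toR q))); last by ring.
apply: (le_trans (ler_normB _ _)).
have := ler_normB (l t - l (toR r)) (l (toR q) - l (toR r)).
by move: yq yr lqr me; set k := m.+1%:R^-1; lra.
Qed.

End uniform_continuity.

(** The paths of both processes are cadlag, so their continuity is membership in
    a measurable subset of the path space. *)
Lemma continuous_path_transfer {R : realType} d d0 (T : measurableType d)
    (T0 : measurableType d0) (P : probability T R) (P0 : probability T0 R)
    (X : R -> {RV P >-> R}) (L : R -> {RV P0 >-> R}) :
  same_process_law P P0 X L -> (forall w, cadlag (fun t => X t w)) ->
  {ae P0, forall w, continuous_path (fun t => L t w)} ->
  {ae P, forall w, continuous_path (fun t => X t w)}.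
Proof.
move=> XL Xc [N [mN N0 hN]].
pose C := @rationally_continuous_paths R.
have mC : measurable (~` C) by apply: measurableC; exact: measurable_rationally_continuous_paths.
have mL : measurable (path_of L @^-1` ~` C).
  by rewrite -[X in measurable X]setTI; exact: (measurable_path_of L measurableT mC).
have mX : measurable (path_of X @^-1` ~` C).
  by rewrite -[X in measurable X]setTI; exact: (measurable_path_of X measurableT mC).
exists (path_of X @^-1` ~` C); split => //.
  rewrite (same_path_law XL mC); apply/eqP; rewrite eq_le measure_ge0 andbT -N0.
  apply: le_measure; rewrite ?inE// => w /= nC; apply: hN => /= cL; apply: nC.
  exact: continuous_rationally_continuous.
move=> w /= ncX; rewrite /preimage /setC /= => Cw; apply: ncX.
exact: cadlag_rationally_continuous.
Qed.

(** * The maximum process *)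

Section orthants.
Context {R : realType} d (T : measurableType d) (P : probability T R).
Local Open Scope ereal_scope.

(** Half-spaces orthogonal to the axes generate the Borel sets of [R ^ n], and
    those orthogonal to a given axis are stable by intersection. *)
Lemma same_law_orthants n (X Y : T -> n.-tuple R) :
  measurable_fun setT X -> measurable_fun setT Y ->
  (forall (s : seq 'I_n) (z : 'I_n -> R),
    P [set w | forall k, k \in s -> (tnth (X w) k <= z k)%R] =
    P [set w | forall k, k \in s -> (tnth (Y w) k <= z k)%R]) ->
  same_law P P X Y.
Proof.
move=> mX mY XY.
pose ray k z : set (n.-tuple R) := [set v | tnth v k <= z]%R.
pose G (k : 'I_n) := [set A | exists z : R, A = ray k z].
have mtn k : measurable_fun setT (fun v : n.-tuple R => tnth v k).
  exact: measurable_tnth.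
have mray k z : measurable (ray k z).
  have := mtn k measurableT `]-oo, z]%classic (measurable_itv _).
  by rewrite setTI; congr measurable; apply/seteqP; split => v /=; rewrite in_itv.
pose GT := g_sigma_algebraType (\bigcup_(k in [set: 'I_n]) G k).
have mid : measurable_fun setT (id : GT -> n.-tuple R).
  apply/measurable_fun_tnthP => k.
  apply: (measurability _ (RGenOInfty.measurableE R)) => _ [_ [z ->] <-].
  rewrite setTI (_ : _ @^-1` _ = ~` ray k z).
    by apply: measurableC; apply: sub_sigma_algebra; exists k => //; exists z.
  by apply/seteqP; split => v /=; rewrite in_itv/= andbT ltNge => /negP.
move=> A mA.
suff : pushforward P X A = pushforward P Y A by [].
apply: (@cylinder_measure_unique _ _ _ _ setT G).
- by move=> k _ _ [z ->].
- move=> k _ _ _ [z ->] [z' ->]; exists (Num.min z z').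
  by apply/seteqP; split => v /=; rewrite /ray/= le_min => /andP.
- by rewrite /= /pushforward preimage_setT probability_setT ltry.
- move=> s B us sB.
  have /choice[z hz] : forall k, exists z, k \in s -> B k = ray k z.
    move=> k; have [ks|_] := boolP (k \in s); last by exists 0%R.
    by have [_ [z ->]] := sB _ ks; exists z.
  have e (V : T -> n.-tuple R) : V @^-1` (\bigcap_(i in [set` s]) B i) =
      [set w | forall k, k \in s -> (tnth (V w) k <= z k)%R].
    by apply/seteqP; split => w /= h k ks; have := h k ks; rewrite hz.
  by have := XY s z; rewrite -(e X) -(e Y).
by have := mid measurableT A mA; rewrite setTI.
Qed.

End orthants.

Section borel_lebesgue.
Context {R : realType}.
Local Open Scope ereal_scope.

Let mid : measurable_fun setT (fun x : measurableTypeR R => x : R).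
Proof. by []. Qed.

(** Lebesgue measure on [R] with the display of the values of random variables,
    which differs from the display of [measurableTypeR R]. *)
Definition borel_lebesgue (A : set R) : \bar R := @lebesgue_measure R A.

HB.instance Definition _ := isMeasure.Build _ R R borel_lebesgue
  (measure0 (@lebesgue_measure R)) (measure_ge0 (@lebesgue_measure R))
  (@measure_semi_sigma_additive _ _ _ (@lebesgue_measure R)).

Lemma integral_borel_lebesgue (A : set R) (f : R -> \bar R) :
  measurable A -> measurable_fun setT f -> (forall x, 0 <= f x) ->
  \int[borel_lebesgue]_(x in A) f x = \int[lebesgue_measure]_(x in A) f x.
Proof.
move=> mA mf f0.
have := ge0_integral_pushforward mid (@lebesgue_measure R) mA (measurable_funTS mf)
  (fun x _ => f0 x).
by move=> <-; apply: eq_measure_integral.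
Qed.

Lemma eq_poisson_point_process d d' (T : measurableType d) (E : measurableType d')
    (P : probability T R) (U : nat -> {RV P >-> E}) (mu1 mu2 : set E -> \bar R) :
  (forall A, measurable A -> mu1 A = mu2 A) ->
  poisson_point_process P U mu1 -> poisson_point_process P U mu2.
Proof.
move=> e [h1 h2 h3]; split => // [A mA|A mA]; rewrite -e//.
- exact: h1.
- exact: h2.
Qed.

End borel_lebesgue.

Section maximum_process.
Context {R : realType} (alpha : R -> R) (a b : R).
Hypotheses (a0 : 0 < a) (alpha_bnd : forall z, a <= alpha z <= b)
  (malpha : measurable_fun setT alpha).
Context d0 (Omega0 : measurableType d0)
    (P0 : probability Omega0 R) (L : R -> {RV P0 >-> R})
    (L_levy : levy_process P0 L)
    (L_exp : ('E_P0[fun w => expR (L 1%R w)] = 1)%E)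
    d (Omega : measurableType d) (P : probability Omega R)
    (U : nat -> {RV P >-> R})
    (U_poisson : poisson_point_process P U (intensity alpha))
    (Lc : nat -> R -> {RV P >-> R})
    (Lc_cadlag : forall i w, cadlag (fun t => Lc i t w))
    (Lc_law : forall i, same_process_law P P0 (Lc i) L)
    (Lc_indep : independent_systems P (fun o : option nat =>
       if o is Some i
       then generated_sigma_algebra [set t : R | 0 <= t] (Lc i)
       else generated_sigma_algebra [set: nat] U)).
Notation mu := (@lebesgue_measure R).
Let X i t w := time_changed alpha (fun s => Lc i s w) (U i w) t.
Let Z := max_process X.
Let f (x : R) : \bar R := (alpha x * expR (- x))%:E.

Let alpha0 x : 0 < alpha x.
Proof. by have /andP[h _] := alpha_bnd x; exact: lt_le_trans h. Qed.

Let mf : measurable_fun setT f.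
Proof.
apply/measurable_EFinP; apply: measurable_funM => //.
by apply: continuous_measurable_fun => x; apply: continuous_comp;
  [exact: opp_continuous|exact: continuous_expR].
Qed.

Let f0 x : (0 <= f x)%E.
Proof. by rewrite lee_fin mulr_ge0// ltW. Qed.

Let U_borel :
  poisson_point_process P U (fun A => \int[borel_lebesgue]_(x in A) f x)%E.
Proof.
apply: eq_poisson_point_process U_poisson => A mA.
by rewrite integral_borel_lebesgue.
Qed.

Let ffin x : f x \is a fin_num. Proof. by []. Qed.

Let XE i t w : 0 <= t -> X i t w = process_value alpha ((U i w, path_of (Lc i) w), t).
Proof.
move=> t0; symmetry.
exact: (process_valueE a0 alpha_bnd malpha (U i w) (Lc_cadlag i w) t0).
Qed.

(** The density of the intensity is at most [b * exp (- x)], and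
    [exceed_before_integral_lty] bounds the rest. *)
Lemma mark_intensity_lty (A : set (R * path_space R)) (u S : R) :
  measurable A -> 0 < S ->
  (forall l x, cadlag l -> A (x, l) -> exceed_before u S (x, l)) ->
  (mark_intensity L borel_lebesgue f A < +oo)%E.
Proof.
move=> mA S0 AS; have mpL := measurable_path_of L.
have mE := @measurable_exceed_before R u S S0.
have lcad w : cadlag (path_of L w) by have [_ + _ _] := L_levy; exact.
have h0 x : (0 <= (expR (- x))%:E * P0 [set w | exceed_before u S (x, path_of L w)])%E.
  by rewrite mule_ge0// lee_fin.
have mhA : measurable_fun setT (fun x : R => P0 [set w | A (x, path_of L w)] * f x)%E.
  apply: emeasurable_funM => //; exact: (measurable_section_measure P0 mpL mA).
have hA0 x : (0 <= P0 [set w | A (x, path_of L w)] * f x)%E by rewrite mule_ge0.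
rewrite /mark_intensity integral_borel_lebesgue//.
have b0 : 0 <= b by have /andP[h1 h2] := alpha_bnd 0; exact: le_trans (ltW (lt_le_trans a0 h1)) h2.
have mw : measurable_fun setT (fun x : R => (expR (- x))%:E).
  apply/measurable_EFinP; apply: continuous_measurable_fun => x.
  by apply: continuous_comp; [exact: opp_continuous|exact: continuous_expR].
have mh : measurable_fun setT (fun x : R =>
    (expR (- x))%:E * P0 [set w | exceed_before u S (x, path_of L w)])%E.
  apply: emeasurable_funM => //.
  exact: (measurable_section_measure P0 mpL mE).
apply: (@le_lt_trans _ _ (\int[mu]_x (b%:E * ((expR (- x))%:E *
    P0 [set w | exceed_before u S (x, path_of L w)])))%E).
  apply: ge0_le_integral => //.
  - exact: measurable_funeM.
  - move=> x _; rewrite muleC /f EFinM -!muleA.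
    have ab : alpha x <= b by have /andP[] := alpha_bnd x.
    apply: lee_pmul; rewrite ?lee_fin//.
    + exact: ltW.
    + by rewrite mule_ge0// lee_fin.
    apply: lee_wpmul2l; first by rewrite lee_fin.
    apply: le_measure; rewrite ?inE.
    + exact: measurable_preimage_pair.
    + exact: measurable_preimage_pair.
    by move=> w; exact: AS.
rewrite (ge0_integralZlT mu mh h0)//.
rewrite lte_mul_pinfty//.
exact: (exceed_before_integral_lty L_levy L_exp u S0).
Qed.

Lemma finitely_many_above : {ae P, forall w, forall z S : R,
  finite_set [set i | exists2 t, 0 <= t < S & z < X i t w]}.
Proof.
have H n k : {ae P, forall w,
    finite_set [set i | exists2 t, 0 <= t < k.+1%:R & - n%:R < X i t w]}.
  have S0 : 0 < k.+1%:R / a by rewrite divr_gt0.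
  have mE := @measurable_exceed_before R (- n%:R) _ S0.
  have I := @mark_intensity_lty (exceed_before (- n%:R) (k.+1%:R / a)) _ _ mE S0
    (fun _ _ _ => id).
  have := finitely_many_hits Lc_law Lc_indep mf f0 U_borel mE I.
  apply: filterS => w; apply: sub_finite_set => i [t /andP[t0 tS] zX].
  exact: (time_changed_exceed a0 alpha_bnd malpha (Lc_cadlag i w) t0 tS zX).
have := ae_foralln (fun n => ae_foralln (H n)).
apply: filterS => w h z S.
apply: (sub_finite_set _ (h (Num.truncn `|z|).+1 (Num.truncn `|S|))).
move=> i [t /andP[t0 tS] zX]; exists t.
  rewrite t0/=; apply: (lt_le_trans tS); apply: (le_trans (ler_norm _)).
  by apply: ltW; exact: truncnS_gt.
apply: le_lt_trans zX; rewrite lerNl; apply: (@le_trans _ _ `|z|).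
  by rewrite -normrN ler_norm.
by apply: ltW; exact: truncnS_gt.
Qed.

Lemma maximum_cadlag : {ae P, forall w,
  (forall t, 0 <= t -> is_max [set X i t w | i in [set: nat]] (Z t w)) /\
  cadlag (fun t => Z t w)}.
Proof.
have := finitely_many_above; apply: filterS => w h; split.
  by move=> t t0; exact: (@locally_finite_is_max R (fun i t => X i t w) h t t0).
apply: (@locally_finite_cadlag R (fun i t => X i t w) h) => i.
exact: (time_changed_cadlag a0 alpha_bnd malpha (U i w) (Lc_cadlag i w)).
Qed.

Lemma maximum_continuous : {ae P0, forall w, continuous_path (fun t => L t w)} ->
  {ae P, forall w, continuous_path (fun t => Z t w)}.
Proof.
move=> Lcont.
have Lcc := ae_foralln (fun i => continuous_path_transfer (Lc_law i) (Lc_cadlag i) Lcont).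
apply: filterS2 finitely_many_above Lcc => w h hc.
apply: (@locally_finite_continuous R (fun i t => X i t w) h) => i.
exact: (time_changed_continuous a0 alpha_bnd malpha (Lc_cadlag i w) (hc i)).
Qed.

Let mX i t : 0 <= t -> measurable_fun setT (X i t).
Proof.
move=> t0.
have mz : measurable_fun setT (fun w => ((U i w, path_of (Lc i) w), t)).
  apply: measurable_fun_pair => //; apply: measurable_fun_pair => //.
  exact: measurable_path_of.
have := measurableT_comp (measurable_process_value a0 alpha_bnd malpha) mz.
by apply: eq_measurable_fun => w _; rewrite /= XE.
Qed.

(** The maximum is attained almost surely only, so [Z] is also described on the
    exceptional set, where the supremum of an unbounded set is 0, like [fine] of
    an infinite value. *)
Lemma measurable_maximum t : 0 <= t -> measurable_fun setT (Z t).
Proof.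
move=> t0.
have m : measurable_fun setT (fun w => fine (ereal_sup [set (X i t w)%:E | i in [set: nat]])).
  apply: (measurableT_comp (f := @fine R)) => //.
  have := @measurable_fun_esups _ _ _ setT (fun i w => (X i t w)%:E) _ 0%N.
  move=> /(_ (fun i => (measurable_EFinP _ _).2 (mX i t0))).
  apply: eq_measurable_fun => w _; rewrite /esups /sdrop; congr ereal_sup.
  by apply/seteqP; split => _ [i _ <-]; exists i.
move: m; apply: eq_measurable_fun => w _; rewrite /Z /max_process.
set A := [set X i t w | i in [set: nat]].
have A0 : A !=set0 by exists (X 0%N t w), 0%N.
have -> : [set (X i t w)%:E | i in [set: nat]] = EFin @` A.
  by rewrite image_comp.
have [ubA|nubA] := pselect (has_ubound A); first by rewrite ereal_sup_EFin.
rewrite sup_out; last by case.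
suff -> : ereal_sup (EFin @` A) = +oo%E by [].
apply: eq_infty => M.
have [x Ax Mx] : exists2 x, A x & M < x.
  apply: contrapT => nM; apply: nubA; exists M => x Ax.
  by rewrite leNgt; apply/negP => Mx; apply: nM; exists x.
apply: (@le_trans _ _ x%:E); first by rewrite lee_fin ltW.
by apply: ereal_sup_ubound; exists x.
Qed.

Section finite_dimensional_law.
Variables (n : nat) (t : n.-tuple R) (s : seq 'I_n) (z : 'I_n -> R).
Hypothesis t_ge0 : forall k, 0 <= tnth t k.

Let E (v : (R * path_space R) * R) : bool :=
  has (fun k => z k < process_value alpha (v.1, tnth t k + v.2)) s.

Let A h : set (R * path_space R) := [set y | E (y, h)].

Let mE : measurable_fun setT E.
Proof.
rewrite /E; elim: s => [|k r IH] /=; first exact: measurable_cst.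
apply: measurable_or => //; apply: measurable_fun_ltr => //.
apply: (measurableT_comp (measurable_process_value a0 alpha_bnd malpha)).
by apply: measurable_fun_pair => //; exact: measurable_funD.
Qed.

Let mEh h : measurable_fun setT (fun y => E (y, h)).
Proof. exact: (measurableT_comp mE (measurable_fun_pair _ _)). Qed.

Let mA h : measurable (A h).
Proof.
have : measurable (setT `&` (fun y => E (y, h)) @^-1` [set true]) by exact: mEh.
by rewrite setTI.
Qed.

(** [E] depends on the starting point and path through the time-changed process
    only. *)
Let flowE l x u v : cadlag l -> 0 < u -> 0 <= v ->
  E ((x + l u, shift_path u l), v) = E ((x, l), clock alpha l x u + v).
Proof.
move=> cl u0 v0; apply: eq_has => k; congr (_ < _) => /=.
have cu : 0 <= clock alpha l x u by exact: (clock_path_ge0 a0 alpha_bnd malpha x cl (ltW u0)).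
rewrite (process_valueE a0 alpha_bnd malpha _ (cadlag_shift (ltW u0) cl)) ?addr_ge0//.
rewrite (process_valueE a0 alpha_bnd malpha _ cl) ?addr_ge0//.
rewrite (time_changed_shift a0 alpha_bnd malpha _ cl (ltW u0)) ?addr_ge0//.
by rewrite addrCA.
Qed.

Let G h := path_integral L (fun y => (if E (y, h) then alpha y.1 else 0)%:E).

Let GE h : mark_intensity L borel_lebesgue f (A h) = G h.
Proof.
have mpL := measurable_path_of L.
have mhA : measurable_fun setT (fun x : R => P0 [set w | A h (x, path_of L w)] * f x)%E.
  by apply: emeasurable_funM => //; exact: (measurable_section_measure P0 mpL (mA h)).
rewrite /mark_intensity integral_borel_lebesgue//; last first.
  by move=> x; rewrite mule_ge0.
rewrite /G path_integralE.
- apply: eq_integral => x _.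
  rewrite /f mulrC EFinM muleCA; congr (_ * _)%E.
  have mAx := measurable_preimage_pair mpL x (mA h).
  transitivity (\int[P0]_w ((alpha x)%:E * (\1_[set w | A h (x, path_of L w)] w)%:E))%E.
    rewrite ge0_integralZlT.
    + by rewrite (integral_indic P0 measurableT mAx) setIT muleC.
    + by apply/measurable_EFinP; exact: measurable_indic mAx.
    + by move=> w; rewrite lee_fin.
    + by rewrite lee_fin ltW.
  apply: eq_integral => w _; rewrite -EFinM indicE; congr EFin.
  have [h1|h1] := boolP (E _).
    by rewrite mem_set ?mulr1.
  by rewrite memNset ?mulr0//; apply/negP.
- apply/measurable_EFinP; apply: measurable_fun_ifT => //.
  exact: (measurableT_comp malpha).
- by move=> y; rewrite lee_fin; case: ifP => // _; exact: ltW.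
Qed.

Let G0_lty : (G 0 < +oo)%E.
Proof.
pose u := - \big[Num.max/0]_(k < n) (- z k).
pose S := \big[Num.max/0]_(k < n) tnth t k.
have S0 : 0 <= S by apply: bigmax_ge_id.
rewrite -GE; apply: (@mark_intensity_lty _ u ((S + 1) / a)) => //.
  by rewrite divr_gt0// ltr_wpDl.
move=> l x cl /hasP[k ks /=]; rewrite addr0.
rewrite (process_valueE a0 alpha_bnd malpha _ cl)// => zk.
apply: (time_changed_exceed a0 alpha_bnd malpha cl (t_ge0 k)).
  by apply: (@le_lt_trans _ _ S); [exact: le_bigmax|rewrite ltrDl].
by apply: le_lt_trans zk; rewrite lerNl; exact: le_bigmax.
Qed.

Let G_inv h : 0 <= h -> G h = G 0.
Proof.
move=> h0.
exact: (alpha_weighted_invariance a0 alpha_bnd malpha L_levy L_exp mE flowE h0 G0_lty).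
Qed.

(** Almost surely the maximum is attained, so it exceeds one of the levels exactly
    when one of the marked points falls in [A h]; the intensity of this region
    does not depend on [h]. *)
Lemma orthant_probability h : 0 <= h ->
  P [set w | forall k, k \in s -> Z (tnth t k + h) w <= z k] =
  (expR (- fine (G 0)))%:E.
Proof.
move=> h0.
have Ah_lty : (mark_intensity L borel_lebesgue f (A h) < +oo)%E.
  by rewrite GE G_inv.
rewrite -(G_inv h0) -GE.
rewrite -(avoidance_probability Lc_law Lc_indep mf f0 ffin U_borel (mA h) Ah_lty).
apply: ae_eq_measure.
- rewrite (_ : [set w | _] = \bigcap_(k in [set` s])
    [set w | Z (tnth t k + h) w <= z k]); last first.
    by apply/seteqP; split => w /= hw k ks; exact: hw.
  apply: fin_bigcap_measurable; first exact: finite_seq.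
  move=> k _; have th : 0 <= tnth t k + h by rewrite addr_ge0.
  have := measurable_maximum th measurableT (measurable_itv `]-oo, z k]).
  by rewrite setTI; congr measurable; apply/seteqP; split => w /=; rewrite in_itv.
- rewrite (_ : [set w | _] = \bigcap_(i in [set: nat])
    ~` [set w | A h (U i w, path_of (Lc i) w)]); last first.
    by apply/seteqP; split => w /= hw i; [move=> _|]; exact: hw.
  apply: bigcap_measurableType => i _; apply: measurableC.
  exact: (measurable_mark_hit U Lc (mA h)).
apply: filterS maximum_cadlag => w [hmax _].
have th k : 0 <= tnth t k + h by rewrite addr_ge0.
split=> /= [hw i /hasP[k ks /=]|hw k ks].
  rewrite -XE// => zX; have [_ ub] := hmax _ (th k).
  have := le_trans (ub _ (ex_intro2 _ _ i Logic.I erefl)) (hw k ks).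
  by rewrite leNgt zX.
have [[i _ <-] _] := hmax _ (th k).
rewrite leNgt; apply/negP => zX; apply: (hw i); apply/hasP; exists k => //=.
by rewrite -XE.
Qed.

Lemma orthant_probability_shift h : 0 <= h ->
  P [set w | forall k, k \in s -> Z (tnth t k) w <= z k] =
  P [set w | forall k, k \in s -> Z (tnth t k + h) w <= z k].
Proof.
move=> h0; rewrite (orthant_probability h0) -(orthant_probability (lexx 0)).
by congr (P _); apply/seteqP; split => w /= hw k ks; have := hw k ks; rewrite addr0.
Qed.

End finite_dimensional_law.

Lemma maximum_stationary : stationary P Z.
Proof.
split=> [t t0|h h0 n t st tge0]; first exact: measurable_maximum.
have t0 k : 0 <= tnth t k by move/allP : tge0; apply; exact: mem_tnth.
have mtv (Y : R -> Omega -> R) : (forall k, measurable_fun setT (Y (tnth t k))) ->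
    measurable_fun setT (time_vector Y t).
  move=> mY; apply/measurable_fun_tnthP => k.
  by apply: eq_measurable_fun (mY k) => w _; rewrite /= tnth_mktuple.
apply: same_law_orthants.
- by apply: mtv => k; exact: measurable_maximum.
- by apply: mtv => k; apply: measurable_maximum; rewrite addr_ge0.
move=> s z.
have e (Y : R -> Omega -> R) :
    [set w | forall k, k \in s -> tnth (time_vector Y t w) k <= z k] =
    [set w | forall k, k \in s -> Y (tnth t k) w <= z k].
  by apply/seteqP; split => w /= hw k ks; have := hw k ks; rewrite tnth_mktuple.
transitivity (P [set w | forall k, k \in s -> Z (tnth t k) w <= z k]).
  by congr (P _); exact: e.
rewrite (orthant_probability_shift s z t0 h0).
by congr (P _); symmetry; exact: (e (fun u => Z (u + h))).
Qed.

End maximum_process.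

Lemma rate_bounds {R : realType} (alpha : R -> R) :
  (forall z, 0 < alpha z) ->
  (0%:E < ereal_inf [set (alpha z)%:E | z in [set: R]])%E ->
  (ereal_sup [set (alpha z)%:E | z in [set: R]] < +oo)%E ->
  exists a b, 0 < a /\ forall z, a <= alpha z <= b.
Proof.
move=> alpha0 hinf hsup.
have lei z : (ereal_inf [set (alpha z)%:E | z in [set: R]] <= (alpha z)%:E)%E.
  by apply: ereal_inf_lbound; exists z.
have les z : ((alpha z)%:E <= ereal_sup [set (alpha z)%:E | z in [set: R]])%E.
  by apply: ereal_sup_ubound; exists z.
move: hinf hsup lei les.
case: (ereal_inf _) => [a| |]; case: (ereal_sup _) => [b| |] //= a0 _ lei les.
- exists a, b; split; first by rewrite -lte_fin.
  by move=> z; rewrite -!lee_fin lei les.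
- by have := les 0; rewrite leeNy_eq.
- by have := lei 0; rewrite leye_eq.
- by have := lei 0; rewrite leye_eq.
Qed.

Theorem theorem4p3 (R : realType) (alpha : R -> R)
    (alpha_pos : forall z, 0 < alpha z)
    (alpha_cont : continuous alpha)
    (alpha_inf : (0%:E < ereal_inf [set (alpha z)%:E | z in [set: R]])%E)
    (alpha_sup : (ereal_sup [set (alpha z)%:E | z in [set: R]] < +oo)%E)
    (alpha_lim : alpha z @[z --> +oo] --> (1 : R))
    (d0 : measure_display) (Omega0 : measurableType d0)
    (P0 : probability Omega0 R) (L : R -> {RV P0 >-> R})
    (L_levy : levy_process P0 L)
    (L_exp : ('E_P0[fun w => expR (L 1%R w)] = 1)%E)
    (d : measure_display) (Omega : measurableType d) (P : probability Omega R)
    (U : nat -> {RV P >-> R})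
    (U_poisson : poisson_point_process P U (intensity alpha))
    (Lc : nat -> R -> {RV P >-> R})
    (Lc_cadlag : forall i w, cadlag (fun t => Lc i t w))
    (Lc_law : forall i, same_process_law P P0 (Lc i) L)
    (Lc_indep : independent_systems P (fun o : option nat =>
       if o is Some i
       then generated_sigma_algebra [set t : R | 0 <= t] (Lc i)
       else generated_sigma_algebra [set: nat] U)) :
  let X i t w := time_changed alpha (fun s => Lc i s w) (U i w) t in
  let Z := max_process X in
  [/\ {ae P, forall w,
        (forall t, 0 <= t -> is_max [set X i t w | i in [set: nat]] (Z t w)) /\
        cadlag (fun t => Z t w)},
      stationary P Z &
      {ae P0, forall w, continuous_path (fun t => L t w)} ->
      {ae P, forall w, continuous_path (fun t => Z t w)}].
Proof.
have [a [b [a0 alpha_bnd]]] := rate_bounds alpha_pos alpha_inf alpha_sup.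
have malpha : measurable_fun setT alpha by exact: continuous_measurable_fun.
split.
- exact: (maximum_cadlag a0 alpha_bnd malpha L_levy L_exp U_poisson
    Lc_cadlag Lc_law Lc_indep).
- exact: (maximum_stationary a0 alpha_bnd malpha L_levy L_exp U_poisson
    Lc_cadlag Lc_law Lc_indep).
- exact: (maximum_continuous a0 alpha_bnd malpha L_levy L_exp U_poisson
    Lc_cadlag Lc_law Lc_indep).
Qed.
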